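(* Let $d\ge2$, let $X_n$ be finite $(d-1)$-connected uniform $d$-complexes and $X$ a countable $(d-1)$-connected uniform $d$-complex, all with $(d-1)$-degrees bounded by a common constant, such that $X_n\to X$. Suppose one of the following holds: (1) $0\notin\operatorname{Spec}(\Delta^+_X|_{Z_{d-1}(X)})$, i.e. $\lambda(X)\neq0$; (2) $0$ is a non-isolated point of $\operatorname{Spec}(\Delta^+_X|_{Z_{d-1}(X)})$; (3) the $(d-2)$-cells of all $X_n$ have degrees bounded by a common constant, and $\inf_n\lambda_{d-2}(X_n)>0$. Then $\liminf_{n\to\infty}\lambda(X_n)\le\lambda(X)$.
   Context: A simplicial complex is a collection of finite subsets (cells) of a vertex set closed under taking subsets (the empty set is a cell); a $j$-cell has $j+1$ vertices; $X^j$ is the set of $j$-cells; the degree $\deg\sigma$ of a $j$-cell is the number of $(j+1)$-cells containing it; a $d$-complex has maximal cell dimension $d$ and is uniform if every cell lies in a $d$-cell. For $j\ge1$ each $j$-cell has two orientations (orderings of its vertices modulo even permutations); $X^j_\pm$ is the set of oriented $j$-cells, $\bar\sigma$ the opposite orientation. The oriented cell $[v_0,\dots,v_j]$ induces on its face $\{v_0,\dots,v_j\}\setminus\{v_i\}$ the orientation $(-1)^i[v_0,\dots,\widehat{v_i},\dots,v_j]$ ($-1$ meaning reversal). For $v\notin\sigma$ write $v\triangleleft\sigma$ if $\sigma\cup\{v\}\in X$, and $v\sigma=[v,\sigma_0,\dots,\sigma_k]$ for $\sigma=[\sigma_0,\dots,\sigma_k]$. $\Omega^j(X)$ is the space of real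 functions $f$ on $X^j_\pm$ with $f(\bar\sigma)=-f(\sigma)$ ($j=0$: functions on vertices; $j=-1$: functions on $\{\emptyset\}$). Two oriented $(d-1)$-cells are neighbours, $\sigma\sim\sigma'$, if some oriented $d$-cell $\tau$ has both $\sigma$ and $\overline{\sigma'}$ as faces with the induced orientations; $X$ is $(d-1)$-connected if any two oriented $(d-1)$-cells are joined by a chain of neighbours. Norms: on $\Omega^{d-1}$, $\|f\|^2=\sum_{\sigma\in X^{d-1}}f(\sigma)^2/\deg\sigma$; on $\Omega^k$, $k\neq d-1$, $\|f\|^2=\sum_{\sigma\in X^k}f(\sigma)^2$; $\Omega^k_{L^2}$ denotes the forms of finite norm. Boundary $\partial_k:\Omega^k\to\Omega^{k-1}$, $(\partial_kf)(\sigma)=\sum_{v\triangleleft\sigma}f(v\sigma)$. Coboundary (pointwise), writing $\sigma\setminus\sigma_i=[\sigma_0,\dots,\widehat{\sigma_i},\dots,\sigma_k]$: $(\delta_{d-1}f)(\sigma)=\deg\sigma\sum_{i=0}^{d-1}(-1)^if(\sigma\setminus\sigma_i)$ for $f\in\Omega^{d-2}$, and $(\delta_df)(\sigma)=\sum_{i=0}^d(-1)^if(\sigma\setminus\sigma_i)/\deg(\sigma\setminus\sigma_i)$. Upper Laplacian $\Delta^+_X=\partial_d\delta_d$ on $\Omega^{d-1}_{L^2}$: $(\Delta^+f)(\sigma)=f(\sigma)-\sum_{\sigma'\sim\sigma}f(\sigma')/\deg\sigma'$. $B^{d-1}(X)=\{\delta_{d-1}f:f\in\Omega^{d-2}_{L^2}\}\cap\Omega^{d-1}_{L^2}$,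 $Z_{d-1}(X)=(B^{d-1})^\perp$ (a $\Delta^+$-invariant subspace of $\Omega^{d-1}_{L^2}$; for finite $X$ it equals $\ker\partial_{d-1}$), and the spectral gap is $\lambda(X)=\min\operatorname{Spec}(\Delta^+_X|_{Z_{d-1}(X)})$. For a finite complex $Y$, $\lambda_{d-2}(Y)=\min\operatorname{Spec}\big(\partial_{d-1}\delta_{d-1}|_{\ker\partial_{d-2}}\big)$, where $\partial_{d-1}\delta_{d-1}$ acts on $\Omega^{d-2}(Y)$. The distance between $(d-1)$-cells $\sigma,\sigma'$ is the minimal $n$ such that there are $(d-1)$-cells $\sigma=\tau_0,\dots,\tau_n=\sigma'$ with $\tau_i\cup\tau_{i+1}\in X^d$. The ball $B_R(X,\sigma)$ is the subcomplex consisting of the $(d-1)$-cells at distance $\le R$ from $\sigma$, the $d$-cells all of whose $(d-1)$-faces are at distance $\le R$, and all subsets of these. $X_n\to X$ means: there are $\sigma_n\in X_n^{d-1}$, $\sigma\in X^{d-1}$ such that for every $R$ there is $N$ such that for $n\ge N$ there is a simplicial isomorphism $B_R(X_n,\sigma_n)\to B_R(X,\sigma)$ sending $\sigma_n$ to $\sigma$. *)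

(* Defs.v *)
From Stdlib Require Import Reals Lra List Permutation Sorted Classical ClassicalEpsilon Relations.
Import ListNotations.
Open Scope R_scope.

(** * Simplicial complexes on the countable vertex set nat.
    A cell {v_0,...,v_j} is represented by any duplicate-free list of its
    vertices; an ordering of the list is an oriented cell.  A j-cell is a
    cell-list of length j+1. *)
Record complex := mkComplex {
  cell : list nat -> Prop;
  cell_nodup : forall s, cell s -> NoDup s;
  cell_perm : forall s t, Permutation s t -> cell s -> cell t;
  cell_sub : forall s t, cell s -> NoDup t -> incl t s -> cell t;
  cell_nil : cell []
}.

(** cell with k vertices (i.e. a (k-1)-cell), as an oriented cell *)
Definition dcell (X : complex) (k : nat) (s : list nat) : Prop :=
  cell X s /\ length s = k.

(** canonical representative of an unoriented cell: increasing list *)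
Definition canon (X : complex) (k : nat) (s : list nat) : Prop :=
  dcell X k s /\ Sorted lt s.

Definition finite_complex (X : complex) : Prop :=
  exists N, forall s, cell X s -> forall v, In v s -> (v < N)%nat.

Definition uniform_dcomplex (d : nat) (X : complex) : Prop :=
  (forall s, cell X s -> (length s <= S d)%nat) /\
  (exists s, dcell X (S d) s) /\
  (forall s, cell X s -> exists t, dcell X (S d) t /\ incl s t).

Inductive adj_swap : list nat -> list nat -> Prop :=
  | AdjSwap l1 a b l2 : adj_swap (l1 ++ a :: b :: l2) (l1 ++ b :: a :: l2).

Inductive perm_par : bool -> list nat -> list nat -> Prop :=
  | pp_refl s : perm_par false s s
  | pp_step b s t u : perm_par b s t -> adj_swap t u -> perm_par (negb b) s u.

Definition rem (i : nat) (s : list nat) : list nat := firstn i s ++ skipn (S i) s.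

Definition induced_face (sigma tau : list nat) : Prop :=
  exists i, (i < length tau)%nat /\ perm_par (Nat.odd i) sigma (rem i tau).

Definition nbr (d : nat) (X : complex) (sigma sigma' : list nat) : Prop :=
  dcell X d sigma /\ dcell X d sigma' /\
  exists tau, dcell X (S d) tau /\ induced_face sigma tau /\
    exists sigma'', perm_par true sigma' sigma'' /\ induced_face sigma'' tau.

(** (d-1)-connected (chains of neighbours; lists representing the same
    oriented cell are identified) *)
Definition connected_top (d : nat) (X : complex) : Prop :=
  forall sigma sigma', dcell X d sigma -> dcell X d sigma' ->
    clos_refl_trans (list nat)
      (fun a b => nbr d X a b \/ (dcell X d a /\ perm_par false a b)) sigma sigma'.

Definition lsum (l : list R) : R := fold_right Rplus 0 l.

Definition enumerates (P : nat -> Prop) (L : list nat) : Prop :=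
  NoDup L /\ forall v, In v L <-> P v.

(** sum of g over a finite set P of vertices (0 if P is infinite;
    independent of the enumeration chosen) *)
Definition fsum (P : nat -> Prop) (g : nat -> R) : R :=
  match excluded_middle_informative (exists L, enumerates P L) with
  | left H => lsum (map g (proj1_sig (constructive_indefinite_description _ H)))
  | right _ => 0
  end.

(** number of elements of a finite set P of vertices (0 if infinite) *)
Definition fcard (P : nat -> Prop) : nat :=
  match excluded_middle_informative (exists L, enumerates P L) with
  | left H => length (proj1_sig (constructive_indefinite_description _ H))
  | right _ => O
  end.

Definition nbv (X : complex) (s : list nat) (v : nat) : Prop :=
  ~ In v s /\ cell X (v :: s).

Definition deg (X : complex) (s : list nat) : nat := fcard (nbv X s).

(** deg s <= D (meaningful also for cells of infinite degree) *)
Definition deg_le (X : complex) (s : list nat) (D : nat) : Prop :=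
  forall L, NoDup L -> (forall v, In v L -> nbv X s v) -> (length L <= D)%nat.

Definition form := list nat -> R.
Definition zero_form : form := fun _ => 0.

Definition is_form (X : complex) (k : nat) (f : form) : Prop :=
  forall s t, dcell X k s -> perm_par true s t -> f t = - f s.

Definition feq (X : complex) (k : nat) (f g : form) : Prop :=
  forall s, dcell X k s -> f s = g s.

Definition bdry (X : complex) (f : form) : form :=
  fun s => fsum (nbv X s) (fun v => f (v :: s)).

(** δ_d (on d-cells τ, f a (d-1)-form) *)
Definition delta_top (X : complex) (f : form) : form :=
  fun tau => lsum (map (fun i => (-1) ^ i * f (rem i tau) / INR (deg X (rem i tau)))
                       (seq 0 (length tau))).

(** δ_{d-1} (on (d-1)-cells σ, f a (d-2)-form) *)
Definition delta_low (X : complex) (f : form) : form :=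
  fun sigma => INR (deg X sigma) *
    lsum (map (fun i => (-1) ^ i * f (rem i sigma)) (seq 0 (length sigma))).

Definition lapl_up (X : complex) (f : form) : form := bdry X (delta_top X f).

(** * Countable sums of nonnegative terms and L^2 *)
Definition psums (P : list nat -> Prop) (g : list nat -> R) (x : R) : Prop :=
  exists L, NoDup L /\ (forall s, In s L -> P s) /\ x = lsum (map g L).

Definition HasSum (P : list nat -> Prop) (g : list nat -> R) (S : R) : Prop :=
  is_lub (psums P g) S.

Definition wsq (X : complex) (f : form) : list nat -> R :=
  fun s => (f s) ^ 2 / INR (deg X s).

Definition L2_top (d : nat) (X : complex) (f : form) : Prop :=
  exists S, HasSum (canon X d) (wsq X f) S.

Definition L2_low (k : nat) (X : complex) (f : form) : Prop :=
  exists S, HasSum (canon X k) (fun s => (f s) ^ 2) S.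

(** orthogonality in Omega^{d-1}_{L^2} (polarization: ‖f+h‖ = ‖f-h‖) *)
Definition orth_top (d : nat) (X : complex) (f h : form) : Prop :=
  forall S1 S2, HasSum (canon X d) (wsq X (fun s => f s + h s)) S1 ->
                HasSum (canon X d) (wsq X (fun s => f s - h s)) S2 -> S1 = S2.

Definition Zspace (d : nat) (X : complex) (f : form) : Prop :=
  is_form X d f /\ L2_top d X f /\
  forall g, is_form X (d - 1) g -> L2_low (d - 1) X g ->
    L2_top d X (delta_low X g) -> orth_top d X f (delta_low X g).

(** * Spectrum (real part) of an operator A restricted to an invariant
    subspace H, forms identified by E: x is in the spectrum iff A - x is not
    a bijection of H. *)
Definition bij_on (H : form -> Prop) (E : form -> form -> Prop) (T : form -> form) : Prop :=
  (forall f, H f -> E (T f) zero_form -> E f zero_form) /\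
  (forall g, H g -> exists f, H f /\ E (T f) g).

Definition in_spec (H : form -> Prop) (E : form -> form -> Prop) (A : form -> form) (x : R) : Prop :=
  ~ bij_on H E (fun f s => A f s - x * f s).

Definition is_min_spec (H : form -> Prop) (E : form -> form -> Prop) (A : form -> form) (m : R) : Prop :=
  in_spec H E A m /\ forall x, in_spec H E A x -> m <= x.

Definition specZ (d : nat) (X : complex) (x : R) : Prop :=
  in_spec (Zspace d X) (feq X d) (lapl_up X) x.

Definition is_lambda (d : nat) (X : complex) (m : R) : Prop :=
  is_min_spec (Zspace d X) (feq X d) (lapl_up X) m.

Definition Kspace (d : nat) (Y : complex) (f : form) : Prop :=
  is_form Y (d - 1) f /\ feq Y (d - 2) (bdry Y f) zero_form.

Definition is_lambda_low (d : nat) (Y : complex) (m : R) : Prop :=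
  is_min_spec (Kspace d Y) (feq Y (d - 1)) (fun f => bdry Y (delta_low Y f)) m.

Definition adjc (d : nat) (X : complex) (a b : list nat) : Prop :=
  exists t, dcell X (S d) t /\ incl a t /\ incl b t.

Fixpoint within (d : nat) (X : complex) (R : nat) (a b : list nat) : Prop :=
  match R with
  | O => Permutation a b
  | S r => within d X r a b \/
           exists c, within d X r a c /\ dcell X d c /\ dcell X d b /\ adjc d X c b
  end.

Definition ball (d : nat) (X : complex) (R : nat) (sigma : list nat) (s : list nat) : Prop :=
  NoDup s /\ exists t, incl s t /\
    ((dcell X d t /\ within d X R sigma t) \/
     (dcell X (S d) t /\ forall u, NoDup u -> incl u t -> length u = d -> within d X R sigma u)).

Definition simp_iso (B1 B2 : list nat -> Prop) (phi : nat -> nat) : Prop :=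
  (forall s, B1 s -> B2 (map phi s)) /\
  (forall t, B2 t -> exists s, B1 s /\ Permutation (map phi s) t) /\
  (forall u v, B1 [u] -> B1 [v] -> phi u = phi v -> u = v).

Definition converges (d : nat) (Xs : nat -> complex) (X : complex) : Prop :=
  exists (sigmas : nat -> list nat) (sigma : list nat),
    (forall n, dcell (Xs n) d (sigmas n)) /\ dcell X d sigma /\
    forall R : nat, exists N : nat, forall n, (N <= n)%nat ->
      exists phi, simp_iso (ball d (Xs n) R (sigmas n)) (ball d X R sigma) phi /\
                  Permutation (map phi (sigmas n)) sigma.

(* Main.v *)
From Stdlib Require Import Reals Lra Lia List Permutation Sorted Mergesort FinFun
  Classical ClassicalEpsilon Relations FunctionalExtensionality PropExtensionality.
From Coquelicot Require Import Rcomplements Hierarchy Rbar Lim_seq.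
Require Import Defs.
Import ListNotations.
Open Scope R_scope.

(** All sums run over ordered cells, so that moving the [i]-th vertex of a cell to the front is a
    bijection of the index set. This change of variables makes the boundary adjoint, up to a
    constant, to the weighted coboundaries, of which [delta_top] and [delta_low] are two instances.

    If [x] is in the spectrum on [Zspace d X], there are forms [f] with [lapl_up X f] close to
    [x f]; otherwise [T = lapl_up - x] would be bounded below on [Zspace], and iterating the
    contraction [1 - t T^2] would invert it. Truncating [f] to a ball and pulling it back along an
    isomorphism of balls gives a form [G] on [Xs n] that satisfies the same estimate. On the finite
    complex [Xs n], [lamn n] bounds the Rayleigh quotients on [Zspace] from below, so it remains to
    turn [G] into an element of [Zspace d (Xs n)]. If [x <> 0], take [lapl_up G], which is
    orthogonal to all coboundaries. If [lam = 0] and the third alternative holds, [f] is a cycle, so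
    the boundary of [G] is small; [0] is not in the spectrum of [bdry delta_low] on [Kspace], so
    [bdry delta_low h = bdry G] has a solution there, and [G - delta_low h] is a cycle with
    [delta_low h] small. *)

(** * Finite sums *)

Definition em_eq_dec {A : Type} (x y : A) : {x = y} + {x <> y} :=
  excluded_middle_informative (x = y).

Lemma functional_choice {A B : Type} (rel : A -> B -> Prop) :
  (forall a, exists b, rel a b) -> exists f, forall a, rel a (f a).
Proof.
  intros H. exists (fun a => proj1_sig (constructive_indefinite_description _ (H a))).
  intros a. apply proj2_sig.
Qed.

Definition select {A : Type} (P : A -> Prop) (L : list A) : list A :=
  filter (fun a => if excluded_middle_informative (P a) then true else false) L.

Lemma in_select {A} (P : A -> Prop) L a : In a (select P L) <-> In a L /\ P a.
Proof.
  unfold select. rewrite filter_In.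
  destruct (excluded_middle_informative (P a)); intuition discriminate.
Qed.

Lemma NoDup_select {A} (P : A -> Prop) L : NoDup L -> NoDup (select P L).
Proof. apply NoDup_filter. Qed.

Definition extend_zero {A : Type} (P : A -> Prop) (u : A -> R) : A -> R :=
  fun a => if excluded_middle_informative (P a) then u a else 0.

Lemma extend_zero_in {A} (P : A -> Prop) u a : P a -> extend_zero P u a = u a.
Proof. unfold extend_zero. destruct (excluded_middle_informative (P a)); tauto. Qed.

Lemma extend_zero_out {A} (P : A -> Prop) u a : ~ P a -> extend_zero P u a = 0.
Proof. unfold extend_zero. destruct (excluded_middle_informative (P a)); tauto. Qed.

Lemma nonneg_quadratic_discriminant a b c :
  (forall t, 0 <= a + 2 * t * b + t ^ 2 * c) -> b ^ 2 <= a * c.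
Proof.
  intros H.
  destruct (Req_dec c 0) as [->|Hc].
  - destruct (Req_dec b 0) as [->|Hb]; [lra|].
    specialize (H (- (a + 1) / (2 * b))).
    replace (a + 2 * (- (a + 1) / (2 * b)) * b + (- (a + 1) / (2 * b)) ^ 2 * 0) with (-1) in H
      by (field; auto). lra.
  - destruct (Rlt_le_dec 0 c) as [Hpos|Hneg].
    + specialize (H (- b / c)).
      replace (a + 2 * (- b / c) * b + (- b / c) ^ 2 * c) with ((a * c - b ^ 2) / c) in H
        by (field; lra).
      apply (Rmult_le_compat_r c) in H; [|lra].
      replace ((a * c - b ^ 2) / c * c) with (a * c - b ^ 2) in H by (field; lra). lra.
    + set (t := 1 + Rabs a / - c).
      assert (Ht : t * - c = - c + Rabs a) by (unfold t; field; lra).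
      assert (1 <= t) by (pose proof (Rabs_pos a); nra).
      assert (- c + Rabs a <= t * (t * - c)) by (rewrite Ht; pose proof (Rabs_pos a); nra).
      pose proof (H t); pose proof (H (- t)). pose proof (Rle_abs a). lra.
Qed.

Lemma abs_mul_le_sqr_add x y : Rabs (x * y) <= x ^ 2 + y ^ 2.
Proof. apply Rabs_le. pose proof (pow2_ge_0 (x + y)); pose proof (pow2_ge_0 (x - y)). nra. Qed.

Definition sum_over {A : Type} (u : A -> R) (L : list A) : R := lsum (map u L).

Lemma sum_over_cons {A} (u : A -> R) a L : sum_over u (a :: L) = u a + sum_over u L.
Proof. reflexivity. Qed.

Lemma sum_over_app {A} (u : A -> R) L M : sum_over u (L ++ M) = sum_over u L + sum_over u M.
Proof.
  induction L as [|a L IH]; simpl; rewrite ?sum_over_cons, ?IH; [unfold sum_over; simpl|]; ring.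
Qed.

Lemma sum_over_permutation {A} (u : A -> R) L M :
  Permutation L M -> sum_over u L = sum_over u M.
Proof. induction 1; rewrite ?sum_over_cons in *; try lra; auto. Qed.

Lemma sum_over_same_elements {A} (u : A -> R) L M :
  NoDup L -> NoDup M -> (forall a, In a L <-> In a M) -> sum_over u L = sum_over u M.
Proof. intros; apply sum_over_permutation, NoDup_Permutation; auto. Qed.

Lemma sum_over_ext {A} (u v : A -> R) L :
  (forall a, In a L -> u a = v a) -> sum_over u L = sum_over v L.
Proof. intros H. unfold sum_over. now rewrite (map_ext_in _ _ _ H). Qed.

Lemma sum_over_add {A} (u v : A -> R) L :
  sum_over (fun a => u a + v a) L = sum_over u L + sum_over v L.
Proof. induction L; rewrite ?sum_over_cons, ?IHL; [unfold sum_over; simpl|]; ring. Qed.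

Lemma sum_over_scal {A} c (u : A -> R) L : sum_over (fun a => c * u a) L = c * sum_over u L.
Proof. induction L; rewrite ?sum_over_cons, ?IHL; [unfold sum_over; simpl|]; ring. Qed.

Lemma sum_over_const {A} c (L : list A) : sum_over (fun _ => c) L = INR (length L) * c.
Proof.
  induction L; [unfold sum_over; simpl; ring|].
  rewrite sum_over_cons, IHL; simpl length; rewrite S_INR; ring.
Qed.

Lemma sum_over_zero {A} (u : A -> R) L : (forall a, In a L -> u a = 0) -> sum_over u L = 0.
Proof. intros H. rewrite (sum_over_ext _ _ _ H), sum_over_const. ring. Qed.

Lemma sum_over_le {A} (u v : A -> R) L :
  (forall a, In a L -> u a <= v a) -> sum_over u L <= sum_over v L.
Proof.
  induction L; intros H; [apply Rle_refl|]. rewrite !sum_over_cons.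
  apply Rplus_le_compat; [|apply IHL; intros]; apply H; simpl; auto.
Qed.

Lemma sum_over_ge0 {A} (u : A -> R) L : (forall a, In a L -> 0 <= u a) -> 0 <= sum_over u L.
Proof.
  intros H. rewrite <- (sum_over_zero (fun _ => 0) L) by auto. now apply sum_over_le.
Qed.

Lemma sum_over_map {A B} (h : A -> B) (u : B -> R) L :
  sum_over u (map h L) = sum_over (fun a => u (h a)) L.
Proof. unfold sum_over; now rewrite map_map. Qed.

Lemma sum_over_flat_map {A B} (h : A -> list B) (u : B -> R) L :
  sum_over u (flat_map h L) = sum_over (fun a => sum_over u (h a)) L.
Proof. induction L; auto. simpl. now rewrite sum_over_app, sum_over_cons, IHL. Qed.

Lemma sum_over_exchange {A B} (u : A -> B -> R) L M :
  sum_over (fun a => sum_over (u a) M) L = sum_over (fun b => sum_over (fun a => u a b) L) M.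
Proof.
  induction L.
  - symmetry; apply sum_over_zero; auto.
  - rewrite sum_over_cons, IHL, <- sum_over_add; auto.
Qed.

Lemma sum_over_select_split {A} (u : A -> R) (P : A -> Prop) L :
  sum_over u L = sum_over u (select P L) + sum_over u (select (fun a => ~ P a) L).
Proof.
  induction L as [|a L IH]; [unfold sum_over; simpl; ring|].
  rewrite sum_over_cons, IH. unfold select; simpl.
  destruct (excluded_middle_informative (P a)), (excluded_middle_informative (~ P a));
    rewrite ?sum_over_cons; tauto || ring.
Qed.

Lemma sum_over_select {A} (u : A -> R) (P : A -> Prop) L :
  (forall a, In a L -> ~ P a -> u a = 0) -> sum_over u (select P L) = sum_over u L.
Proof.
  intros H. rewrite (sum_over_select_split u P L).
  rewrite (sum_over_zero u (select (fun a => ~ P a) L)); [ring|].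
  intros a Ha. apply in_select in Ha as [? ?]; auto.
Qed.

Lemma sum_over_incl_le {A} (u : A -> R) L M : NoDup L -> NoDup M -> incl L M ->
  (forall a, In a M -> 0 <= u a) -> sum_over u L <= sum_over u M.
Proof.
  intros HL HM HI Hnonneg.
  rewrite (sum_over_select_split u (fun a => In a L) M).
  rewrite (sum_over_same_elements u L (select (fun a => In a L) M)); auto using NoDup_select.
  - assert (0 <= sum_over u (select (fun a => ~ In a L) M)); [|lra].
    apply sum_over_ge0; intros a Ha; apply in_select in Ha as [? ?]; auto.
  - intros a. rewrite in_select. split; [split; auto | tauto].
Qed.

Lemma sum_over_sqr_le {A} (u : A -> R) L :
  sum_over u L ^ 2 <= INR (length L) * sum_over (fun a => u a ^ 2) L.
Proof.
  apply nonneg_quadratic_discriminant. intros t.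
  replace (_ + _) with (sum_over (fun a => (1 + t * u a) ^ 2) L).
  - apply sum_over_ge0; intros; apply pow2_ge_0.
  - rewrite (sum_over_ext _ (fun a => 1 + (2 * t * u a + t ^ 2 * u a ^ 2))) by (intros; ring).
    rewrite !sum_over_add, !sum_over_scal, sum_over_const. ring.
Qed.

(** * Unconditional sums *)

Definition finite_subset {A : Type} (P : A -> Prop) (L : list A) : Prop :=
  NoDup L /\ forall a, In a L -> P a.

Definition union {A : Type} (L M : list A) : list A := nodup em_eq_dec (L ++ M).

Lemma in_union {A} (L M : list A) a : In a (union L M) <-> In a L \/ In a M.
Proof. unfold union. rewrite nodup_In, in_app_iff. tauto. Qed.

Lemma finite_subset_union {A} (P : A -> Prop) L M :
  finite_subset P L -> finite_subset P M -> finite_subset P (union L M).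
Proof.
  intros [_ HL] [_ HM]. split; [apply NoDup_nodup|].
  intros a Ha. apply in_union in Ha as [|]; auto.
Qed.

Lemma finite_subset_nil {A} (P : A -> Prop) : finite_subset P [].
Proof. split; [constructor | simpl; tauto]. Qed.

Definition finite_subsets {A : Type} (P : A -> Prop) : (list A -> Prop) -> Prop :=
  fun Q => exists F, finite_subset P F /\ forall L, finite_subset P L -> incl F L -> Q L.

Global Instance finite_subsets_filter {A} (P : A -> Prop) : ProperFilter (finite_subsets P).
Proof.
  split; [|split].
  - intros Q [F [HF HQ]]. exists F. apply HQ; auto using incl_refl.
  - exists []. split; auto using finite_subset_nil.
  - intros Q1 Q2 [F1 [HF1 HQ1]] [F2 [HF2 HQ2]]. exists (union F1 F2).
    split; [now apply finite_subset_union|].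
    intros L HL HI. split; [apply HQ1 | apply HQ2]; auto; intros a Ha; apply HI, in_union; auto.
  - intros Q1 Q2 HQ [F [HF H]]. exists F; auto.
Qed.

Lemma finite_subsets_all {A} (P : A -> Prop) (Q : list A -> Prop) :
  (forall L, finite_subset P L -> Q L) -> finite_subsets P Q.
Proof. intros H. exists []. split; auto using finite_subset_nil. Qed.

Definition has_sum {A : Type} (P : A -> Prop) (u : A -> R) (l : R) : Prop :=
  filterlim (sum_over u) (finite_subsets P) (locally l).

Definition summable {A : Type} (P : A -> Prop) (u : A -> R) : Prop := exists l, has_sum P u l.

Definition tsum {A : Type} (P : A -> Prop) (u : A -> R) : R := iota (has_sum P u).

Lemma finite_subsets_limit_le {A} (P : A -> Prop) (f g : list A -> R) (l m : R) :
  finite_subsets P (fun L => f L <= g L) -> filterlim f (finite_subsets P) (locally l) ->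
  filterlim g (finite_subsets P) (locally m) -> l <= m.
Proof. exact (filterlim_le f g (Finite l) (Finite m)). Qed.

Section HasSum.
Context {A : Type} {P : A -> Prop}.
Implicit Types (u v : A -> R) (l m : R).

Lemma has_sum_unique u l m : has_sum P u l -> has_sum P u m -> l = m.
Proof. apply (filterlim_locally_unique (V := R_NormedModule)). Qed.

Lemma tsum_eq u l : has_sum P u l -> tsum P u = l.
Proof. apply (iota_filterlim_locally (V := R_CompleteNormedModule) (sum_over u)). Qed.

Lemma tsum_has_sum u : summable P u -> has_sum P u (tsum P u).
Proof. intros [l Hl]. now rewrite (tsum_eq u l Hl). Qed.

Lemma has_sum_ext u v l : (forall a, P a -> u a = v a) -> has_sum P u l -> has_sum P v l.
Proof.
  intros E. apply filterlim_ext_loc, finite_subsets_all.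
  intros L HL. apply sum_over_ext. intros a Ha. apply E, HL, Ha.
Qed.

Lemma has_sum_zero : has_sum P (fun _ => 0) 0.
Proof.
  apply (filterlim_ext (fun _ => 0)); [|apply filterlim_const].
  intros L. symmetry. now apply sum_over_zero.
Qed.

Lemma has_sum_add u v l m :
  has_sum P u l -> has_sum P v m -> has_sum P (fun a => u a + v a) (l + m).
Proof.
  intros Hu Hv. apply (filterlim_ext (fun L => sum_over u L + sum_over v L)).
  - intros L. symmetry. apply sum_over_add.
  - exact (filterlim_comp_2 _ _ _ Hu Hv (filterlim_plus l m)).
Qed.

Lemma has_sum_scal c u l : has_sum P u l -> has_sum P (fun a => c * u a) (c * l).
Proof.
  intros Hu. apply (filterlim_ext (fun L => c * sum_over u L)).
  - intros L. symmetry. apply sum_over_scal.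
  - exact (filterlim_comp _ _ _ _ _ _ _ _ Hu (filterlim_scal_r c l)).
Qed.

Lemma has_sum_le u v l m :
  (forall a, P a -> u a <= v a) -> has_sum P u l -> has_sum P v m -> l <= m.
Proof.
  intros Huv Hu Hv. apply (finite_subsets_limit_le P (sum_over u) (sum_over v)); auto.
  apply finite_subsets_all. intros L HL. apply sum_over_le. intros a Ha. apply Huv, HL, Ha.
Qed.

Lemma has_sum_ge0 u l : (forall a, P a -> 0 <= u a) -> has_sum P u l -> 0 <= l.
Proof. intros Hnonneg. apply (has_sum_le (fun _ => 0)); auto using has_sum_zero. Qed.

Lemma sum_over_le_has_sum u l L :
  (forall a, P a -> 0 <= u a) -> has_sum P u l -> finite_subset P L -> sum_over u L <= l.
Proof.
  intros Hnonneg H HL. apply (finite_subsets_limit_le P (fun _ => sum_over u L) (sum_over u));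
    [|apply filterlim_const | exact H].
  exists L. split; auto. intros M HM HI.
  apply sum_over_incl_le; auto; [apply HL | apply HM |]. intros a Ha. apply Hnonneg, HM, Ha.
Qed.

Definition partial_sums (Q : A -> Prop) u (x : R) : Prop :=
  exists L, NoDup L /\ (forall a, In a L -> Q a) /\ x = sum_over u L.

Lemma has_sum_is_lub u l :
  (forall a, P a -> 0 <= u a) -> has_sum P u l <-> is_lub (partial_sums P u) l.
Proof.
  intros Hnonneg. split.
  - intros H. split.
    + intros x [L [HL [HP ->]]]. apply sum_over_le_has_sum; auto. split; auto.
    + intros b Hb. apply (finite_subsets_limit_le P (sum_over u) (fun _ => b));
        [|exact H | apply filterlim_const].
      apply finite_subsets_all. intros L [HL HP]. apply Hb. now exists L.
  - intros [Hub Hleast]. apply (filterlim_locally (sum_over u)). intros eps.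
    destruct (classic (exists F, finite_subset P F /\ l - eps < sum_over u F)) as [[F [HF K]]|N].
    + exists F. split; auto. intros L HL HI.
      assert (sum_over u L <= l) by (apply Hub; exists L; destruct HL; auto).
      assert (sum_over u F <= sum_over u L).
      { apply sum_over_incl_le; auto; [apply HF | apply HL |]. intros; now apply Hnonneg, HL. }
      apply Rabs_def1; simpl; unfold minus, plus, opp; simpl; pose proof (cond_pos eps); lra.
    + exfalso. assert (l <= l - eps); [|pose proof (cond_pos eps); lra]. apply Hleast.
      intros x [L [HL [HP ->]]]. apply Rnot_lt_le. intros ?. apply N. exists L.
      unfold finite_subset. auto.
Qed.

Lemma summable_of_bounded u M :
  (forall a, P a -> 0 <= u a) -> (forall L, finite_subset P L -> sum_over u L <= M) ->
  summable P u /\ tsum P u <= M.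
Proof.
  intros Hnonneg HM.
  destruct (completeness (partial_sums P u)) as [l Hl].
  - exists M. intros x [L [HL [HP ->]]]. now apply HM.
  - exists 0, []. repeat split; [constructor | simpl; tauto].
  - assert (H : has_sum P u l) by (apply has_sum_is_lub; auto). split; [now exists l|].
    rewrite (tsum_eq u l H). apply Hl. intros x [L [HL [HP ->]]]. now apply HM.
Qed.

Lemma summable_ext u v : (forall a, P a -> u a = v a) -> summable P u -> summable P v.
Proof. intros E [l H]. exists l. now apply (has_sum_ext u). Qed.

Lemma summable_add u v : summable P u -> summable P v -> summable P (fun a => u a + v a).
Proof. intros [l H] [m K]. exists (l + m). now apply has_sum_add. Qed.

Lemma summable_scal c u : summable P u -> summable P (fun a => c * u a).
Proof. intros [l H]. exists (c * l). now apply has_sum_scal. Qed.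

Lemma summable_nonneg_le u v : (forall a, P a -> 0 <= u a <= v a) -> summable P v ->
  summable P u /\ tsum P u <= tsum P v.
Proof.
  intros H Hv. apply summable_of_bounded; [intros; now apply H|].
  intros L HL. apply Rle_trans with (sum_over v L).
  - apply sum_over_le. intros. now apply H, HL.
  - apply sum_over_le_has_sum; auto using tsum_has_sum. intros a Ha. destruct (H a Ha); lra.
Qed.

Lemma summable_abs_le u v : (forall a, P a -> Rabs (u a) <= v a) -> summable P v -> summable P u.
Proof.
  intros H Hv.
  assert (K : summable P (fun a => u a + v a)).
  { apply (summable_nonneg_le _ (fun a => 2 * v a)); auto using summable_scal.
    intros a Ha. apply H, Rabs_le_between in Ha. lra. }
  apply (summable_ext (fun a => (u a + v a) + (-1) * v a)); [intros; ring|].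
  auto using summable_add, summable_scal.
Qed.

Lemma summable_mul_of_sqr u v :
  summable P (fun a => u a ^ 2) -> summable P (fun a => v a ^ 2) -> summable P (fun a => u a * v a).
Proof.
  intros Hu Hv. apply (summable_abs_le _ (fun a => u a ^ 2 + v a ^ 2)); auto using summable_add.
  intros a _. apply abs_mul_le_sqr_add.
Qed.

Lemma tsum_add u v :
  summable P u -> summable P v -> tsum P (fun a => u a + v a) = tsum P u + tsum P v.
Proof. intros. apply tsum_eq, has_sum_add; now apply tsum_has_sum. Qed.

Lemma tsum_scal c u : summable P u -> tsum P (fun a => c * u a) = c * tsum P u.
Proof. intros. apply tsum_eq, has_sum_scal. now apply tsum_has_sum. Qed.

Lemma tsum_ext u v : (forall a, P a -> u a = v a) -> summable P u -> tsum P u = tsum P v.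
Proof. intros E Hu. symmetry. apply tsum_eq, (has_sum_ext u); auto using tsum_has_sum. Qed.

Lemma has_sum_sum_over {B} (u : B -> A -> R) (l : B -> R) M :
  (forall b, In b M -> has_sum P (u b) (l b)) ->
  has_sum P (fun a => sum_over (fun b => u b a) M) (sum_over l M).
Proof.
  induction M as [|b M IH]; intros H; [apply has_sum_zero|].
  apply (has_sum_add (u b) (fun a => sum_over (fun b => u b a) M)); [|apply IH; intros];
    apply H; simpl; auto.
Qed.

End HasSum.

Definition listing {A : Type} (P : A -> Prop) (F : list A) : Prop :=
  NoDup F /\ forall a, In a F <-> P a.

Lemma has_sum_listing {A} (P : A -> Prop) u F : listing P F -> has_sum P u (sum_over u F).
Proof.
  intros [HF HP]. apply (filterlim_ext_loc (fun _ => sum_over u F)); [|apply filterlim_const].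
  exists F. split; [split; auto; intros; now apply HP|].
  intros L [HL HPL] HI. apply sum_over_same_elements; auto.
  intros a. split; auto. intros. now apply HP, HPL.
Qed.

Definition fibres {A B : Type} (P : A -> Prop) (Q : B -> Prop) (p : A -> B) (fib : B -> list A) :
  Prop :=
  (forall a, P a -> Q (p a)) /\ forall b, Q b -> listing (fun a => P a /\ p a = b) (fib b).

Section Fibres.
Context {A B : Type} {P : A -> Prop} {Q : B -> Prop} {p : A -> B} {fib : B -> list A}.
Hypothesis Hfib : fibres P Q p fib.

Lemma in_flat_map_fibres L a :
  finite_subset Q L -> In a (flat_map fib L) <-> P a /\ In (p a) L.
Proof.
  intros [_ HQ]. rewrite in_flat_map. split.
  - intros [b [Hb Ha]]. apply (proj2 Hfib b (HQ b Hb)) in Ha as [? <-]. auto.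
  - intros [Ha Hp]. exists (p a). split; auto. now apply (proj2 Hfib (p a) (HQ _ Hp)).
Qed.

Lemma finite_subset_flat_map_fibres L : finite_subset Q L -> finite_subset P (flat_map fib L).
Proof.
  intros HL. split; [|intros a Ha; now apply in_flat_map_fibres in Ha].
  destruct HL as [HL HQ].
  induction HL as [|b L Hb HL IH]; simpl; [constructor|]. apply NoDup_app.
  - apply (proj2 Hfib), HQ; simpl; auto.
  - apply IH. intros; apply HQ; simpl; auto.
  - intros a Ha Hf. apply in_flat_map in Hf as [b' [Hb' Ha']].
    apply (proj2 Hfib) in Ha as [_ E]; [|apply HQ; simpl; auto].
    apply (proj2 Hfib) in Ha' as [_ E']; [|apply HQ; simpl; auto]. congruence.
Qed.

Lemma finite_subset_image L : finite_subset P L -> finite_subset Q (nodup em_eq_dec (map p L)).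
Proof.
  intros [_ HL]. split; [apply NoDup_nodup|]. intros b Hb.
  apply nodup_In, in_map_iff in Hb as [a [<- Ha]]. apply Hfib, HL, Ha.
Qed.

Lemma has_sum_fibres u l : has_sum P u l -> has_sum Q (fun b => sum_over u (fib b)) l.
Proof.
  intros H. apply (filterlim_ext (fun L => sum_over u (flat_map fib L))).
  - intros L. apply sum_over_flat_map.
  - apply (filterlim_comp _ _ _ (flat_map fib) (sum_over u) _ (finite_subsets P)); auto.
    intros S [F [HF HS]]. exists (nodup em_eq_dec (map p F)).
    split; [now apply finite_subset_image|]. intros L HL HI.
    apply HS; [now apply finite_subset_flat_map_fibres|].
    intros a Ha. apply in_flat_map_fibres; auto. split; [now apply HF|].
    now apply HI, nodup_In, in_map.
Qed.

Lemma has_sum_of_fibres u l : (forall a, P a -> 0 <= u a) ->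
  has_sum Q (fun b => sum_over u (fib b)) l -> has_sum P u l.
Proof.
  intros Hnonneg H.
  assert (S : summable P u).
  { apply (summable_of_bounded u l Hnonneg). intros L HL.
    pose proof (finite_subset_image L HL) as HM. set (M := nodup em_eq_dec (map p L)) in HM.
    pose proof (finite_subset_flat_map_fibres M HM) as HfM.
    apply Rle_trans with (sum_over u (flat_map fib M)).
    - apply sum_over_incl_le; [apply HL | apply HfM | | intros; apply Hnonneg, HfM; auto].
      intros a Ha. apply in_flat_map_fibres; auto. split; [now apply HL|].
      now apply nodup_In, in_map.
    - rewrite sum_over_flat_map. apply (sum_over_le_has_sum (P := Q)); auto.
      intros b Hb. apply sum_over_ge0. intros a Ha. now apply Hnonneg, (proj2 Hfib b Hb). }
  destruct S as [m Hm]. now rewrite (has_sum_unique _ _ _ H (has_sum_fibres u m Hm)).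
Qed.

End Fibres.

Lemma has_sum_support {A} (P : A -> Prop) u l :
  has_sum (fun a => P a /\ u a <> 0) u l <-> has_sum P u l.
Proof.
  assert (Hsel : forall L, sum_over u (select (fun a => u a <> 0) L) = sum_over u L).
  { intros L. apply sum_over_select. intros a _ N. now destruct (Req_dec (u a) 0). }
  split; intros H S HS; destruct (H S HS) as [F [HF K]].
  - exists F. split; [split; [apply HF | intros; now apply HF]|].
    intros L HL HI. unfold filtermap. rewrite <- Hsel. apply K.
    + split; [apply NoDup_select, HL|]. intros a Ha. apply in_select in Ha as [Ha N].
      split; auto. now apply HL.
    + intros a Ha. apply in_select. split; auto. now apply HF.
  - exists (select (fun a => u a <> 0) F). split.
    + split; [apply NoDup_select, HF|]. intros a Ha. apply in_select in Ha as [Ha N].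
      split; auto. now apply HF.
    + intros L HL HI. unfold filtermap. rewrite (sum_over_same_elements u L
        (select (fun a => u a <> 0) (union F L))).
      * rewrite Hsel. apply K; [|intros a Ha; apply in_union; auto].
        apply finite_subset_union; auto. split; [apply HL | intros; now apply HL].
      * apply HL.
      * apply NoDup_select, NoDup_nodup.
      * intros a. rewrite in_select, in_union. split.
        -- intros Ha. split; auto. now apply HL.
        -- intros [[Ha|Ha] N]; auto. now apply HI, in_select.
Qed.

Lemma has_sum_reindex {A B} (P : A -> Prop) (Q : B -> Prop) (u : A -> R) (v : B -> R)
    (h : A -> B) (k : B -> A) l :
  (forall a, P a -> u a <> 0 -> Q (h a) /\ k (h a) = a /\ v (h a) = u a) ->
  (forall b, Q b -> v b <> 0 -> P (k b) /\ h (k b) = b /\ u (k b) = v b) ->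
  has_sum Q v l -> has_sum P u l.
Proof.
  intros Hh Hk H. apply has_sum_support in H. apply has_sum_support.
  apply (has_sum_ext (fun a => sum_over v [h a])).
  - intros a [Ha N]. destruct (Hh a Ha N) as [_ [_ E]]. unfold sum_over; simpl. rewrite E. ring.
  - apply (has_sum_fibres (Q := fun a => P a /\ u a <> 0) (p := k) (fib := fun a => [h a])) in H;
      auto.
    split.
    + intros b [Hb N]. destruct (Hk b Hb N) as [HP [_ Ev]]. split; auto. congruence.
    + intros a [Ha N]. destruct (Hh a Ha N) as [HQ [Ek Ev]].
      split; [repeat constructor; simpl; tauto|]. intros b. simpl. split.
      * intros [<-|[]]. repeat split; auto. congruence.
      * intros [[Hb Nb] <-]. left. now apply Hk.
Qed.

(** * Limits of real sequences *)

Lemma is_lim_seq_dominated (u b : nat -> R) (l : R) :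
  (forall k, Rabs (u k - l) <= b k) -> is_lim_seq b 0 -> is_lim_seq u l.
Proof.
  intros H Hb. apply (is_lim_seq_le_le (fun k => l - b k) u (fun k => l + b k)).
  - intros k. specialize (H k). apply Rabs_le_between in H. lra.
  - replace (Finite l) with (Finite (l - 0)) by (f_equal; ring).
    apply is_lim_seq_minus'; auto using is_lim_seq_const.
  - replace (Finite l) with (Finite (l + 0)) by (f_equal; ring).
    apply is_lim_seq_plus'; auto using is_lim_seq_const.
Qed.

Lemma is_lim_seq_eq (u v : nat -> R) (l m : R) :
  (forall k, u k = v k) -> is_lim_seq u l -> is_lim_seq v m -> l = m.
Proof.
  intros E Hu Hv. apply (is_lim_seq_ext _ _ _ E), is_lim_seq_unique in Hu.
  apply is_lim_seq_unique in Hv. rewrite Hu in Hv. now injection Hv.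
Qed.

Lemma is_lim_seq_scal_0 (u : nat -> R) c : is_lim_seq u 0 -> is_lim_seq (fun k => c * u k) 0.
Proof.
  intros Hu. rewrite <- (Rmult_0_r c). apply is_lim_seq_mult'; auto using is_lim_seq_const.
Qed.

Lemma is_lim_seq_sum_over {B} (u : nat -> B -> R) (l : B -> R) L :
  (forall b, In b L -> is_lim_seq (fun k => u k b) (l b)) ->
  is_lim_seq (fun k => sum_over (u k) L) (sum_over l L).
Proof.
  induction L as [|b L IH]; intros H; [apply is_lim_seq_const|].
  apply is_lim_seq_plus'; [|apply IH; intros]; apply H; simpl; auto.
Qed.

Lemma is_lim_seq_sqr_dist (u : nat -> R) (l x c : R) :
  is_lim_seq u l -> is_lim_seq (fun k => (1 * u k + -1 * x) ^ 2 * c) ((1 * l + -1 * x) ^ 2 * c).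
Proof.
  intros H. apply is_lim_seq_mult'; [|apply is_lim_seq_const].
  assert (K : is_lim_seq (fun k => 1 * u k + -1 * x) (1 * l + -1 * x)).
  { apply is_lim_seq_plus'; [apply is_lim_seq_mult'; auto|]; apply is_lim_seq_const. }
  repeat (apply is_lim_seq_mult'; [exact K|]). apply is_lim_seq_const.
Qed.

Lemma INR_S_pos n : 0 < INR (S n).
Proof. apply lt_0_INR. lia. Qed.

Lemma is_lim_seq_inv_INR_S : is_lim_seq (fun k => / INR (S k)) 0.
Proof.
  apply (is_lim_seq_incr_1 (fun k => / INR k)).
  now apply (is_lim_seq_inv INR p_infty); [apply is_lim_seq_INR|].
Qed.

Lemma bounded_sequence_subseq (u : nat -> R) r : (forall k, Rabs (u k) <= r) ->
  exists phi (l : R), filterlim phi eventually eventually /\ is_lim_seq (fun k => u (phi k)) l.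
Proof.
  intros Hr.
  destruct (Bolzano_Weierstrass u (fun x => - r <= x <= r)) as [l Hl]; [apply compact_P3| |].
  { intros k. apply Rabs_le_between, Hr. }
  assert (Hex : forall k, exists p, (k <= p)%nat /\ Rabs (u p - l) <= / INR (S k)).
  { intros k. assert (Hp : 0 < / INR (S k)) by apply Rinv_0_lt_compat, INR_S_pos.
    destruct (Hl (disc l (mkposreal _ Hp)) k) as [p [Hk Hd]].
    - exists (mkposreal _ Hp). now intros y Hy.
    - exists p. split; auto. left. exact Hd. }
  apply functional_choice in Hex as [phi Hphi]. exists phi, l. split.
  - intros Q [N HN]. exists N. intros k Hk. apply HN. destruct (Hphi k). lia.
  - apply (is_lim_seq_dominated _ (fun k => / INR (S k))); [apply Hphi|].
    apply is_lim_seq_inv_INR_S.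
Qed.

Lemma bounded_family_subseq {A} (fs : nat -> A -> R) (r : A -> R) L :
  (forall k a, In a L -> Rabs (fs k a) <= r a) ->
  exists phi, filterlim phi eventually eventually /\
    forall a, In a L -> ex_finite_lim_seq (fun k => fs (phi k) a).
Proof.
  induction L as [|a L IH]; intros Hr.
  - exists (fun k => k). split; [now intros Q HQ | simpl; tauto].
  - destruct IH as [phi [Hphi HL]]; [intros; apply Hr; simpl; auto|].
    destruct (bounded_sequence_subseq (fun k => fs (phi k) a) (r a)) as [psi [l [Hpsi Hl]]].
    { intros. apply Hr. simpl; auto. }
    exists (fun k => phi (psi k)). split; [exact (filterlim_comp _ _ _ _ _ _ _ _ Hpsi Hphi)|].
    intros b [<-|Hb]; [now exists l|]. destruct (HL b Hb) as [m Hm]. exists m.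
    now apply (is_lim_seq_subseq (fun k => fs (phi k) b)).
Qed.

(** * Weighted l2 spaces *)

Definition eq_on {A : Type} (P : A -> Prop) (f g : A -> R) : Prop := forall a, P a -> f a = g a.

Definition lincomb {A : Type} (c : R) (f : A -> R) (e : R) (g : A -> R) : A -> R :=
  fun a => c * f a + e * g a.

Ltac lincomb_ring := intros; unfold lincomb; ring.

Record weight {A : Type} (P : A -> Prop) := Weight {
  weight_at :> A -> R;
  weight_pos : forall a, P a -> 0 < weight_at a }.

Arguments Weight {A} P.
Arguments weight_pos {A P} w a _ : rename.

Section WeightedL2.
Context {A : Type} {P : A -> Prop} (w : weight P).
Implicit Types f g h : A -> R.

Definition L2 f : Prop := summable P (fun a => f a ^ 2 * w a).
Definition inner f g : R := tsum P (fun a => f a * g a * w a).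
Definition l2norm f : R := sqrt (inner f f).
Definition l2dist f g : R := l2norm (lincomb 1 f (-1) g).

Lemma weight_ge0 a : P a -> 0 <= w a.
Proof. intros Ha. left. now apply weight_pos. Qed.

Lemma sqr_weight_ge0 f a : P a -> 0 <= f a ^ 2 * w a.
Proof. intros Ha. apply Rmult_le_pos; auto using pow2_ge_0, weight_ge0. Qed.

Lemma inner_summable f g : L2 f -> L2 g -> summable P (fun a => f a * g a * w a).
Proof.
  intros Hf Hg. apply (summable_abs_le _ (fun a => f a ^ 2 * w a + g a ^ 2 * w a));
    auto using summable_add.
  intros a Ha. pose proof (weight_ge0 a Ha).
  rewrite <- Rmult_plus_distr_r, Rabs_mult, (Rabs_pos_eq (w a)) by auto.
  apply Rmult_le_compat_r; auto using abs_mul_le_sqr_add.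
Qed.

Lemma L2_lincomb c f e g : L2 f -> L2 g -> L2 (lincomb c f e g).
Proof.
  intros Hf Hg.
  apply (summable_nonneg_le _ (fun a => 2 * c ^ 2 * (f a ^ 2 * w a) + 2 * e ^ 2 * (g a ^ 2 * w a)));
    auto using summable_add, summable_scal.
  intros a Ha. split; [now apply sqr_weight_ge0|]. unfold lincomb.
  replace (2 * c ^ 2 * (f a ^ 2 * w a) + 2 * e ^ 2 * (g a ^ 2 * w a))
    with ((2 * (c * f a) ^ 2 + 2 * (e * g a) ^ 2) * w a) by ring.
  apply Rmult_le_compat_r; auto using weight_ge0.
  pose proof (pow2_ge_0 (c * f a - e * g a)). lra.
Qed.
Hint Resolve L2_lincomb : core.

Lemma L2_ext f g : eq_on P f g -> L2 f -> L2 g.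
Proof. intros E. apply summable_ext. intros a Ha. now rewrite E. Qed.

Lemma inner_sym f g : inner f g = inner g f.
Proof. unfold inner. f_equal. apply functional_extensionality. intros; ring. Qed.

Lemma inner_ext f f' g g' :
  eq_on P f f' -> eq_on P g g' -> L2 f -> L2 g -> inner f g = inner f' g'.
Proof.
  intros E E' Hf Hg. apply tsum_ext; auto using inner_summable.
  intros a Ha. now rewrite E, E'.
Qed.

Lemma inner_eq0 f g : (forall a, P a -> f a * g a = 0) -> inner f g = 0.
Proof.
  intros H. apply tsum_eq, (has_sum_ext (fun _ => 0)); auto using has_sum_zero.
  intros a Ha. rewrite H by auto. ring.
Qed.

Lemma inner_lincomb_l c f e g h :
  L2 f -> L2 g -> L2 h -> inner (lincomb c f e g) h = c * inner f h + e * inner g h.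
Proof.
  intros. unfold inner.
  rewrite <- !tsum_scal, <- tsum_add by auto using inner_summable, summable_scal.
  f_equal. apply functional_extensionality. lincomb_ring.
Qed.

Lemma inner_lincomb_r c f e g h :
  L2 f -> L2 g -> L2 h -> inner h (lincomb c f e g) = c * inner h f + e * inner h g.
Proof. intros. rewrite inner_sym, inner_lincomb_l, (inner_sym f), (inner_sym g); auto. Qed.

Lemma inner_lincomb_self c f e g : L2 f -> L2 g ->
  inner (lincomb c f e g) (lincomb c f e g) =
  c ^ 2 * inner f f + 2 * c * e * inner f g + e ^ 2 * inner g g.
Proof. intros. rewrite inner_lincomb_l, !inner_lincomb_r, (inner_sym g f) by auto. ring. Qed.

Lemma has_sum_inner_self f : L2 f -> has_sum P (fun a => f a ^ 2 * w a) (inner f f).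
Proof.
  intros Hf. apply (has_sum_ext (fun a => f a * f a * w a)); [intros; ring|].
  apply tsum_has_sum, inner_summable; auto.
Qed.

Lemma inner_self_ge0 f : L2 f -> 0 <= inner f f.
Proof.
  intros Hf. apply (has_sum_ge0 _ _ (sqr_weight_ge0 f)), has_sum_inner_self, Hf.
Qed.

Lemma l2norm_ge0 f : 0 <= l2norm f.
Proof. apply sqrt_pos. Qed.

Lemma l2norm_sqr f : L2 f -> l2norm f ^ 2 = inner f f.
Proof. intros. now apply pow2_sqrt, inner_self_ge0. Qed.

Lemma l2norm_le_of_sqr f r : 0 <= r -> inner f f <= r ^ 2 -> l2norm f <= r.
Proof. intros Hr H. unfold l2norm. rewrite <- (sqrt_pow2 r Hr). now apply sqrt_le_1_alt. Qed.

Lemma abs_inner_le f g : L2 f -> L2 g -> Rabs (inner f g) <= l2norm f * l2norm g.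
Proof.
  intros Hf Hg. pose proof (l2norm_ge0 f); pose proof (l2norm_ge0 g).
  rewrite <- (Rabs_pos_eq (l2norm f * l2norm g)) by nra.
  apply Rsqr_le_abs_0. rewrite !Rsqr_pow2, Rpow_mult_distr, !l2norm_sqr by auto.
  apply nonneg_quadratic_discriminant. intros t.
  replace (_ + _) with (inner (lincomb 1 f t g) (lincomb 1 f t g))
    by (rewrite inner_lincomb_self by auto; ring).
  apply inner_self_ge0; auto.
Qed.

Lemma inner_le f g : L2 f -> L2 g -> inner f g <= l2norm f * l2norm g.
Proof. intros. eapply Rle_trans; [apply Rle_abs | now apply abs_inner_le]. Qed.

Lemma l2norm_lincomb_le c f e g :
  L2 f -> L2 g -> l2norm (lincomb c f e g) <= Rabs c * l2norm f + Rabs e * l2norm g.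
Proof.
  intros Hf Hg. pose proof (l2norm_ge0 f); pose proof (l2norm_ge0 g).
  pose proof (Rabs_pos c); pose proof (Rabs_pos e).
  apply l2norm_le_of_sqr; [nra|].
  assert (c * e * inner f g <= Rabs c * Rabs e * (l2norm f * l2norm g)).
  { eapply Rle_trans; [apply Rle_abs|]. rewrite !Rabs_mult.
    apply Rmult_le_compat_l; [nra | now apply abs_inner_le]. }
  rewrite inner_lincomb_self, <- !l2norm_sqr, <- (pow2_abs c), <- (pow2_abs e) by auto. nra.
Qed.

Lemma l2norm_ext f g : eq_on P f g -> L2 f -> l2norm f = l2norm g.
Proof. intros E Hf. unfold l2norm. f_equal. now apply inner_ext. Qed.

Lemma l2norm_scal c f : L2 f -> l2norm (lincomb c f 0 f) = Rabs c * l2norm f.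
Proof.
  intros Hf. unfold l2norm. rewrite inner_lincomb_self by auto.
  replace (_ + _) with (Rsqr c * inner f f) by (unfold Rsqr; ring).
  rewrite sqrt_mult, sqrt_Rsqr_abs; auto using Rle_0_sqr, inner_self_ge0.
Qed.

Lemma l2norm_eq0_of_eq0 f : eq_on P f (fun _ => 0) -> l2norm f = 0.
Proof.
  intros E. unfold l2norm. rewrite inner_eq0; [apply sqrt_0|].
  intros a Ha. rewrite E by auto. ring.
Qed.

Lemma l2dist_self f : l2dist f f = 0.
Proof. apply l2norm_eq0_of_eq0. intros a _. lincomb_ring. Qed.

Lemma l2dist_sym f g : L2 f -> L2 g -> l2dist f g = l2dist g f.
Proof.
  intros Hf Hg. unfold l2dist, l2norm. f_equal.
  rewrite !inner_lincomb_self, (inner_sym g f) by auto. ring.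
Qed.

Lemma l2norm_le_l2dist f g : L2 f -> L2 g -> l2norm f <= l2norm g + l2dist f g.
Proof.
  intros Hf Hg. rewrite (l2norm_ext f (lincomb 1 g 1 (lincomb 1 f (-1) g)));
    [|intros a _; lincomb_ring | auto].
  eapply Rle_trans; [apply l2norm_lincomb_le; auto|]. rewrite Rabs_R1. unfold l2dist. lra.
Qed.

Lemma l2dist_triangle f g h : L2 f -> L2 g -> L2 h -> l2dist f h <= l2dist f g + l2dist g h.
Proof.
  intros. unfold l2dist at 1.
  rewrite (l2norm_ext _ (lincomb 1 (lincomb 1 f (-1) g) 1 (lincomb 1 g (-1) h)));
    [|intros a _; lincomb_ring | auto].
  eapply Rle_trans; [apply l2norm_lincomb_le; auto|]. rewrite Rabs_R1. unfold l2dist. lra.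
Qed.

Lemma abs_le_l2norm f a : L2 f -> P a -> Rabs (f a) * sqrt (w a) <= l2norm f.
Proof.
  intros Hf Ha. rewrite <- sqrt_Rsqr_abs, <- sqrt_mult by auto using Rle_0_sqr, weight_ge0.
  apply sqrt_le_1_alt. rewrite Rsqr_pow2.
  replace (f a ^ 2 * w a) with (sum_over (fun a => f a ^ 2 * w a) [a])
    by (unfold sum_over; simpl; ring).
  apply (sum_over_le_has_sum (P := P)); auto using sqr_weight_ge0, has_sum_inner_self.
  split; [repeat constructor; simpl; tauto|]. now intros b [<-|[]].
Qed.

Lemma sqrt_weight_pos a : P a -> 0 < sqrt (w a).
Proof. intros. now apply sqrt_lt_R0, weight_pos. Qed.

Lemma l2norm_eq0 f : L2 f -> l2norm f <= 0 -> eq_on P f (fun _ => 0).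
Proof.
  intros Hf H a Ha. pose proof (abs_le_l2norm f a Hf Ha). pose proof (sqrt_weight_pos a Ha).
  pose proof (Rabs_pos (f a)). destruct (Req_dec (f a) 0) as [|N]; auto.
  apply Rabs_pos_lt in N. nra.
Qed.

Lemma l2dist_eq0 f g : L2 f -> L2 g -> l2dist f g <= 0 -> eq_on P f g.
Proof.
  intros Hf Hg H a Ha. pose proof (l2norm_eq0 _ (L2_lincomb 1 f (-1) g Hf Hg) H a Ha) as E.
  unfold lincomb in E. lra.
Qed.

Definition L2_cvg (fs : nat -> A -> R) f : Prop := is_lim_seq (fun k => l2dist (fs k) f) 0.

Lemma L2_cvg_pointwise fs f a :
  (forall k, L2 (fs k)) -> L2 f -> L2_cvg fs f -> P a -> is_lim_seq (fun k => fs k a) (f a).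
Proof.
  intros Hfs Hf Hc Ha. pose proof (sqrt_weight_pos a Ha).
  apply (is_lim_seq_dominated _ (fun k => / sqrt (w a) * l2dist (fs k) f)).
  - intros k. rewrite Rmult_comm. apply Rle_div_r; auto.
    replace (fs k a - f a) with (lincomb 1 (fs k) (-1) f a) by lincomb_ring.
    apply abs_le_l2norm; auto.
  - now apply is_lim_seq_scal_0.
Qed.

Lemma L2_cvg_l2norm fs f :
  (forall k, L2 (fs k)) -> L2 f -> L2_cvg fs f -> is_lim_seq (fun k => l2norm (fs k)) (l2norm f).
Proof.
  intros Hfs Hf. apply is_lim_seq_dominated. intros k. apply Rabs_le.
  pose proof (l2norm_le_l2dist (fs k) f (Hfs k) Hf).
  pose proof (l2norm_le_l2dist f (fs k) Hf (Hfs k)) as Hback.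
  rewrite l2dist_sym in Hback by auto. lra.
Qed.

Lemma L2_cvg_inner fs gs f g : (forall k, L2 (fs k)) -> (forall k, L2 (gs k)) -> L2 f -> L2 g ->
  L2_cvg fs f -> L2_cvg gs g -> is_lim_seq (fun k => inner (fs k) (gs k)) (inner f g).
Proof.
  intros Hfs Hgs Hf Hg Hcf Hcg.
  apply (is_lim_seq_dominated _
    (fun k => l2dist (fs k) f * l2norm (gs k) + l2norm f * l2dist (gs k) g)).
  - intros k.
    replace (inner (fs k) (gs k) - inner f g)
      with (inner (lincomb 1 (fs k) (-1) f) (gs k) + inner f (lincomb 1 (gs k) (-1) g))
      by (rewrite inner_lincomb_l, inner_lincomb_r by auto; ring).
    eapply Rle_trans; [apply Rabs_triang|]. apply Rplus_le_compat; apply abs_inner_le; auto.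
  - replace (Finite 0) with (Finite (0 * l2norm g + l2norm f * 0)) by (f_equal; ring).
    apply is_lim_seq_plus'; apply is_lim_seq_mult'; auto using is_lim_seq_const, L2_cvg_l2norm.
Qed.

Section Completeness.
Context (fs : nat -> A -> R) (b : nat -> R).
Hypothesis Hfs : forall k, L2 (fs k).
Hypothesis Hb : is_lim_seq b 0.
Hypothesis Hcauchy : forall k j, l2dist (fs (j + k)%nat) (fs k) <= b k.

Lemma L2_cauchy_pointwise a : P a -> ex_finite_lim_seq (fun k => fs k a).
Proof.
  intros Ha. apply ex_lim_seq_cauchy_corr. intros eps.
  pose proof (sqrt_weight_pos a Ha) as Hw.
  assert (He : 0 < eps * sqrt (w a) / 2) by (pose proof (cond_pos eps); nra).
  apply is_lim_seq_spec in Hb. destruct (Hb (mkposreal _ He)) as [N HN].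
  exists N.
  assert (K : forall k, (N <= k)%nat -> Rabs (fs k a - fs N a) < eps / 2).
  { intros k Hk. apply Rmult_lt_reg_r with (sqrt (w a)); auto.
    replace (fs k a - fs N a) with (lincomb 1 (fs k) (-1) (fs N) a) by lincomb_ring.
    eapply Rle_lt_trans; [apply abs_le_l2norm; auto|].
    specialize (Hcauchy N (k - N)%nat). replace (k - N + N)%nat with k in Hcauchy by lia.
    eapply Rle_lt_trans; [apply Hcauchy|].
    specialize (HN N (le_n _)). simpl in HN. apply Rabs_lt_between in HN. lra. }
  intros k m Hk Hm. replace (fs k a - fs m a) with ((fs k a - fs N a) - (fs m a - fs N a)) by ring.
  eapply Rle_lt_trans; [apply Rabs_triang|]. rewrite Rabs_Ropp.
  pose proof (K k Hk). pose proof (K m Hm). lra.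
Qed.

(* Riesz-Fischer: the bound on finite partial sums survives the pointwise limit. *)
Lemma L2_complete : exists f, L2 f /\ forall k, l2dist (fs k) f <= b k.
Proof.
  set (f := fun a => real (Lim_seq (fun k => fs k a))).
  assert (Hlim : forall a, P a -> is_lim_seq (fun k => fs k a) (f a))
    by (intros; now apply Lim_seq_correct', L2_cauchy_pointwise).
  assert (Hsum : forall k, L2 (lincomb 1 f (-1) (fs k)) /\
    tsum P (fun a => lincomb 1 f (-1) (fs k) a ^ 2 * w a) <= b k ^ 2).
  { intros k. apply summable_of_bounded; [intros; now apply sqr_weight_ge0|]. intros L HL.
    apply (is_lim_seq_le
      (fun j => sum_over (fun a => lincomb 1 (fs (j + k)%nat) (-1) (fs k) a ^ 2 * w a) L)
      (fun _ => b k ^ 2) (sum_over (fun a => lincomb 1 f (-1) (fs k) a ^ 2 * w a) L) (b k ^ 2));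
      [|apply (is_lim_seq_sum_over
        (fun j a => lincomb 1 (fs (j + k)%nat) (-1) (fs k) a ^ 2 * w a))
      | apply is_lim_seq_const].
    - intros j. apply Rle_trans with (l2dist (fs (j + k)%nat) (fs k) ^ 2).
      + unfold l2dist. rewrite l2norm_sqr by auto.
        apply (sum_over_le_has_sum (P := P)); auto using sqr_weight_ge0, has_sum_inner_self.
      + apply pow_incr. split; [apply l2norm_ge0 | apply Hcauchy].
    - intros a Ha. apply is_lim_seq_sqr_dist, (is_lim_seq_incr_n (fun k => fs k a)), Hlim, HL, Ha. }
  assert (Hf : L2 f).
  { apply (L2_ext (lincomb 1 (lincomb 1 f (-1) (fs O)) 1 (fs O))); [intros a _; lincomb_ring|].
    apply L2_lincomb; auto. apply Hsum. }
  exists f. split; auto. intros k. rewrite l2dist_sym by auto. apply l2norm_le_of_sqr.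
  - eapply Rle_trans; [apply l2norm_ge0 | apply (Hcauchy k O)].
  - rewrite <- (tsum_eq _ _ (has_sum_inner_self _ (proj1 (Hsum k)))). apply Hsum.
Qed.

End Completeness.

Lemma geometric_steps_cauchy fs q D : (forall k, L2 (fs k)) -> 0 <= q < 1 ->
  (forall k, l2dist (fs (S k)) (fs k) <= D * q ^ k) ->
  forall k j, l2dist (fs (j + k)%nat) (fs k) <= D / (1 - q) * q ^ k.
Proof.
  intros HL Hq Hstep k j. set (C := D / (1 - q)).
  assert (HCq : D = C * (1 - q)) by (unfold C; field; lra).
  assert (HC : 0 <= C).
  { pose proof (Hstep O) as Hfirst.
    pose proof (l2norm_ge0 (lincomb 1 (fs 1%nat) (-1) (fs O))) as Hnorm.
    fold (l2dist (fs 1%nat) (fs O)) in Hnorm. simpl in Hfirst. nra. }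
  apply Rle_trans with (C * (q ^ k - q ^ (j + k))).
  - induction j as [|j IH]; [change (0 + k)%nat with k; rewrite l2dist_self; lra|].
    eapply Rle_trans; [apply (l2dist_triangle _ (fs (j + k)%nat)); auto|].
    specialize (Hstep (j + k)%nat). rewrite HCq in Hstep. simpl in *. nra.
  - pose proof (pow_le q (j + k) (proj1 Hq)). nra.
Qed.

Record closed_subspace (H : (A -> R) -> Prop) : Prop := {
  subspace_L2 : forall f, H f -> L2 f;
  subspace_lincomb : forall c f e g, H f -> H g -> H (lincomb c f e g);
  subspace_closed : forall fs f, (forall k, H (fs k)) -> L2 f -> L2_cvg fs f -> H f }.

Section Subspace.
Context {H : (A -> R) -> Prop}.
Hypothesis Hclosed : closed_subspace H.

Lemma contraction_fixed_point (Phi : (A -> R) -> A -> R) q f0 : H f0 ->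
  (forall f, H f -> H (Phi f)) -> 0 <= q < 1 ->
  (forall f g, H f -> H g -> l2dist (Phi f) (Phi g) <= q * l2dist f g) ->
  exists f, H f /\ eq_on P (Phi f) f.
Proof.
  intros Hf0 HPhi Hq Hcontr.
  assert (HL : forall f, H f -> L2 f) by apply Hclosed.
  set (fs := fun k => Nat.iter k Phi f0).
  assert (Hfs : forall k, H (fs k)) by (induction k; simpl; auto).
  set (D := l2dist (fs 1%nat) (fs O)). set (C := D / (1 - q)).
  assert (Hcauchy : forall k j, l2dist (fs (j + k)%nat) (fs k) <= C * q ^ k).
  { apply geometric_steps_cauchy; auto. induction k as [|k IH].
    - simpl pow. rewrite Rmult_1_r. apply Rle_refl.
    - eapply Rle_trans; [apply (Hcontr (fs (S k)) (fs k)); auto|].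
      apply Rle_trans with (q * (D * q ^ k)); [now apply Rmult_le_compat_l | simpl; lra]. }
  assert (Hgeom : is_lim_seq (fun k => C * q ^ k) 0).
  { apply is_lim_seq_scal_0, is_lim_seq_geom. rewrite Rabs_pos_eq; lra. }
  destruct (L2_complete fs _ (fun k => HL _ (Hfs k)) Hgeom Hcauchy) as [f [Lf Hcvg]].
  assert (Hcv : L2_cvg fs f).
  { apply (is_lim_seq_le_le (fun _ => 0) _ (fun k => C * q ^ k)); auto using is_lim_seq_const.
    intros k. split; [apply l2norm_ge0 | apply Hcvg]. }
  assert (Hf : H f) by (apply (subspace_closed H Hclosed fs); auto).
  exists f. split; auto.
  assert (Hdist : l2dist (Phi f) f <= q * 0 + 0).
  { apply (is_lim_seq_le (fun _ => l2dist (Phi f) f)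
      (fun k => q * l2dist (fs k) f + l2dist (fs (S k)) f) (l2dist (Phi f) f) (q * 0 + 0));
      [|apply is_lim_seq_const|].
    - intros k. eapply Rle_trans; [apply (l2dist_triangle _ (fs (S k))); auto|].
      pose proof (Hcontr f (fs k) Hf (Hfs k)) as Hk. rewrite (l2dist_sym f) in Hk by auto.
      apply Rplus_le_compat_r, Hk.
    - apply is_lim_seq_plus'; [apply is_lim_seq_mult'; auto using is_lim_seq_const|].
      now apply (is_lim_seq_incr_1 (fun k => l2dist (fs k) f)). }
  rewrite Rmult_0_r, Rplus_0_r in Hdist.
  apply l2dist_eq0; auto.
Qed.

End Subspace.
End WeightedL2.

Lemma l2norm_reindex {A B} {P : A -> Prop} {Q : B -> Prop} (w : weight P) (v : weight Q)
    (f : A -> R) (g : B -> R) (h : A -> B) (k : B -> A) :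
  (forall a, P a -> f a ^ 2 * w a <> 0 ->
    Q (h a) /\ k (h a) = a /\ g (h a) ^ 2 * v (h a) = f a ^ 2 * w a) ->
  (forall b, Q b -> g b ^ 2 * v b <> 0 ->
    P (k b) /\ h (k b) = b /\ f (k b) ^ 2 * w (k b) = g b ^ 2 * v b) ->
  L2 v g -> L2 w f /\ l2norm w f = l2norm v g.
Proof.
  intros Hh Hk Hg.
  pose proof (has_sum_reindex P Q _ _ h k _ Hh Hk (has_sum_inner_self v g Hg)) as Hsum.
  assert (Hf : L2 w f) by now eexists; apply Hsum.
  split; auto. unfold l2norm. f_equal.
  exact (has_sum_unique _ _ _ (has_sum_inner_self w f Hf) Hsum).
Qed.

(** * Bounded symmetric operators *)

Definition shift {A : Type} (T : (A -> R) -> A -> R) (x : R) : (A -> R) -> A -> R :=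
  fun f a => T f a - x * f a.

Lemma shiftE {A} (T : (A -> R) -> A -> R) x f : shift T x f = lincomb 1 (T f) (- x) f.
Proof. apply functional_extensionality. unfold shift. lincomb_ring. Qed.

Record symmetric_operator {A : Type} {P : A -> Prop} (w : weight P) (H : (A -> R) -> Prop)
    (T : (A -> R) -> A -> R) (M : R) : Prop := {
  operator_maps : forall f, H f -> H (T f);
  operator_lincomb : forall c f e g, T (lincomb c f e g) = lincomb c (T f) e (T g);
  operator_symmetric : forall f g, H f -> H g -> inner w (T f) g = inner w f (T g);
  operator_bound_ge0 : 0 <= M;
  operator_bound : forall f, H f -> l2norm w (T f) <= M * l2norm w f }.

Arguments operator_maps {A P w H T M} _ f _.
Arguments operator_lincomb {A P w H T M} _ c f e g.
Arguments operator_symmetric {A P w H T M} _ f g _ _.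
Arguments operator_bound_ge0 {A P w H T M} _.
Arguments operator_bound {A P w H T M} _ f _.
Arguments subspace_L2 {A P w H} _ f _.
Arguments subspace_lincomb {A P w H} _ c f e g _ _.
Arguments subspace_closed {A P w H} _ fs f _ _ _.

Section Operator.
Context {A : Type} {P : A -> Prop} {w : weight P}.
Context {H : (A -> R) -> Prop} {T : (A -> R) -> A -> R} {M : R}.
Hypothesis Hclosed : closed_subspace w H.
Hypothesis Hsymm : symmetric_operator w H T M.

Let L2_H : forall f, H f -> L2 w f := subspace_L2 Hclosed.
Let L2_TH f (Hf : H f) : L2 w (T f) := L2_H _ (operator_maps Hsymm f Hf).
Let H_lincomb : forall c f e g, H f -> H g -> H (lincomb c f e g) := subspace_lincomb Hclosed.
Let H_T : forall f, H f -> H (T f) := operator_maps Hsymm.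
Hint Resolve L2_H L2_TH L2_lincomb H_lincomb H_T : core.

Lemma symmetric_operator_shift x : symmetric_operator w H (shift T x) (M + Rabs x).
Proof.
  split.
  - intros f Hf. rewrite shiftE. auto.
  - intros c f e g. rewrite !shiftE, (operator_lincomb Hsymm).
    apply functional_extensionality. lincomb_ring.
  - intros f g Hf Hg.
    rewrite !shiftE, inner_lincomb_l, inner_lincomb_r, (operator_symmetric Hsymm) by auto. ring.
  - pose proof (operator_bound_ge0 Hsymm); pose proof (Rabs_pos x). lra.
  - intros f Hf. rewrite shiftE. eapply Rle_trans; [apply l2norm_lincomb_le; auto|].
    rewrite Rabs_R1, Rabs_Ropp. pose proof (operator_bound Hsymm f Hf). lra.
Qed.

Section BoundedBelow.
Context {c : R}.
Hypothesis c_pos : 0 < c.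
Hypothesis bounded_below : forall f, H f -> c * l2norm w f <= l2norm w (T f).

Lemma bounded_below_injective f : H f -> eq_on P (T f) (fun _ => 0) -> eq_on P f (fun _ => 0).
Proof.
  intros Hf E. apply (l2norm_eq0 w); auto. specialize (bounded_below f Hf).
  rewrite (l2norm_eq0_of_eq0 w _ E) in bounded_below. pose proof (l2norm_ge0 w f). nra.
Qed.

Lemma richardson_contraction K h : c <= K -> M <= K -> H h ->
  l2norm w (lincomb 1 h (- / K ^ 2) (T (T h))) <= sqrt (1 - (c / K) ^ 2) * l2norm w h.
Proof.
  intros HcK HMK Hh. set (t := / K ^ 2). set (n := l2norm w h).
  assert (Ht : 0 < t) by (apply Rinv_0_lt_compat, pow_lt; lra).
  assert (HtK : t * K ^ 2 = 1) by (unfold t; field; lra).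
  assert (Hn : 0 <= n) by apply l2norm_ge0.
  assert (Hq : (c / K) ^ 2 = t * c ^ 2) by (unfold t; field; lra).
  assert (Hq1 : 0 <= 1 - (c / K) ^ 2).
  { rewrite Hq, <- HtK, <- Rmult_minus_distr_l. apply Rmult_le_pos; nra. }
  apply l2norm_le_of_sqr; [apply Rmult_le_pos; auto using sqrt_pos|].
  rewrite Rpow_mult_distr, pow2_sqrt, Hq by auto.
  rewrite inner_lincomb_self, <- (operator_symmetric Hsymm), <- !l2norm_sqr by auto. fold n.
  set (n1 := l2norm w (T h)). set (n2 := l2norm w (T (T h))).
  assert (Hupper : t ^ 2 * n2 ^ 2 <= t * n1 ^ 2).
  { replace (t * n1 ^ 2) with (t ^ 2 * (K * n1) ^ 2)
      by (transitivity (t * (t * K ^ 2) * n1 ^ 2); [ring | rewrite HtK; ring]).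
    apply Rmult_le_compat_l; [apply pow2_ge_0|]. apply pow_incr. split; [apply l2norm_ge0|].
    eapply Rle_trans; [apply (operator_bound Hsymm); auto|].
    apply Rmult_le_compat_r; auto. apply l2norm_ge0. }
  assert (Hlower : t * (c * n) ^ 2 <= t * n1 ^ 2).
  { apply Rmult_le_compat_l; [lra|]. apply pow_incr. split; [nra | now apply bounded_below]. }
  rewrite Rpow_mult_distr in Hlower. nra.
Qed.

(* Richardson iteration [f + t (g - T^2 f)] converges to a solution of [T^2 f = g]. *)
Lemma bounded_below_surjective g : H g -> exists f, H f /\ eq_on P (T f) g.
Proof.
  intros Hg. set (K := M + c). pose proof (operator_bound_ge0 Hsymm).
  set (t := / K ^ 2). assert (Ht : 0 < t) by (apply Rinv_0_lt_compat, pow_lt; unfold K; lra).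
  set (Phi := fun f => lincomb 1 f t (lincomb 1 g (-1) (T (T f)))).
  destruct (contraction_fixed_point w Hclosed Phi (sqrt (1 - (c / K) ^ 2)) g) as [f [Hf E]]; auto.
  - intros f Hf. unfold Phi. auto.
  - assert (Hpos : 0 < (c / K) ^ 2) by (apply pow_lt, Rdiv_lt_0_compat; unfold K; lra).
    assert (Hle : (c / K) ^ 2 <= 1 ^ 2).
    { apply pow_incr. split; [left; apply Rdiv_lt_0_compat | apply Rle_div_l]; unfold K; lra. }
    assert (Hlt : sqrt (1 - (c / K) ^ 2) < sqrt 1) by (apply sqrt_lt_1_alt; lra).
    rewrite sqrt_1 in Hlt. split; [apply sqrt_pos | exact Hlt].
  - intros f f' Hf Hf'. unfold l2dist at 1.
    replace (lincomb 1 (Phi f) (-1) (Phi f'))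
      with (lincomb 1 (lincomb 1 f (-1) f') (- t) (T (T (lincomb 1 f (-1) f')))).
    + apply richardson_contraction; unfold K; auto; lra.
    + rewrite !(operator_lincomb Hsymm). apply functional_extensionality.
      unfold Phi. lincomb_ring.
  - exists (T f). split; auto. intros a Ha. specialize (E a Ha). unfold Phi, lincomb in E. nra.
Qed.

End BoundedBelow.

Lemma L2_cvg_operator fs f : (forall k, H (fs k)) -> H f ->
  L2_cvg w fs f -> L2_cvg w (fun k => T (fs k)) (T f).
Proof.
  intros Hfs Hf Hc.
  apply (is_lim_seq_le_le (fun _ => 0) _ (fun k => M * l2dist w (fs k) f));
    [|apply is_lim_seq_const|].
  - intros k. split; [apply l2norm_ge0|]. unfold l2dist at 1. rewrite <- (operator_lincomb Hsymm).
    apply (operator_bound Hsymm), H_lincomb; auto.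
  - now apply is_lim_seq_scal_0.
Qed.

Lemma inner_operator_null f : H f -> l2norm w f <= 0 -> inner w (T f) f = 0.
Proof.
  intros Hf Hn. rewrite inner_sym. apply inner_eq0. intros a Ha.
  rewrite (l2norm_eq0 w f (L2_H f Hf) Hn a Ha). ring.
Qed.

Lemma normalize_rayleigh f : H f -> 0 < l2norm w f ->
  exists g, H g /\ l2norm w g = 1 /\ inner w (T f) f = l2norm w f ^ 2 * inner w (T g) g.
Proof.
  intros Hf Hn. exists (lincomb (/ l2norm w f) f 0 f).
  rewrite (operator_lincomb Hsymm), inner_lincomb_l, !inner_lincomb_r, l2norm_scal, Rabs_pos_eq
    by (auto; left; now apply Rinv_0_lt_compat).
  split; [auto|]. split; field; lra.
Qed.

Lemma rayleigh_minimizing_sequence f0 : H f0 -> 0 < l2norm w f0 ->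
  exists r (fs : nat -> A -> R), (forall g, H g -> r * l2norm w g ^ 2 <= inner w (T g) g) /\
    forall k, H (fs k) /\ l2norm w (fs k) = 1 /\ inner w (T (fs k)) (fs k) <= r + / INR (S k).
Proof.
  intros Hf0 Hn0.
  set (E := fun x => exists g, H g /\ l2norm w g = 1 /\ x = - inner w (T g) g).
  destruct (completeness E) as [r [Hub Hleast]].
  { exists M. intros x [g [Hg [Hn ->]]]. rewrite inner_sym.
    eapply Rle_trans; [apply Rle_abs|]. rewrite Rabs_Ropp.
    eapply Rle_trans; [apply abs_inner_le; auto|]. rewrite Hn, Rmult_1_l.
    pose proof (operator_bound Hsymm g Hg) as B. now rewrite Hn, Rmult_1_r in B. }
  { destruct (normalize_rayleigh f0 Hf0 Hn0) as [g [Hg [Hn _]]]. eexists. now exists g. }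
  exists (- r).
  destruct (functional_choice (fun k f => H f /\ l2norm w f = 1 /\
    inner w (T f) f <= - r + / INR (S k))) as [fs Hfs].
  { intros k. apply NNPP. intros N.
    assert (Hp : 0 < / INR (S k)) by apply Rinv_0_lt_compat, INR_S_pos.
    assert (r <= r - / INR (S k)); [|lra]. apply Hleast. intros x [g [Hg [Hn ->]]].
    apply Rnot_lt_le. intros Hlt. apply N. exists g. repeat split; auto. lra. }
  exists fs. split; auto. intros g Hg. destruct (Rle_lt_dec (l2norm w g) 0) as [Z|Z].
  - rewrite inner_operator_null by auto. pose proof (l2norm_ge0 w g).
    replace (l2norm w g) with 0 by lra. lra.
  - destruct (normalize_rayleigh g Hg Z) as [g' [Hg' [Hn ->]]].
    assert (- inner w (T g') g' <= r) by (apply Hub; now exists g').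
    rewrite Rmult_comm. apply Rmult_le_compat_l; [apply pow2_ge_0 | lra].
Qed.

(* The form [<T f, f> - r |f|^2] is nonnegative, so Cauchy-Schwarz for it makes its null vectors
   eigenfunctions. *)
Lemma rayleigh_minimizer_eigenfunction r f :
  (forall g, H g -> r * l2norm w g ^ 2 <= inner w (T g) g) ->
  H f -> inner w (T f) f <= r * l2norm w f ^ 2 -> eq_on P (shift T r f) (fun _ => 0).
Proof.
  intros Hr Hf Hmin. pose proof (symmetric_operator_shift r) as HS. set (S := shift T r) in *.
  assert (HSf : forall g, H g -> H (S g)) by apply (operator_maps HS).
  assert (Sinner : forall g, H g -> inner w (S g) g = inner w (T g) g - r * l2norm w g ^ 2).
  { intros g Hg. unfold S. rewrite shiftE, inner_lincomb_l, l2norm_sqr by auto. ring. }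
  assert (Hdisc : inner w (S f) (S f) ^ 2 <= inner w (S f) f * inner w (S (S f)) (S f)).
  { apply nonneg_quadratic_discriminant. intros t.
    replace (_ + _) with (inner w (S (lincomb 1 f t (S f))) (lincomb 1 f t (S f))).
    - rewrite Sinner by auto. specialize (Hr (lincomb 1 f t (S f)) ltac:(auto)). lra.
    - rewrite (operator_lincomb HS), inner_lincomb_l, !inner_lincomb_r by auto.
      rewrite (operator_symmetric HS (S f) f) by auto. ring. }
  assert (Hzero : inner w (S f) f = 0).
  { apply Rle_antisym; rewrite Sinner by auto; [lra|]. specialize (Hr f Hf). lra. }
  rewrite Hzero, Rmult_0_l in Hdisc. apply (l2norm_eq0 w); auto.
  apply l2norm_le_of_sqr; [lra|]. nra.
Qed.

End Operator.

Section Spectrum.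
Context {P : list nat -> Prop} {w : weight P}.
Context {H : form -> Prop} {T : form -> form} {M : R}.
Hypothesis Hclosed : closed_subspace w H.
Hypothesis Hsymm : symmetric_operator w H T M.

Lemma approximate_eigenfunction x : in_spec H (eq_on P) T x -> forall eps, 0 < eps ->
  exists f, H f /\ 0 < l2norm w f /\ l2norm w (shift T x f) < eps * l2norm w f.
Proof.
  intros Hx eps Heps. apply NNPP. intros N. apply Hx.
  pose proof (symmetric_operator_shift Hclosed Hsymm x) as HS.
  assert (Hb : forall f, H f -> eps * l2norm w f <= l2norm w (shift T x f)).
  { intros f Hf. destruct (Rle_lt_dec (l2norm w f) 0) as [Z|Z].
    - pose proof (l2norm_ge0 w (shift T x f)). nra.
    - apply Rnot_lt_le. intros L. apply N. now exists f. }
  split.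
  - exact (bounded_below_injective Hclosed Heps Hb).
  - exact (bounded_below_surjective Hclosed HS Heps Hb).
Qed.

Lemma spectrum_ge0 x : (forall f, H f -> 0 <= inner w (T f) f) -> in_spec H (eq_on P) T x -> 0 <= x.
Proof.
  intros Hpos Hx. apply Rnot_lt_le. intros Hlt.
  destruct (approximate_eigenfunction x Hx (- x / 2)) as [f [Hf [Hn Ha]]]; [lra|].
  pose proof (subspace_L2 Hclosed f Hf) as Lf.
  pose proof (subspace_L2 Hclosed _ (operator_maps Hsymm f Hf)) as LTf.
  rewrite shiftE in Ha.
  pose proof (inner_le w _ f (L2_lincomb w 1 (T f) (- x) f LTf Lf) Lf) as HC.
  rewrite inner_lincomb_l, <- (l2norm_sqr w f) in HC by auto. specialize (Hpos f Hf). nra.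
Qed.

Lemma eigenvalue_in_spectrum x f :
  H f -> 0 < l2norm w f -> eq_on P (shift T x f) (fun _ => 0) -> in_spec H (eq_on P) T x.
Proof.
  intros Hf Hn E [Hinj _]. specialize (Hinj f Hf E).
  rewrite (l2norm_eq0_of_eq0 w f Hinj) in Hn. lra.
Qed.

End Spectrum.

(** * The Rayleigh quotient over a finite index set *)

Section FiniteIndex.
Context {A : Type} {P : A -> Prop} (w : weight P).
Hypothesis finite_P : exists F, listing P F.

Lemma L2_finite f : L2 w f.
Proof. destruct finite_P as [F HF]. eexists. now apply (has_sum_listing P _ F). Qed.

Lemma L2_cvg_finite (fs : nat -> A -> R) (f : A -> R) :
  (forall a, P a -> is_lim_seq (fun k => fs k a) (f a)) -> L2_cvg w fs f.
Proof.
  intros Hc. destruct finite_P as [F HF].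
  assert (K : is_lim_seq (fun k => inner w (lincomb 1 (fs k) (-1) f) (lincomb 1 (fs k) (-1) f)) 0).
  { rewrite <- (sum_over_zero (fun a => (1 * f a + -1 * f a) ^ 2 * w a) F) by (intros; ring).
    apply (is_lim_seq_ext (fun k => sum_over (fun a => (1 * fs k a + -1 * f a) ^ 2 * w a) F)).
    - intros k. symmetry. apply tsum_eq.
      apply (has_sum_ext (fun a => (1 * fs k a + -1 * f a) ^ 2 * w a)); [lincomb_ring|].
      now apply has_sum_listing.
    - apply (is_lim_seq_sum_over (fun k a => (1 * fs k a + -1 * f a) ^ 2 * w a)).
      intros a Ha. apply is_lim_seq_sqr_dist, Hc, HF, Ha. }
  unfold L2_cvg, l2dist, l2norm. rewrite <- sqrt_0.
  apply (is_lim_seq_continuous sqrt _ 0); auto. apply continuity_pt_sqrt, Rle_refl.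
Qed.

Lemma bounded_L2_subseq fs r : (forall k, l2norm w (fs k) <= r) ->
  exists phi f, filterlim phi eventually eventually /\ L2_cvg w (fun k => fs (phi k)) f.
Proof.
  intros Hr. destruct finite_P as [F HF].
  destruct (bounded_family_subseq fs (fun a => r / sqrt (w a)) F) as [phi [Hphi Hlim]].
  { intros k a Ha. apply HF in Ha. apply Rle_div_r; [now apply sqrt_weight_pos|].
    eapply Rle_trans; [apply abs_le_l2norm; auto using L2_finite | apply Hr]. }
  exists phi, (fun a => real (Lim_seq (fun k => fs (phi k) a))). split; auto.
  apply L2_cvg_finite. intros a Ha. now apply Lim_seq_correct', Hlim, HF.
Qed.

Context {H : (A -> R) -> Prop} {T : (A -> R) -> A -> R} {M : R}.
Hypothesis Hclosed : closed_subspace w H.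
Hypothesis Hsymm : symmetric_operator w H T M.

Hint Resolve L2_finite : core.

Lemma rayleigh_min_attained f0 : H f0 -> 0 < l2norm w f0 ->
  exists f, H f /\ l2norm w f = 1 /\
    forall g, H g -> inner w (T f) f * l2norm w g ^ 2 <= inner w (T g) g.
Proof.
  intros Hf0 Hn0.
  destruct (rayleigh_minimizing_sequence Hclosed Hsymm f0 Hf0 Hn0) as [r [fs [Hr Hfs]]].
  destruct (bounded_L2_subseq fs 1) as [phi [f [Hphi Hc]]]; [intros; right; apply Hfs|].
  assert (Hf : H f).
  { apply (subspace_closed Hclosed (fun k => fs (phi k))); auto. intros; apply Hfs. }
  exists f. split; auto. split.
  - apply (is_lim_seq_eq (fun k => l2norm w (fs (phi k))) (fun _ => 1));
      [intros; apply Hfs | now apply L2_cvg_l2norm | apply is_lim_seq_const].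
  - assert (Hle : inner w (T f) f <= r + 0).
    { apply (is_lim_seq_le (fun k => inner w (T (fs (phi k))) (fs (phi k)))
        (fun k => r + / INR (S (phi k))) (inner w (T f) f) (r + 0)); [intros; apply Hfs | |].
      - apply L2_cvg_inner; auto. apply (L2_cvg_operator Hclosed Hsymm); auto. intros; apply Hfs.
      - apply is_lim_seq_plus'; [apply is_lim_seq_const|].
        now apply (is_lim_seq_subseq (fun k => / INR (S k))), is_lim_seq_inv_INR_S. }
    intros g Hg. eapply Rle_trans; [|apply Hr, Hg].
    apply Rmult_le_compat_r; [apply pow2_ge_0 | lra].
Qed.

End FiniteIndex.

Lemma rayleigh_ge_of_spectrum_ge {P : list nat -> Prop} (w : weight P) (H : form -> Prop)
    (T : form -> form) (M m : R) : (exists F, listing P F) ->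
  closed_subspace w H -> symmetric_operator w H T M ->
  (forall x, in_spec H (eq_on P) T x -> m <= x) ->
  forall f, H f -> m * l2norm w f ^ 2 <= inner w (T f) f.
Proof.
  intros Hfin Hclosed Hsymm Hm f Hf. destruct (Rle_lt_dec (l2norm w f) 0) as [Z|Z].
  - rewrite (inner_operator_null Hclosed f Hf Z). pose proof (l2norm_ge0 w f).
    replace (l2norm w f) with 0 by lra. lra.
  - destruct (rayleigh_min_attained w Hfin Hclosed Hsymm f Hf Z) as [g [Hg [Hn Hmin]]].
    eapply Rle_trans; [apply Rmult_le_compat_r; [apply pow2_ge_0|]|apply (Hmin f Hf)].
    apply Hm, (eigenvalue_in_spectrum (w := w) _ g); auto; [lra|].
    apply (rayleigh_minimizer_eigenfunction Hclosed Hsymm); auto. rewrite Hn. lra.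
Qed.

(** * Orientations *)

Lemma adj_swap_permutation s t : adj_swap s t -> Permutation s t.
Proof. intros [l1 a b l2]. apply Permutation_app_head, perm_swap. Qed.

Lemma adj_swap_cons v s t : adj_swap s t -> adj_swap (v :: s) (v :: t).
Proof. intros [l1 a b l2]. apply (AdjSwap (v :: l1)). Qed.

Lemma perm_par_permutation b s t : perm_par b s t -> Permutation s t.
Proof. induction 1; eauto using adj_swap_permutation, Permutation_trans. Qed.

Lemma perm_par_swap s t : adj_swap s t -> perm_par true s t.
Proof. intros H. apply (pp_step false s s t); auto. constructor. Qed.

Lemma perm_par_cons v b s t : perm_par b s t -> perm_par b (v :: s) (v :: t).
Proof. induction 1; econstructor; eauto using adj_swap_cons. Qed.

Lemma perm_par_trans b c s t u : perm_par b s t -> perm_par c t u -> perm_par (xorb b c) s u.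
Proof.
  intros Hst Htu. induction Htu as [|c t u v Htu IH Ha].
  - now rewrite Bool.xorb_false_r.
  - replace (xorb b (negb c)) with (negb (xorb b c)) by (destruct b, c; reflexivity).
    econstructor; eauto.
Qed.

Lemma perm_par_map phi b s t : perm_par b s t -> perm_par b (map phi s) (map phi t).
Proof.
  induction 1 as [|b s t u _ IH Ha]; [constructor|]. econstructor; eauto.
  destruct Ha as [l1 x y l2]. rewrite !map_app. simpl. constructor.
Qed.

Lemma permutation_perm_par s t : Permutation s t -> exists b, perm_par b s t.
Proof.
  induction 1 as [|x l l' _ [b IH]|x y l|l l' l'' _ [b IH1] _ [c IH2]].
  - exists false. constructor.
  - exists b. now apply perm_par_cons.
  - exists true. apply perm_par_swap. exact (AdjSwap [] y x l).
  - exists (xorb b c). eapply perm_par_trans; eauto.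
Qed.

Lemma dcell_permutation X k s t : dcell X k s -> Permutation s t -> dcell X k t.
Proof.
  intros [H E] Hp. split; [eapply cell_perm; eauto|].
  rewrite <- E. symmetry. now apply Permutation_length.
Qed.

Definition sign (b : bool) : R := if b then -1 else 1.

Lemma sign_odd i : sign (Nat.odd i) = (-1) ^ i.
Proof.
  induction i; [reflexivity|]. rewrite Nat.odd_succ, <- Nat.negb_odd. simpl pow. rewrite <- IHi.
  destruct (Nat.odd i); simpl; ring.
Qed.

Lemma is_form_of_swap X k f :
  (forall s t, dcell X k s -> adj_swap s t -> f t = - f s) -> is_form X k f.
Proof.
  intros H s t Hs Hp.
  assert (G : forall b, perm_par b s t -> f t = sign b * f s); [|rewrite (G true Hp); simpl; ring].
  clear Hp. induction 1 as [|b s t u Hp IH Ha]; [simpl; ring|].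
  rewrite (H t u), IH; auto; [destruct b; simpl; ring|].
  eapply dcell_permutation; eauto using perm_par_permutation.
Qed.

Lemma is_form_perm_par X k f b s t :
  is_form X k f -> dcell X k s -> perm_par b s t -> f t = sign b * f s.
Proof.
  intros Hf Hs Hp. induction Hp as [|b s t u Hp IH Ha]; [simpl; ring|].
  rewrite (Hf t u), IH; auto using perm_par_swap; [destruct b; simpl; ring|].
  eapply dcell_permutation; eauto using perm_par_permutation.
Qed.

Lemma is_form_sqr X k f s t :
  is_form X k f -> dcell X k s -> Permutation s t -> f t ^ 2 = f s ^ 2.
Proof.
  intros Hf Hs Hp. destruct (permutation_perm_par s t Hp) as [b Hb].
  rewrite (is_form_perm_par X k f b s t) by auto. destruct b; simpl; ring.
Qed.

Lemma is_form_lincomb X k c f e g :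
  is_form X k f -> is_form X k g -> is_form X k (lincomb c f e g).
Proof. intros Hf Hg s t Hs Hp. unfold lincomb. rewrite (Hf s t), (Hg s t) by auto. ring. Qed.

Lemma is_form_mul X k (m f : form) : (forall s t, Permutation s t -> m s = m t) ->
  is_form X k f -> is_form X k (fun s => m s * f s).
Proof.
  intros Hm Hf s t Hs Hp.
  rewrite (Hf s t), (Hm s t) by eauto using perm_par_permutation. ring.
Qed.

Lemma is_form_closed X k (w : weight (dcell X k)) fs f :
  (forall j, is_form X k (fs j)) -> (forall j, L2 w (fs j)) -> L2 w f -> L2_cvg w fs f ->
  is_form X k f.
Proof.
  intros Hfs HL Hf Hc s t Hs Hp.
  assert (Ht : dcell X k t) by eauto using dcell_permutation, perm_par_permutation.
  pose proof (L2_cvg_pointwise w fs f s HL Hf Hc Hs) as Cs.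
  pose proof (L2_cvg_pointwise w fs f t HL Hf Hc Ht) as Ct.
  apply is_lim_seq_opp in Cs.
  apply (is_lim_seq_eq (fun j => fs j t) (fun j => - fs j s)); auto. intros; now apply Hfs.
Qed.

(** * Faces and the coboundary *)

Definition move_front (i : nat) (t : list nat) : list nat := nth i t O :: rem i t.

Definition insert_head (i : nat) (t : list nat) : list nat :=
  match t with [] => [] | a :: l => firstn i l ++ a :: skipn i l end.

Lemma rem_cons i a l : rem (S i) (a :: l) = a :: rem i l.
Proof. reflexivity. Qed.

Lemma move_front_perm_par i t : (i < length t)%nat -> perm_par (Nat.odd i) t (move_front i t).
Proof.
  revert i; induction t as [|a l IH]; intros i Hi; [simpl in Hi; lia|].
  destruct i as [|i]; [constructor|].
  rewrite Nat.odd_succ, <- Nat.negb_odd. simpl in Hi.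
  apply (pp_step _ _ (a :: move_front i l)); [apply perm_par_cons, IH; lia|].
  exact (AdjSwap [] a (nth i l O) (rem i l)).
Qed.

Lemma move_front_permutation i t : (i < length t)%nat -> Permutation t (move_front i t).
Proof. intros. eapply perm_par_permutation, move_front_perm_par; auto. Qed.

Lemma insert_head_move_front i t : (i < length t)%nat -> insert_head i (move_front i t) = t.
Proof.
  revert i; induction t as [|a l IH]; intros i Hi; [simpl in Hi; lia|].
  destruct i as [|i]; [reflexivity|]. simpl in Hi.
  unfold move_front. rewrite rem_cons. simpl. f_equal. apply (IH i). lia.
Qed.

Lemma move_front_insert_head i t : (i < length t)%nat -> move_front i (insert_head i t) = t.
Proof.
  destruct t as [|a l]; [simpl; lia|]. simpl length. simpl insert_head.
  revert i; induction l as [|b l IH]; intros i Hi.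
  - simpl in Hi. now replace i with O by lia.
  - destruct i as [|i]; [reflexivity|]. simpl in Hi. specialize (IH i ltac:(lia)).
    unfold move_front in *. simpl firstn; simpl skipn; simpl app. rewrite rem_cons. simpl nth.
    injection IH as -> ->. reflexivity.
Qed.

Lemma insert_head_permutation i t : (i < length t)%nat -> Permutation t (insert_head i t).
Proof.
  destruct t as [|a l]; [simpl; lia|]. intros _. simpl.
  rewrite <- (firstn_skipn i l) at 1. apply Permutation_middle.
Qed.

Lemma dcell_tl X k t : dcell X (S k) t -> dcell X k (tl t).
Proof.
  destruct t as [|a l]; intros [Hc E]; [discriminate|]. injection E as E. split; auto.
  pose proof (cell_nodup X _ Hc) as N. inversion N; subst.
  apply (cell_sub X _ _ Hc); auto. intros x Hx. simpl; auto.
Qed.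

Lemma dcell_rem X k t i : dcell X (S k) t -> (i <= k)%nat -> dcell X k (rem i t).
Proof.
  intros Ht Hi. apply (dcell_tl X k (move_front i t)), (dcell_permutation X (S k) t); auto.
  apply move_front_permutation. destruct Ht. lia.
Qed.

Lemma rem_incl i t : incl (rem i t) t.
Proof.
  intros x Hx. unfold rem in Hx. rewrite <- (firstn_skipn i t). apply in_app_iff.
  apply in_app_iff in Hx as [|Hx]; auto. right.
  change (S i) with (1 + i)%nat in Hx. rewrite <- skipn_skipn in Hx.
  destruct (skipn i t); simpl in *; auto.
Qed.

Lemma map_rem (phi : nat -> nat) i t : map phi (rem i t) = rem i (map phi t).
Proof. unfold rem. now rewrite map_app, firstn_map, skipn_map. Qed.

Definition coboundary (g : form) : form :=
  fun t => sum_over (fun i => (-1) ^ i * g (rem i t)) (seq 0 (length t)).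

Lemma coboundary_cons g a l :
  coboundary g (a :: l) = g l - coboundary (fun s => g (a :: s)) l.
Proof.
  unfold coboundary. simpl length. simpl seq. rewrite sum_over_cons, <- seq_shift, sum_over_map.
  rewrite (sum_over_ext _ (fun i => -1 * ((-1) ^ i * g (a :: rem i l)))).
  - rewrite sum_over_scal. change (rem 0 (a :: l)) with l. simpl. ring.
  - intros i _. rewrite rem_cons. simpl. ring.
Qed.

Lemma coboundary_lincomb c f e g :
  coboundary (lincomb c f e g) = lincomb c (coboundary f) e (coboundary g).
Proof.
  apply functional_extensionality. intros t. unfold coboundary, lincomb.
  rewrite <- !sum_over_scal, <- sum_over_add. apply sum_over_ext. intros; ring.
Qed.

Lemma coboundary_ext g g' t :
  (forall i, (i < length t)%nat -> g (rem i t) = g' (rem i t)) -> coboundary g t = coboundary g' t.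
Proof.
  intros H. apply sum_over_ext. intros i Hi. apply in_seq in Hi. now rewrite H by lia.
Qed.

Lemma coboundary_coboundary g t : coboundary (coboundary g) t = 0.
Proof.
  revert g; induction t as [|a l IH]; intros g; [reflexivity|].
  rewrite coboundary_cons.
  replace (fun s => coboundary g (a :: s))
    with (lincomb 1 g (-1) (coboundary (fun s => g (a :: s)))).
  - rewrite coboundary_lincomb. unfold lincomb. rewrite IH. ring.
  - apply functional_extensionality. intros s. rewrite coboundary_cons. lincomb_ring.
Qed.

Lemma coboundary_swap (Q : list nat -> Prop) g s t :
  (forall u v, Q u -> adj_swap u v -> g v = - g u) ->
  (forall i, (i < length s)%nat -> Q (rem i s)) -> adj_swap s t ->
  coboundary g t = - coboundary g s.
Proof.
  intros Hg HQ Hst. destruct Hst as [l1 a b l2]. revert Q g Hg HQ.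
  induction l1 as [|c l1 IH]; intros Q g Hg HQ; simpl app in *; rewrite !coboundary_cons.
  - rewrite (coboundary_ext (fun s => g (b :: a :: s))
      (lincomb (-1) (fun s => g (a :: b :: s)) 0 (fun _ => 0))).
    + rewrite coboundary_lincomb. unfold lincomb. ring.
    + intros i Hi. specialize (HQ (S (S i)) ltac:(simpl; lia)). rewrite !rem_cons in HQ.
      rewrite (Hg _ (b :: a :: rem i l2) HQ); [lincomb_ring|]. exact (AdjSwap [] a b (rem i l2)).
  - rewrite (IH (fun u => Q (c :: u)) (fun s => g (c :: s))).
    + rewrite (Hg (l1 ++ a :: b :: l2)); [ring | | constructor]. apply (HQ O). simpl; lia.
    + intros u v Hu Hv. apply Hg; auto. now apply adj_swap_cons.
    + intros i Hi. apply (HQ (S i)). simpl; lia.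
Qed.

Lemma coboundary_is_form X k g : is_form X k g -> is_form X (S k) (coboundary g).
Proof.
  intros Hg. apply is_form_of_swap. intros s t Hs. apply (coboundary_swap (dcell X k)).
  - intros u v Hu Hv. apply Hg; auto. now apply perm_par_swap.
  - intros i Hi. apply (dcell_rem X k); auto. destruct Hs; lia.
Qed.

(** * Neighbouring vertices and the boundary *)

Lemma fsum_enumerates P g L : enumerates P L -> fsum P g = sum_over g L.
Proof.
  intros HL. unfold fsum.
  destruct (excluded_middle_informative _) as [H|H]; [|now destruct H; exists L].
  destruct (constructive_indefinite_description _ H) as [L' [HN' HE']]; simpl.
  destruct HL as [HN HE]. apply sum_over_same_elements; auto. intros a. now rewrite HE', HE.
Qed.

Lemma fcard_enumerates P L : enumerates P L -> fcard P = length L.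
Proof.
  intros HL. unfold fcard.
  destruct (excluded_middle_informative _) as [H|H]; [|now destruct H; exists L].
  destruct (constructive_indefinite_description _ H) as [L' [HN' HE']]; simpl.
  destruct HL as [HN HE]. apply Permutation_length, NoDup_Permutation; auto.
  intros a. now rewrite HE', HE.
Qed.

Lemma fsum_lincomb P c g e h : fsum P (lincomb c g e h) = c * fsum P g + e * fsum P h.
Proof.
  unfold fsum. destruct (excluded_middle_informative _) as [H|H]; [|ring].
  destruct (constructive_indefinite_description _ H) as [L HL]; simpl.
  fold (sum_over g L) (sum_over h L) (sum_over (lincomb c g e h) L).
  rewrite <- !sum_over_scal, <- sum_over_add. reflexivity.
Qed.

Lemma fsum_ext P g h : (forall v, P v -> g v = h v) -> fsum P g = fsum P h.
Proof.
  intros E. unfold fsum. destruct (excluded_middle_informative _) as [H|H]; auto.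
  destruct (constructive_indefinite_description _ H) as [L HL]; simpl.
  apply sum_over_ext. intros v Hv. apply E, HL, Hv.
Qed.

Lemma fsum_zero P g : (forall v, P v -> g v = 0) -> fsum P g = 0.
Proof.
  intros E. rewrite (fsum_ext P g (lincomb 0 g 0 g)); [rewrite fsum_lincomb; ring|].
  intros v Hv. unfold lincomb. rewrite (E v Hv). ring.
Qed.

Lemma nbv_permutation X s t : Permutation s t -> nbv X s = nbv X t.
Proof.
  assert (G : forall s t v, Permutation s t -> nbv X s v -> nbv X t v).
  { intros s' t' v Hp [Hnotin Hcell]. split.
    - intros Hin. apply Hnotin. eapply Permutation_in; [apply Permutation_sym|]; eauto.
    - eapply cell_perm; [|apply Hcell]. now constructor. }
  intros Hp. apply functional_extensionality. intros v. apply propositional_extensionality.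
  split; apply G; auto using Permutation_sym.
Qed.

Lemma deg_permutation X s t : Permutation s t -> deg X s = deg X t.
Proof. intros Hp. unfold deg. now rewrite (nbv_permutation X s t). Qed.

Lemma nbv_dcell X k s v : dcell X k s -> nbv X s v <-> dcell X (S k) (v :: s).
Proof.
  intros [Hc E]. unfold nbv, dcell. simpl. split.
  - intros [_ H]; auto.
  - intros [H _]. pose proof (cell_nodup X _ H) as N. inversion N; auto.
Qed.

Lemma deg_le_enumerates X s n : deg_le X s n ->
  exists L, enumerates (nbv X s) L /\ (length L <= n)%nat.
Proof.
  intros H. apply NNPP. intros N.
  assert (G : forall m, exists L, NoDup L /\ (forall v, In v L -> nbv X s v) /\ length L = m).
  { induction m as [|m [L [Hnodup [Hnbv Hlen]]]].
    - exists []. split; [constructor | split; [simpl; tauto | reflexivity]].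
    - destruct (classic (exists v, nbv X s v /\ ~ In v L)) as [[v [Hv Hn]]|N'].
      + exists (v :: L). split; [now constructor|]. split; [|simpl; lia].
        intros u [<-|Hu]; auto.
      + exfalso. apply N. exists L. split; [split; auto | now apply H]. intros v. split; auto.
        intros Hv. apply NNPP. intros Hn. apply N'. eauto. }
  destruct (G (S n)) as [L [Hnodup [Hnbv Hlen]]]. specialize (H L Hnodup Hnbv). lia.
Qed.

Lemma deg_le_deg X s n : deg_le X s n -> INR (deg X s) <= INR n.
Proof.
  intros H. apply le_INR. destruct (deg_le_enumerates X s n H) as [L [HL Hn]].
  unfold deg. now rewrite (fcard_enumerates _ L).
Qed.

Definition locally_finite (X : complex) (k : nat) : Prop :=
  forall s, dcell X k s -> exists L, enumerates (nbv X s) L.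

Lemma deg_le_locally_finite X k n : (forall s, dcell X k s -> deg_le X s n) -> locally_finite X k.
Proof. intros H s Hs. destruct (deg_le_enumerates X s n (H s Hs)) as [L [HL _]]. now exists L. Qed.

Lemma finite_locally_finite X k : finite_complex X -> locally_finite X k.
Proof.
  intros [N HN] s Hs. exists (select (nbv X s) (seq 0 N)).
  split; [apply NoDup_select, seq_NoDup|]. intros v. rewrite in_select, in_seq.
  split; [tauto|]. intros Hv. split; auto. split; [lia|].
  apply (HN (v :: s)); [apply Hv | simpl; auto].
Qed.

Definition neighbours (X : complex) (s : list nat) : list nat :=
  epsilon (inhabits []) (enumerates (nbv X s)).

Lemma bdry_lincomb X c f e g : bdry X (lincomb c f e g) = lincomb c (bdry X f) e (bdry X g).
Proof. apply functional_extensionality. intros s. apply fsum_lincomb. Qed.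

Lemma bdry_eq0 X k f s : dcell X k s -> feq X (S k) f zero_form -> bdry X f s = 0.
Proof. intros Hs E. apply fsum_zero. intros v Hv. now apply E, nbv_dcell. Qed.

Lemma bdry_is_form X k f : is_form X (S k) f -> is_form X k (bdry X f).
Proof.
  intros Hf s t Hs Hp. unfold bdry.
  rewrite <- (nbv_permutation X s t) by eauto using perm_par_permutation.
  rewrite (fsum_ext _ _ (lincomb (-1) (fun v => f (v :: s)) 0 (fun _ => 0))).
  - rewrite fsum_lincomb. ring.
  - intros v Hv. rewrite (Hf (v :: s) (v :: t)); [lincomb_ring | now apply nbv_dcell |].
    now apply perm_par_cons.
Qed.

Section LocallyFinite.
Context {X : complex} {k : nat}.
Hypothesis HX : locally_finite X k.

Lemma neighbours_enumerates s : dcell X k s -> enumerates (nbv X s) (neighbours X s).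
Proof. intros Hs. unfold neighbours. now apply epsilon_spec, HX. Qed.

Lemma deg_neighbours s : dcell X k s -> deg X s = length (neighbours X s).
Proof. intros. now apply fcard_enumerates, neighbours_enumerates. Qed.

Lemma bdry_neighbours f s :
  dcell X k s -> bdry X f s = sum_over (fun v => f (v :: s)) (neighbours X s).
Proof. intros. now apply fsum_enumerates, neighbours_enumerates. Qed.

Lemma tl_fibres :
  fibres (dcell X (S k)) (dcell X k) (@tl nat) (fun s => map (fun v => v :: s) (neighbours X s)).
Proof.
  split; [apply dcell_tl|]. intros s Hs. destruct (neighbours_enumerates s Hs) as [N E]. split.
  - apply Injective_map_NoDup; auto. intros a b. congruence.
  - intros t. rewrite in_map_iff. split.
    + intros [v [<- Hv]]. split; auto. now apply nbv_dcell, E.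
    + intros [Ht <-]. destruct t as [|v t]; [destruct Ht; discriminate|].
      exists v. split; auto. now apply E, (nbv_dcell X k).
Qed.

Lemma bdry_bdry f : is_form X (S (S k)) f -> feq X k (bdry X (bdry X f)) zero_form.
Proof.
  intros Hf s Hs. destruct (neighbours_enumerates s Hs) as [N E].
  set (L := neighbours X s) in *.
  set (u := fun v w => extend_zero (dcell X (S (S k))) f (w :: v :: s)).
  assert (Eu : bdry X (bdry X f) s = sum_over (fun v => sum_over (u v) L) L).
  { rewrite bdry_neighbours by auto. apply sum_over_ext. intros v Hv.
    apply E, (nbv_dcell X k) in Hv; auto.
    assert (HvL : enumerates (nbv X (v :: s)) (select (nbv X (v :: s)) L)).
    { split; [now apply NoDup_select|]. intros w. rewrite in_select. split; [tauto|].
      intros Hw. split; auto. apply E, (nbv_dcell X k); auto.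
      apply (nbv_dcell X (S k)) in Hw; auto.
      apply (dcell_tl X (S k) (v :: w :: s)), (dcell_permutation X _ (w :: v :: s)); auto.
      constructor. }
    unfold bdry. rewrite (fsum_enumerates _ _ _ HvL), <- (sum_over_select (u v) (nbv X (v :: s)) L).
    - apply sum_over_ext. intros w Hw. apply in_select in Hw as [_ Hw].
      symmetry. apply extend_zero_in. now apply nbv_dcell.
    - intros w _ Hw. apply extend_zero_out. intros Hc. now apply Hw, (nbv_dcell X (S k)). }
  assert (Hsym : forall v w, dcell X (S (S k)) (w :: v :: s) -> dcell X (S (S k)) (v :: w :: s)).
  { intros v w Hc. apply (dcell_permutation X _ _ _ Hc). constructor. }
  assert (Hanti : forall v w, u v w = -1 * u w v).
  { intros v w. unfold u. destruct (classic (dcell X (S (S k)) (w :: v :: s))) as [Hc|Hc].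
    - rewrite !extend_zero_in by auto.
      rewrite (Hf (w :: v :: s) (v :: w :: s)); auto; [ring|].
      apply perm_par_swap. exact (AdjSwap [] w v s).
    - rewrite !extend_zero_out by auto. ring. }
  assert (Eneg :
    sum_over (fun v => sum_over (u v) L) L = -1 * sum_over (fun v => sum_over (u v) L) L).
  { rewrite sum_over_exchange at 1. rewrite <- sum_over_scal. apply sum_over_ext. intros v _.
    rewrite <- sum_over_scal. now apply sum_over_ext. }
  rewrite Eu. unfold zero_form. lra.
Qed.

Lemma has_sum_tl_sqr (h : form) l :
  has_sum (dcell X k) (fun s => INR (deg X s) * h s ^ 2) l ->
  has_sum (dcell X (S k)) (fun t => h (tl t) ^ 2) l.
Proof.
  intros H. apply (has_sum_of_fibres tl_fibres); [intros; apply pow2_ge_0|].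
  revert H. apply has_sum_ext. intros s Hs. rewrite sum_over_map. simpl tl.
  now rewrite sum_over_const, deg_neighbours.
Qed.

End LocallyFinite.

Lemma has_sum_move_front X k i (u : form) l : (i <= k)%nat ->
  has_sum (dcell X (S k)) u l -> has_sum (dcell X (S k)) (fun t => u (move_front i t)) l.
Proof.
  intros Hi. apply (has_sum_reindex _ _ _ _ (move_front i) (insert_head i)).
  - intros t Ht _. assert (Hl : (i < length t)%nat) by (destruct Ht; lia).
    split; [|split; [now apply insert_head_move_front | reflexivity]].
    eauto using dcell_permutation, move_front_permutation.
  - intros t Ht _. assert (Hl : (i < length t)%nat) by (destruct Ht; lia).
    rewrite move_front_insert_head by auto.
    eauto using dcell_permutation, insert_head_permutation.
Qed.

(** * Weighted coboundaries and their Laplacians *)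

(* Up to the factor [k + 1], which counts the possible first vertices, this is the adjoint of the
   boundary for the inner products with weights [w] and [v]. [delta_top] has [w = 1 / deg], [v = 1]
   and [delta_low] has [w = 1], [v = 1 / deg]. *)
Definition weighted_coboundary (w v : list nat -> R) (g : form) : form :=
  fun t => coboundary (fun s => w s * g s) t / v t.

Definition weighted_laplacian (X : complex) (w v : list nat -> R) (g : form) : form :=
  bdry X (weighted_coboundary w v g).

Lemma weighted_coboundary_lincomb w v c f e g :
  weighted_coboundary w v (lincomb c f e g) =
  lincomb c (weighted_coboundary w v f) e (weighted_coboundary w v g).
Proof.
  apply functional_extensionality. intros t. unfold weighted_coboundary.
  replace (fun s => w s * lincomb c f e g s)
    with (lincomb c (fun s => w s * f s) e (fun s => w s * g s))
    by (apply functional_extensionality; lincomb_ring).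
  rewrite coboundary_lincomb. unfold lincomb, Rdiv. ring.
Qed.

Lemma weighted_laplacian_lincomb X w v c f e g :
  weighted_laplacian X w v (lincomb c f e g) =
  lincomb c (weighted_laplacian X w v f) e (weighted_laplacian X w v g).
Proof. unfold weighted_laplacian. now rewrite weighted_coboundary_lincomb, bdry_lincomb. Qed.

Lemma weighted_coboundary_coboundary X k u (w : weight (dcell X k)) v g :
  feq X (S k) (weighted_coboundary w v (weighted_coboundary u w g)) zero_form.
Proof.
  intros t Ht. unfold weighted_coboundary at 1.
  rewrite (coboundary_ext _ (coboundary (fun s => u s * g s))).
  - rewrite coboundary_coboundary. unfold zero_form, Rdiv. ring.
  - intros i Hi. unfold weighted_coboundary. field. apply Rgt_not_eq, weight_pos.
    apply dcell_rem; auto. destruct Ht. lia.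
Qed.

Record weight_bounds {X : complex} {k : nat} (w : weight (dcell X k)) (v : weight (dcell X (S k)))
    (B C : R) : Prop := {
  bounds_locally_finite : locally_finite X k;
  bounds_ge0 : 0 <= B /\ 0 <= C;
  bounds_degree : forall s, dcell X k s -> INR (deg X s) * w s <= B;
  bounds_coweight : forall t, dcell X (S k) t -> 1 <= C * v t;
  bounds_permutation : forall s t, Permutation s t -> w s = w t;
  bounds_copermutation : forall s t, Permutation s t -> v s = v t }.

Arguments bounds_locally_finite {X k w v B C} _.
Arguments bounds_ge0 {X k w v B C} _.
Arguments bounds_degree {X k w v B C} _ s _.
Arguments bounds_coweight {X k w v B C} _ t _.
Arguments bounds_permutation {X k w v B C} _ s t _.
Arguments bounds_copermutation {X k w v B C} _ s t _.

Section WeightedCoboundary.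
Context {X : complex} {k : nat} {w : weight (dcell X k)} {v : weight (dcell X (S k))} {B C : R}.
Hypothesis Hbounds : weight_bounds w v B C.

Notation delta := (weighted_coboundary w v).
Notation laplacian := (weighted_laplacian X w v).

Let B_ge0 : 0 <= B := proj1 (bounds_ge0 Hbounds).
Let C_ge0 : 0 <= C := proj2 (bounds_ge0 Hbounds).
Let HX : locally_finite X k := bounds_locally_finite Hbounds.

Lemma weighted_coboundary_is_form g : is_form X k g -> is_form X (S k) (delta g).
Proof.
  intros Hg. assert (Hv : forall s t, Permutation s t -> / v s = / v t).
  { intros s t Hp. now rewrite (bounds_copermutation Hbounds s t). }
  replace (delta g) with (fun t => / v t * coboundary (fun s => w s * g s) t)
    by (apply functional_extensionality; intros; unfold weighted_coboundary, Rdiv; ring).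
  apply is_form_mul, coboundary_is_form, is_form_mul; auto. apply (bounds_permutation Hbounds).
Qed.

Lemma weighted_laplacian_is_form g : is_form X k g -> is_form X k (laplacian g).
Proof. intros. now apply bdry_is_form, weighted_coboundary_is_form. Qed.

Lemma sqr_summable_of_coL2 F : L2 v F ->
  summable (dcell X (S k)) (fun t => F t ^ 2) /\
  tsum (dcell X (S k)) (fun t => F t ^ 2) <= C * l2norm v F ^ 2.
Proof.
  intros HF. rewrite l2norm_sqr, <- (tsum_eq _ _ (has_sum_inner_self v F HF)), <- tsum_scal by auto.
  apply summable_nonneg_le; [|now apply summable_scal].
  intros t Ht. split; [apply pow2_ge_0|].
  pose proof (bounds_coweight Hbounds t Ht). pose proof (pow2_ge_0 (F t)). nra.
Qed.

Lemma sqr_summable_tl_of_L2 g : L2 w g -> exists l, l <= B * l2norm w g ^ 2 /\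
  has_sum (dcell X (S k)) (fun t => (w (tl t) * g (tl t)) ^ 2) l.
Proof.
  intros Hg. set (h := fun s => w s * g s).
  destruct (summable_nonneg_le (P := dcell X k) (fun s => INR (deg X s) * h s ^ 2)
    (fun s => B * (g s ^ 2 * w s))) as [Hs Hle].
  - intros s Hs. unfold h. pose proof (weight_pos w s Hs). pose proof (pow2_ge_0 (g s)).
    pose proof (bounds_degree Hbounds s Hs). pose proof (pos_INR (deg X s)).
    split; [apply Rmult_le_pos; auto using pow2_ge_0|].
    replace (INR (deg X s) * (w s * g s) ^ 2) with (INR (deg X s) * w s * (g s ^ 2 * w s)) by ring.
    apply Rmult_le_compat_r; nra.
  - now apply summable_scal.
  - eexists. split; [|apply (has_sum_tl_sqr HX h), tsum_has_sum, Hs].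
    eapply Rle_trans; [apply Hle|]. rewrite tsum_scal by auto.
    rewrite l2norm_sqr, <- (tsum_eq _ _ (has_sum_inner_self w g Hg)) by auto. apply Rle_refl.
Qed.

Lemma weighted_coboundary_sqr_le g t : dcell X (S k) t ->
  delta g t ^ 2 * v t <=
  C * (INR (S k) * sum_over (fun i => (w (rem i t) * g (rem i t)) ^ 2) (seq 0 (S k))).
Proof.
  intros Ht. pose proof (weight_pos v t Ht). pose proof (bounds_coweight Hbounds t Ht).
  set (h := fun s => w s * g s). unfold weighted_coboundary. fold h.
  apply Rle_trans with (C * coboundary h t ^ 2).
  - replace ((coboundary h t / v t) ^ 2 * v t) with (/ v t * coboundary h t ^ 2) by (field; lra).
    apply Rmult_le_compat_r; [apply pow2_ge_0|]. rewrite <- (Rmult_1_l (/ v t)).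
    now apply Rle_div_l.
  - apply Rmult_le_compat_l; auto. unfold coboundary. rewrite (proj2 Ht).
    eapply Rle_trans; [apply sum_over_sqr_le|]. rewrite length_seq. right. f_equal.
    apply sum_over_ext. intros i _. rewrite Rpow_mult_distr, <- pow_mult, Nat.mul_comm, pow_mult.
    replace ((-1) ^ 2) with 1 by ring. rewrite pow1. unfold h. ring.
Qed.

Lemma weighted_coboundary_bound g : L2 w g ->
  L2 v (delta g) /\ l2norm v (delta g) <= INR (S k) * sqrt (B * C) * l2norm w g.
Proof.
  intros Hg. destruct (sqr_summable_tl_of_L2 g Hg) as [l [Hl Hsum]].
  assert (Hmaj : has_sum (dcell X (S k))
    (fun t => C * (INR (S k) *
       sum_over (fun i => (w (rem i t) * g (rem i t)) ^ 2) (seq 0 (S k))))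
    (C * (INR (S k) * (INR (S k) * l)))).
  { apply has_sum_scal, has_sum_scal.
    rewrite <- (length_seq (S k) 0) at 2. rewrite <- sum_over_const.
    apply (has_sum_sum_over (fun i t => (w (rem i t) * g (rem i t)) ^ 2)). intros i Hi.
    apply in_seq in Hi. apply (has_sum_move_front X k i) in Hsum; [exact Hsum | lia]. }
  destruct (summable_nonneg_le (fun t => delta g t ^ 2 * v t) _ (fun t Ht =>
    conj (sqr_weight_ge0 v (delta g) t Ht) (weighted_coboundary_sqr_le g t Ht))) as [HL2 Hbound];
    [now eexists; apply Hmaj|].
  split; [exact HL2|]. rewrite (tsum_eq _ _ Hmaj) in Hbound.
  pose proof (l2norm_ge0 w g). pose proof (pos_INR (S k)). pose proof (sqrt_pos (B * C)).
  apply l2norm_le_of_sqr; [repeat apply Rmult_le_pos; auto|].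
  rewrite <- (tsum_eq _ _ (has_sum_inner_self v _ HL2)).
  rewrite !Rpow_mult_distr, pow2_sqrt by (apply Rmult_le_pos; auto).
  eapply Rle_trans; [apply Hbound|].
  apply (Rmult_le_compat_l (C * INR (S k) ^ 2)) in Hl; [lra|].
  apply Rmult_le_pos; auto using pow2_ge_0.
Qed.

Lemma bdry_bound F : L2 v F ->
  L2 w (bdry X F) /\ l2norm w (bdry X F) <= sqrt (B * C) * l2norm v F.
Proof.
  intros HF. destruct (sqr_summable_of_coL2 F HF) as [Hs Hle].
  pose proof (has_sum_fibres (tl_fibres HX) _ _ (tsum_has_sum _ Hs)) as Hfib.
  apply (has_sum_scal B) in Hfib.
  destruct (summable_nonneg_le (P := dcell X k) (fun s => bdry X F s ^ 2 * w s) (fun s => B *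
    sum_over (fun t => F t ^ 2) (map (fun x => x :: s) (neighbours X s)))) as [Hsum Hbound];
    [|now eexists; apply Hfib|].
  - intros s Hsc. split; [now apply sqr_weight_ge0|].
    pose proof (bounds_degree Hbounds s Hsc) as Hdeg. pose proof (weight_ge0 w s Hsc).
    rewrite (deg_neighbours HX) in Hdeg by auto. rewrite (bdry_neighbours HX), sum_over_map by auto.
    apply Rle_trans with (INR (length (neighbours X s)) *
      sum_over (fun x => F (x :: s) ^ 2) (neighbours X s) * w s).
    + apply Rmult_le_compat_r; auto. apply sum_over_sqr_le.
    + rewrite Rmult_assoc, (Rmult_comm _ (w s)), <- Rmult_assoc. apply Rmult_le_compat_r; auto.
      apply sum_over_ge0. intros; apply pow2_ge_0.
  - split; [exact Hsum|]. rewrite (tsum_eq _ _ Hfib) in Hbound.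
    apply l2norm_le_of_sqr; [apply Rmult_le_pos; [apply sqrt_pos | apply l2norm_ge0]|].
    rewrite <- (tsum_eq _ _ (has_sum_inner_self w _ Hsum)).
    rewrite Rpow_mult_distr, pow2_sqrt by (apply Rmult_le_pos; auto).
    eapply Rle_trans; [apply Hbound|]. apply (Rmult_le_compat_l B) in Hle; auto. lra.
Qed.

Lemma bdry_coboundary_adjoint F g : is_form X (S k) F -> L2 v F -> L2 w g ->
  inner v F (delta g) = INR (S k) * inner w (bdry X F) g.
Proof.
  intros FF HF Hg. destruct (sqr_summable_tl_of_L2 g Hg) as [m [_ Hm]].
  destruct (summable_mul_of_sqr F (fun t => w (tl t) * g (tl t))
    (proj1 (sqr_summable_of_coL2 F HF))) as [l Hl]; [now exists m|].
  assert (Hbdry : inner w (bdry X F) g = l).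
  { apply tsum_eq.
    pose proof (has_sum_fibres (tl_fibres HX) _ _ Hl) as Hfib. revert Hfib. apply has_sum_ext.
    intros s Hs. rewrite sum_over_map, (bdry_neighbours HX) by auto. simpl tl.
    rewrite (Rmult_assoc (sum_over _ _)), (Rmult_comm (sum_over _ _)), <- sum_over_scal.
    apply sum_over_ext. intros; ring. }
  rewrite Hbdry. apply tsum_eq.
  apply (has_sum_ext (fun t => sum_over (fun i => F t * ((-1) ^ i * (w (rem i t) * g (rem i t))))
    (seq 0 (S k)))).
  - intros t Ht. rewrite sum_over_scal. unfold weighted_coboundary, coboundary.
    rewrite (proj2 Ht). field. apply Rgt_not_eq. now apply weight_pos.
  - rewrite <- (length_seq (S k) 0) at 2. rewrite <- sum_over_const.
    apply (has_sum_sum_over (fun i t => F t * ((-1) ^ i * (w (rem i t) * g (rem i t))))).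
    intros i Hi. apply in_seq in Hi.
    apply (has_sum_move_front X k i) in Hl; [|lia]. revert Hl. apply has_sum_ext.
    intros t Ht. assert (Hlen : (i < length t)%nat) by (destruct Ht; lia).
    rewrite (is_form_perm_par X (S k) F _ t _ FF Ht (move_front_perm_par i t Hlen)), sign_odd.
    simpl tl. ring.
Qed.

Lemma weighted_laplacian_L2 f : L2 w f -> L2 w (laplacian f).
Proof. intros. now apply bdry_bound, weighted_coboundary_bound. Qed.

Lemma weighted_laplacian_norm_le f : L2 w f ->
  l2norm w (laplacian f) <= INR (S k) * (B * C) * l2norm w f.
Proof.
  intros Hf. destruct (weighted_coboundary_bound f Hf) as [Hd Hle].
  eapply Rle_trans; [apply bdry_bound; auto|].
  rewrite <- (sqrt_sqrt (B * C)) at 2 by (apply Rmult_le_pos; auto).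
  apply (Rmult_le_compat_l (sqrt (B * C))) in Hle; [lra | apply sqrt_pos].
Qed.

Lemma weighted_laplacian_green f g : is_form X k f -> L2 w f -> L2 w g ->
  inner v (delta f) (delta g) = INR (S k) * inner w (laplacian f) g.
Proof.
  intros Ff Hf Hg. apply bdry_coboundary_adjoint; auto using weighted_coboundary_is_form.
  now apply weighted_coboundary_bound.
Qed.

Lemma weighted_laplacian_symmetric f g : is_form X k f -> is_form X k g -> L2 w f -> L2 w g ->
  inner w (laplacian f) g = inner w f (laplacian g).
Proof.
  intros. apply (Rmult_eq_reg_l (INR (S k))); [|apply Rgt_not_eq, INR_S_pos].
  rewrite (inner_sym w f), <- !weighted_laplacian_green by auto. apply inner_sym.
Qed.

Lemma weighted_laplacian_nonneg f : is_form X k f -> L2 w f -> 0 <= inner w (laplacian f) f.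
Proof.
  intros Ff Hf. apply (Rmult_le_reg_l (INR (S k))); [apply INR_S_pos|].
  rewrite Rmult_0_r, <- weighted_laplacian_green by auto.
  now apply inner_self_ge0, weighted_coboundary_bound.
Qed.

Lemma weighted_laplacian_symmetric_operator (H : form -> Prop) :
  (forall f, H f -> is_form X k f /\ L2 w f) -> (forall f, H f -> H (laplacian f)) ->
  symmetric_operator w H laplacian (INR (S k) * (B * C)).
Proof.
  intros HF Hmaps. split; auto.
  - intros. apply weighted_laplacian_lincomb.
  - intros f g Hf Hg. apply weighted_laplacian_symmetric; now apply HF.
  - repeat apply Rmult_le_pos; auto using pos_INR.
  - intros f Hf. now apply weighted_laplacian_norm_le, HF.
Qed.

End WeightedCoboundary.

(** * Sums over canonical and over ordered cells *)

Lemma StronglySorted_le_lt s : StronglySorted le s -> NoDup s -> StronglySorted lt s.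
Proof.
  induction 1 as [|a s Hs IH Ha]; intros Hn; constructor; inversion Hn; subst; auto.
  rewrite Forall_forall in *. intros x Hx. specialize (Ha x Hx).
  assert (a <> x) by (intros ->; auto). lia.
Qed.

Lemma sort_Sorted_lt s : NoDup s -> Sorted lt (NatSort.sort s).
Proof.
  intros Hs. apply StronglySorted_Sorted, StronglySorted_le_lt.
  - assert (H := NatSort.StronglySorted_sort s).
    assert (K : forall l,
      StronglySorted (fun x y => is_true (Nat.leb x y)) l -> StronglySorted le l).
    { induction 1 as [|a l Hl IH Ha]; constructor; auto.
      revert Ha. apply Forall_impl. intros b. apply Nat.leb_le. }
    apply K, H. intros x y z Hxy Hyz. apply Nat.leb_le.
    apply Nat.leb_le in Hxy, Hyz. lia.
  - exact (Permutation_NoDup (NatSort.Permuted_sort s) Hs).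
Qed.

Lemma Sorted_lt_permutation_eq s t : Sorted lt s -> Sorted lt t -> Permutation s t -> s = t.
Proof.
  intros Hs Ht. apply Sorted_StronglySorted in Hs; [|intros x y z; lia].
  apply Sorted_StronglySorted in Ht; [|intros x y z; lia].
  revert t Ht; induction Hs as [|a s Hs IH Ha]; intros t Ht Hp.
  - symmetry. now apply Permutation_nil.
  - destruct Ht as [|b t Ht Hb]; [now apply Permutation_sym, Permutation_nil in Hp|].
    rewrite Forall_forall in *.
    assert (a = b).
    { assert (Hat : In a (b :: t)) by (apply (Permutation_in _ Hp); simpl; auto).
      assert (Hbs : In b (a :: s)) by (apply (Permutation_in _ (Permutation_sym Hp)); simpl; auto).
      destruct Hat as [|Hat]; auto. destruct Hbs as [|Hbs]; auto.
      specialize (Ha b Hbs). specialize (Hb a Hat). lia. }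
    subst b. f_equal. apply IH; auto. now apply Permutation_cons_inv in Hp.
Qed.

Fixpoint lists_below (N k : nat) : list (list nat) :=
  match k with
  | O => [[]]
  | S k => flat_map (fun l => map (fun v => v :: l) (seq 0 N)) (lists_below N k)
  end.

Lemma in_lists_below N k l :
  In l (lists_below N k) <-> length l = k /\ forall v, In v l -> (v < N)%nat.
Proof.
  revert l; induction k as [|k IH]; intros l; simpl.
  - split; [intros [<-|[]]; simpl; tauto|]. intros [H _].
    left. symmetry. now apply length_zero_iff_nil.
  - rewrite in_flat_map. split.
    + intros [t [Ht Hl]]. apply in_map_iff in Hl as [v [<- Hv]]. apply in_seq in Hv.
      apply IH in Ht as [Hlen Hbelow]. split; [simpl; lia|]. intros x [<-|Hx]; [lia | auto].
    + intros [Hlen Hbelow]. destruct l as [|v t]; [discriminate|]. exists t. split.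
      * apply IH. split; [simpl in *; lia|]. intros x Hx. apply Hbelow. simpl; auto.
      * apply in_map_iff. exists v. split; auto. apply in_seq.
        specialize (Hbelow v (or_introl eq_refl)). lia.
Qed.

Lemma bounded_lists_listing (Q : list nat -> Prop) N k :
  (forall l, Q l -> length l = k /\ forall v, In v l -> (v < N)%nat) -> exists L, listing Q L.
Proof.
  intros H. exists (nodup em_eq_dec (select Q (lists_below N k))). split; [apply NoDup_nodup|].
  intros l. rewrite nodup_In, in_select, in_lists_below. split; [tauto|]. auto.
Qed.

Lemma finite_dcell_listing X k : finite_complex X -> exists F, listing (dcell X k) F.
Proof.
  intros [N HN]. apply (bounded_lists_listing _ N k). intros s [H E]. split; auto. now apply HN.
Qed.

Lemma orderings_listing k : exists L, listing (Permutation (seq 0 k)) L.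
Proof.
  apply (bounded_lists_listing _ k k). intros l Hl. split.
  - rewrite <- (Permutation_length Hl). apply length_seq.
  - intros v Hv. apply (Permutation_in v (Permutation_sym Hl)), in_seq in Hv. lia.
Qed.

Definition reorder (s o : list nat) : list nat := map (fun i => nth i s O) o.

Lemma reorder_seq s : reorder s (seq 0 (length s)) = s.
Proof.
  induction s as [|a s IH]; [reflexivity|]. unfold reorder in *. simpl. f_equal.
  now rewrite <- seq_shift, map_map.
Qed.

Lemma permutation_reorder s t :
  Permutation s t <-> exists o, Permutation (seq 0 (length s)) o /\ t = reorder s o.
Proof.
  rewrite <- (reorder_seq s) at 1. split.
  - intros H. apply Permutation_sym, Permutation_map_inv in H as [o [-> Ho]]. now exists o.
  - intros [o [Ho ->]]. now apply Permutation_map.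
Qed.

Lemma reorder_inj s o o' : NoDup s -> Permutation (seq 0 (length s)) o ->
  Permutation (seq 0 (length s)) o' -> reorder s o = reorder s o' -> o = o'.
Proof.
  intros Hs Ho Ho'.
  assert (Hlt : forall p, Permutation (seq 0 (length s)) p ->
    forall i, In i p -> (i < length s)%nat).
  { intros p Hp i Hi. apply (Permutation_in i (Permutation_sym Hp)), in_seq in Hi. lia. }
  specialize (Hlt o Ho) as Hlt_o. specialize (Hlt o' Ho') as Hlt_o'. clear Ho Ho' Hlt.
  revert o' Hlt_o'; induction o as [|i o IH]; intros [|j o'] Hlt_o' E; try discriminate; auto.
  injection E as Ei Eo. f_equal.
  - apply (proj1 (NoDup_nth s O)); auto; [apply Hlt_o | apply Hlt_o']; simpl; auto.
  - apply IH; auto; intros; [apply Hlt_o | apply Hlt_o']; simpl; auto.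
Qed.

Lemma canon_fibres X k L : listing (Permutation (seq 0 k)) L ->
  fibres (dcell X k) (canon X k) NatSort.sort (fun s => map (reorder s) L).
Proof.
  intros [HL HLp]. split.
  - intros s Hs. split; [apply (dcell_permutation X k s); auto; apply NatSort.Permuted_sort|].
    apply sort_Sorted_lt, (cell_nodup X), Hs.
  - intros s [[Hs <-] Hsort]. split.
    + apply Injective_map_NoDup_in; auto. intros o o' Ho Ho'. apply HLp in Ho, Ho'.
      apply reorder_inj; auto. now apply (cell_nodup X).
    + intros t. transitivity (Permutation s t).
      * rewrite in_map_iff, permutation_reorder. split.
        -- intros [o [<- Ho]]. exists o. split; auto. now apply HLp.
        -- intros [o [Ho ->]]. exists o. split; auto. now apply HLp.
      * split.
        -- intros Hp. assert (Ht : dcell X (length s) t).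
           { apply (dcell_permutation X _ s); auto. split; auto. }
           split; auto. apply Sorted_lt_permutation_eq; auto.
           ++ apply sort_Sorted_lt, (cell_nodup X), Ht.
           ++ apply Permutation_sym, (Permutation_trans Hp), NatSort.Permuted_sort.
        -- intros [_ <-]. apply Permutation_sym, NatSort.Permuted_sort.
Qed.

(* Every unoriented cell with [k] vertices has [q = k!] orderings. *)
Lemma HasSum_canon X k : exists q, 0 < q /\ forall u : form,
  (forall s t, dcell X k s -> Permutation s t -> u t = u s) ->
  (forall s, dcell X k s -> 0 <= u s) ->
  forall l, HasSum (canon X k) u l <-> has_sum (dcell X k) u (q * l).
Proof.
  destruct (orderings_listing k) as [L HL]. pose proof (canon_fibres X k L HL) as Hfib.
  assert (Hq : 0 < INR (length L)).
  { apply lt_0_INR. destruct L; [|simpl; lia]. exfalso. apply (in_nil (a := seq 0 k)), HL. auto. }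
  exists (INR (length L)). split; auto. intros u Hu Hnonneg l. set (q := INR (length L)) in *.
  assert (Hsum : forall s, canon X k s -> sum_over u (map (reorder s) L) = q * u s).
  { intros s Hs. rewrite sum_over_map, (sum_over_ext _ (fun _ => u s)); [apply sum_over_const|].
    intros o Ho. apply Hu; [apply Hs|]. apply permutation_reorder. exists o. split; auto.
    rewrite (proj2 (proj1 Hs)). now apply HL. }
  assert (Hcanon : HasSum (canon X k) u l <-> has_sum (canon X k) u l).
  { symmetry. apply has_sum_is_lub. intros s [Hs _]. auto. }
  rewrite Hcanon. split; intros H.
  - apply (has_sum_of_fibres Hfib); auto.
    apply (has_sum_ext (fun s => q * u s)); [intros; symmetry; auto | now apply has_sum_scal].
  - apply (has_sum_fibres Hfib), (has_sum_scal (/ q)) in H.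
    replace (/ q * (q * l)) with l in H by (field; lra).
    revert H. apply has_sum_ext. intros s Hs. rewrite Hsum by auto. field. lra.
Qed.

Lemma HasSum_canon_summable X k (u : form) :
  (forall s t, dcell X k s -> Permutation s t -> u t = u s) ->
  (forall s, dcell X k s -> 0 <= u s) ->
  (exists l, HasSum (canon X k) u l) <-> summable (dcell X k) u.
Proof.
  intros Hu Hnonneg. destruct (HasSum_canon X k) as [q [Hq H]]. split; intros [l Hl].
  - exists (q * l). now apply H.
  - exists (/ q * l). apply H; auto. now rewrite <- Rmult_assoc, Rinv_r, Rmult_1_l by lra.
Qed.

(** * Complexes of bounded degree *)

Record bounded_degree_complex (d D : nat) (X : complex) : Prop := {
  bounded_uniform : uniform_dcomplex d X;
  bounded_deg : forall s, dcell X d s -> deg_le X s D }.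

Arguments bounded_uniform {d D X} _.
Arguments bounded_deg {d D X} _ s _.

Lemma deg_pos d D X s : bounded_degree_complex d D X -> dcell X d s -> 0 < INR (deg X s).
Proof.
  intros [HU HD] Hs. apply lt_0_INR. destruct (deg_le_enumerates X s D (HD s Hs)) as [L [HL _]].
  unfold deg. rewrite (fcard_enumerates _ L) by auto.
  destruct HU as [_ [_ HU]]. destruct Hs as [Hc Hk], (HU s Hc) as [t [[Ht Htk] Hi]].
  assert (exists v, In v t /\ ~ In v s) as [v [Hv Hn]].
  { apply NNPP. intros N.
    assert (Hincl : incl t s) by (intros v Hv; apply NNPP; intros Hn; apply N; eauto).
    pose proof (NoDup_incl_length (cell_nodup X t Ht) Hincl). lia. }
  assert (Hnbv : nbv X s v).
  { split; auto. apply (cell_sub X t); auto.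
    - constructor; auto. now apply (cell_nodup X).
    - intros x [<-|Hx]; auto. }
  apply HL in Hnbv. destruct L; [destruct Hnbv | simpl; lia].
Qed.

Definition inv_deg_weight {d D X} (HX : bounded_degree_complex d D X) : weight (dcell X d) :=
  Weight (dcell X d) (fun s => / INR (deg X s))
    (fun s Hs => Rinv_0_lt_compat _ (deg_pos d D X s HX Hs)).

Definition unit_weight {A : Type} (P : A -> Prop) : weight P :=
  Weight P (fun _ => 1) (fun _ _ => Rlt_0_1).

Lemma L2_low_iff k X f : is_form X k f -> L2_low k X f <-> L2 (unit_weight (dcell X k)) f.
Proof.
  intros Ff. unfold L2_low. rewrite HasSum_canon_summable; auto using pow2_ge_0.
  - split; apply summable_ext; intros; simpl; ring.
  - intros. now apply (is_form_sqr X k).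
Qed.

Section TopForms.
Context {d D : nat} {X : complex} (HX : bounded_degree_complex d D X).

Notation top := (inv_deg_weight HX).

Lemma top_locally_finite : locally_finite X d.
Proof. exact (deg_le_locally_finite X d D (bounded_deg HX)). Qed.

Lemma lapl_upE : lapl_up X = weighted_laplacian X top (unit_weight (dcell X (S d))).
Proof.
  apply functional_extensionality. intros f. unfold lapl_up, weighted_laplacian. f_equal.
  apply functional_extensionality. intros t. unfold weighted_coboundary. simpl.
  unfold Rdiv at 1. rewrite Rinv_1, Rmult_1_r. apply sum_over_ext. intros i _.
  unfold Rdiv. ring.
Qed.

Lemma top_weight_bounds : weight_bounds top (unit_weight (dcell X (S d))) 1 1.
Proof.
  split; auto using top_locally_finite; simpl; try (intros; lra).
  - intros s Hs. pose proof (deg_pos d D X s HX Hs). right. field. lra.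
  - intros s t Hp. now rewrite (deg_permutation X s t).
Qed.

Lemma wsq_permutation f : is_form X d f ->
  forall s t, dcell X d s -> Permutation s t -> wsq X f t = wsq X f s.
Proof.
  intros Ff s t Hs Hp. unfold wsq.
  now rewrite (is_form_sqr X d f s t), (deg_permutation X s t) by auto.
Qed.

Lemma L2_top_iff f : is_form X d f -> L2_top d X f <-> L2 top f.
Proof.
  intros Ff. apply HasSum_canon_summable; [now apply wsq_permutation|].
  exact (sqr_weight_ge0 top f).
Qed.

(* Polarization: [|f + h|^2 - |f - h|^2 = 4 <f, h>]. *)
Lemma orth_top_iff f h : is_form X d f -> is_form X d h -> L2 top f -> L2 top h ->
  orth_top d X f h <-> inner top f h = 0.
Proof.
  intros Ff Fh Hf Hh. destruct (HasSum_canon X d) as [q [Hq H]].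
  assert (K : forall b l, HasSum (canon X d) (wsq X (lincomb 1 f b h)) l <->
    q * l = inner top f f + 2 * b * inner top f h + b ^ 2 * inner top h h).
  { intros b l.
    replace (_ + _) with (inner top (lincomb 1 f b h) (lincomb 1 f b h))
      by (rewrite inner_lincomb_self by auto; ring).
    pose proof (has_sum_inner_self top _ (L2_lincomb top 1 f b h Hf Hh)) as G.
    rewrite (H _ (wsq_permutation _ (is_form_lincomb X d 1 f b h Ff Fh)) (sqr_weight_ge0 top _)).
    split; [intros Hl; exact (has_sum_unique _ _ _ Hl G) | intros ->; exact G]. }
  unfold orth_top.
  replace (fun s => f s + h s) with (lincomb 1 f 1 h)
    by (apply functional_extensionality; lincomb_ring).
  replace (fun s => f s - h s) with (lincomb 1 f (-1) h)
    by (apply functional_extensionality; lincomb_ring).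
  set (a := inner top f f) in *. set (b := inner top f h) in *. set (c := inner top h h) in *.
  split.
  - intros Ho. specialize (Ho (/ q * (a + 2 * 1 * b + 1 ^ 2 * c))
                              (/ q * (a + 2 * (-1) * b + (-1) ^ 2 * c))).
    assert (E : / q * (a + 2 * 1 * b + 1 ^ 2 * c) = / q * (a + 2 * (-1) * b + (-1) ^ 2 * c)).
    { apply Ho; apply K; field; lra. }
    apply Rmult_eq_reg_l in E; [lra | apply Rinv_neq_0_compat; lra].
  - intros Z l1 l2 Hl1 Hl2. apply K in Hl1, Hl2. apply (Rmult_eq_reg_l q); lra.
Qed.

End TopForms.

Section Zspace.
Context {k D : nat} {X : complex} (HX : bounded_degree_complex (S k) D X).

Notation top := (inv_deg_weight HX).

Lemma delta_lowE : delta_low X = weighted_coboundary (unit_weight (dcell X k)) top.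
Proof.
  apply functional_extensionality. intros g. apply functional_extensionality. intros t.
  unfold weighted_coboundary, Rdiv. simpl. rewrite Rinv_inv, Rmult_comm.
  unfold delta_low. f_equal. apply sum_over_ext. intros i _. ring.
Qed.

Lemma delta_low_is_form g : is_form X k g -> is_form X (S k) (delta_low X g).
Proof.
  intros Hg. rewrite delta_lowE.
  replace (weighted_coboundary (unit_weight (dcell X k)) top g)
    with (fun s => INR (deg X s) * coboundary g s).
  - apply is_form_mul, coboundary_is_form, Hg. intros s t Hp. now rewrite (deg_permutation X s t).
  - rewrite <- delta_lowE. reflexivity.
Qed.

Lemma Zspace_iff f : Zspace (S k) X f <-> is_form X (S k) f /\ L2 top f /\
  forall g, is_form X k g -> L2_low k X g -> L2 top (delta_low X g) ->
    inner top f (delta_low X g) = 0.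
Proof.
  unfold Zspace. replace (S k - 1)%nat with k by lia. split; intros [Ff [Hf Ho]].
  - apply (L2_top_iff HX) in Hf; auto. split; [|split]; auto. intros g Fg Hg HL.
    apply orth_top_iff; auto using delta_low_is_form. apply Ho; auto.
    apply (L2_top_iff HX); auto using delta_low_is_form.
  - split; [|split]; auto; [now apply (L2_top_iff HX)|]. intros g Fg Hg HL.
    apply (L2_top_iff HX) in HL; auto using delta_low_is_form.
    apply (orth_top_iff HX); auto using delta_low_is_form.
Qed.

Lemma lapl_up_delta_low g : feq X (S k) (lapl_up X (delta_low X g)) zero_form.
Proof.
  intros s Hs. rewrite (lapl_upE HX), delta_lowE. apply (bdry_eq0 X (S k)); auto.
  apply weighted_coboundary_coboundary.
Qed.

(* [lapl_up] is symmetric and kills coboundaries, so its range is orthogonal to them. *)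
Lemma lapl_up_Zspace f : is_form X (S k) f -> L2 top f -> Zspace (S k) X (lapl_up X f).
Proof.
  intros Ff Hf. rewrite (lapl_upE HX). pose proof (top_weight_bounds HX) as Hbounds.
  apply Zspace_iff. split; [|split].
  - now apply (weighted_laplacian_is_form Hbounds).
  - now apply (weighted_laplacian_L2 Hbounds).
  - intros g Fg _ HL.
    rewrite (weighted_laplacian_symmetric Hbounds) by auto using delta_low_is_form.
    rewrite <- (lapl_upE HX). apply inner_eq0. intros s Hs.
    rewrite lapl_up_delta_low by auto. unfold zero_form. ring.
Qed.

Lemma Zspace_is_form_L2 f : Zspace (S k) X f -> is_form X (S k) f /\ L2 top f.
Proof. intros Hf. apply Zspace_iff in Hf. tauto. Qed.

Lemma Zspace_closed_subspace : closed_subspace top (Zspace (S k) X).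
Proof.
  split.
  - intros. now apply Zspace_is_form_L2.
  - intros c f e g Hf Hg. apply Zspace_iff in Hf as [Ff [Lf Of]], Hg as [Fg [Lg Og]].
    apply Zspace_iff. split; [|split]; auto using is_form_lincomb, L2_lincomb.
    intros h Fh Hh HL. rewrite inner_lincomb_l, Of, Og by auto. ring.
  - intros fs f Hfs Hf Hc.
    assert (HL : forall j, L2 top (fs j)) by (intros j; apply (Zspace_is_form_L2 _ (Hfs j))).
    apply Zspace_iff. split; [|split]; auto.
    + apply (is_form_closed X (S k) top fs); auto. intros j. apply (Zspace_is_form_L2 _ (Hfs j)).
    + intros g Fg Hg Hd.
      assert (Hlim : is_lim_seq (fun j => inner top (fs j) (delta_low X g))
        (inner top f (delta_low X g))).
      { apply (L2_cvg_inner top fs (fun _ => delta_low X g)); auto.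
        apply (is_lim_seq_ext (fun _ => 0)); [intros; symmetry; apply l2dist_self|].
        apply is_lim_seq_const. }
      apply (is_lim_seq_eq _ (fun _ => 0) _ 0) in Hlim; auto using is_lim_seq_const.
      intros j. specialize (Hfs j). apply Zspace_iff in Hfs. now apply Hfs.
Qed.

Lemma lapl_up_symmetric_operator :
  symmetric_operator top (Zspace (S k) X) (lapl_up X) (INR (S (S k))).
Proof.
  replace (INR (S (S k))) with (INR (S (S k)) * (1 * 1)) by ring. rewrite (lapl_upE HX).
  apply weighted_laplacian_symmetric_operator; auto using top_weight_bounds, Zspace_is_form_L2.
  intros f Hf. rewrite <- (lapl_upE HX). now apply lapl_up_Zspace; apply Zspace_is_form_L2.
Qed.

Lemma lapl_up_L2 f : L2 top f -> L2 top (lapl_up X f).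
Proof. intros. rewrite (lapl_upE HX). now apply (weighted_laplacian_L2 (top_weight_bounds HX)). Qed.

Lemma lapl_up_norm_le f : L2 top f -> l2norm top (lapl_up X f) <= INR (S (S k)) * l2norm top f.
Proof.
  intros Hf. rewrite (lapl_upE HX).
  eapply Rle_trans; [apply (weighted_laplacian_norm_le (top_weight_bounds HX)); auto|]. lra.
Qed.

Lemma lapl_up_lincomb c f e g :
  lapl_up X (lincomb c f e g) = lincomb c (lapl_up X f) e (lapl_up X g).
Proof. rewrite (lapl_upE HX). apply weighted_laplacian_lincomb. Qed.

Lemma specZ_ge0 x : specZ (S k) X x -> 0 <= x.
Proof.
  apply (spectrum_ge0 Zspace_closed_subspace lapl_up_symmetric_operator).
  intros f Hf. apply Zspace_is_form_L2 in Hf as [Ff Lf]. rewrite (lapl_upE HX).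
  now apply (weighted_laplacian_nonneg (top_weight_bounds HX)).
Qed.

End Zspace.

(** * Cycles and the lower Laplacian *)

Section Cycles.
Context {k D Dl : nat} {X : complex} (HX : bounded_degree_complex (S k) D X).
Hypothesis Hlow : forall s, dcell X k s -> deg_le X s Dl.

Notation top := (inv_deg_weight HX).
Notation low := (unit_weight (dcell X k)).

Lemma low_weight_bounds : weight_bounds low top (INR Dl) (INR D).
Proof.
  split; simpl; auto using pos_INR.
  - exact (deg_le_locally_finite X k Dl Hlow).
  - intros s Hs. rewrite Rmult_1_r. now apply deg_le_deg, Hlow.
  - intros t Ht. apply Rle_div_r; [exact (deg_pos (S k) D X t HX Ht)|].
    rewrite Rmult_1_l. now apply deg_le_deg, (bounded_deg HX).
  - intros s t Hp. now rewrite (deg_permutation X s t).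
Qed.

Lemma bdry_L2 f : L2 top f -> L2 low (bdry X f).
Proof. apply (bdry_bound low_weight_bounds). Qed.

Lemma bdry_delta_low_adjoint f h : is_form X (S k) f -> L2 top f -> L2 low h ->
  inner top f (delta_low X h) = INR (S k) * inner low (bdry X f) h.
Proof. rewrite (delta_lowE HX). apply (bdry_coboundary_adjoint low_weight_bounds). Qed.

Lemma Zspace_bdry_eq0 f : Zspace (S k) X f -> feq X k (bdry X f) zero_form.
Proof.
  intros Hf. apply (Zspace_iff HX) in Hf as [Ff [Lf Of]].
  pose proof (bdry_is_form X k f Ff) as Fb. pose proof (bdry_L2 f Lf) as Lb.
  assert (Z : inner top f (delta_low X (bdry X f)) = 0).
  { apply Of; auto; [now apply L2_low_iff|].
    rewrite (delta_lowE HX). now apply (weighted_coboundary_bound low_weight_bounds). }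
  rewrite bdry_delta_low_adjoint in Z by auto.
  apply Rmult_integral in Z as [Z|Z]; [exfalso; revert Z; apply not_0_INR; lia|].
  apply (l2norm_eq0 low); auto. unfold l2norm. rewrite Z, sqrt_0. apply Rle_refl.
Qed.

Lemma bdry_eq0_Zspace f : finite_complex X -> is_form X (S k) f ->
  feq X k (bdry X f) zero_form -> Zspace (S k) X f.
Proof.
  intros Hfin Ff E.
  pose proof (L2_finite top (finite_dcell_listing X (S k) Hfin)) as HL.
  apply (Zspace_iff HX). split; [|split]; auto. intros g Fg Hg _.
  rewrite bdry_delta_low_adjoint, inner_eq0; auto; [ring | | now apply L2_low_iff].
  intros s Hs. rewrite E by auto. unfold zero_form. ring.
Qed.

End Cycles.

Definition low_laplacian (X : complex) (f : form) : form := bdry X (delta_low X f).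

Section LowerLaplacian.
Context {e D Dl : nat} {X : complex} (HX : bounded_degree_complex (S (S e)) D X).
Hypothesis Hlow : forall s, dcell X (S e) s -> deg_le X s Dl.
Hypothesis Hfin : finite_complex X.

Notation top := (inv_deg_weight HX).
Notation low := (unit_weight (dcell X (S e))).

Let L2_top_all : forall f, L2 top f := L2_finite top (finite_dcell_listing X (S (S e)) Hfin).
Let L2_low_all : forall f, L2 low f := L2_finite low (finite_dcell_listing X (S e) Hfin).

Lemma Kspace_iff f :
  Kspace (S (S e)) X f <-> is_form X (S e) f /\ feq X e (bdry X f) zero_form.
Proof. unfold Kspace. now replace (S (S e) - 2)%nat with e by lia. Qed.

Lemma Kspace_closed_subspace : closed_subspace low (Kspace (S (S e)) X).
Proof.
  split; auto.
  - intros c f b g Hf Hg. apply Kspace_iff in Hf as [Ff Ef], Hg as [Fg Eg]. apply Kspace_iff.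
    split; [now apply is_form_lincomb|].
    intros s Hs. rewrite bdry_lincomb. unfold lincomb. rewrite Ef, Eg by auto.
    unfold zero_form. ring.
  - intros fs f Hfs Hf Hc. assert (HK := fun j => proj1 (Kspace_iff (fs j)) (Hfs j)).
    apply Kspace_iff. split; [apply (is_form_closed X (S e) low fs); auto; apply HK|].
    intros s Hs. pose proof (finite_locally_finite X e Hfin) as HN.
    assert (Hlim : is_lim_seq (fun j => bdry X (fs j) s) (bdry X f s)).
    { rewrite (bdry_neighbours HN) by auto.
      apply (is_lim_seq_ext (fun j => sum_over (fun v => fs j (v :: s)) (neighbours X s))).
      - intros j. now rewrite (bdry_neighbours HN).
      - apply (is_lim_seq_sum_over (fun j v => fs j (v :: s)) (fun v => f (v :: s))).
        intros v Hv. apply (L2_cvg_pointwise low); auto.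
        now apply nbv_dcell, (neighbours_enumerates HN). }
    apply (is_lim_seq_eq _ (fun _ => 0) _ 0) in Hlim; auto using is_lim_seq_const.
    intros j. now apply HK.
Qed.

Lemma low_laplacian_symmetric_operator :
  symmetric_operator low (Kspace (S (S e)) X) (low_laplacian X)
    (INR (S (S e)) * (INR Dl * INR D)).
Proof.
  pose proof (low_weight_bounds HX Hlow) as Hbounds.
  assert (E : low_laplacian X = weighted_laplacian X low top)
    by (unfold low_laplacian; now rewrite (delta_lowE HX)).
  rewrite E. apply (weighted_laplacian_symmetric_operator Hbounds).
  - intros f [Ff _]. auto.
  - intros f [Ff _]. apply Kspace_iff. split; [now apply (weighted_laplacian_is_form Hbounds)|].
    apply bdry_bdry; auto using finite_locally_finite.
    now apply (weighted_coboundary_is_form Hbounds).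
Qed.

(* Solve [low_laplacian X h = bdry f]; then [f - delta_low h] is a cycle, and the lower bound [c] on
   the spectrum turns into a bound on [h]. *)
Lemma cycle_correction mu c f : is_lambda_low (S (S e)) X mu -> 0 < c -> c <= mu ->
  is_form X (S (S e)) f -> exists h,
    Zspace (S (S e)) X (lincomb 1 f (-1) (delta_low X h)) /\
    c * l2norm top (delta_low X h) ^ 2 <= INR (S (S e)) * l2norm low (bdry X f) ^ 2.
Proof.
  intros [_ Hmin] Hc Hmu Ff.
  assert (Hb : bij_on (Kspace (S (S e)) X) (feq X (S e)) (shift (low_laplacian X) 0)).
  { apply NNPP. intros N. apply Hmin in N. lra. }
  destruct (proj2 Hb (bdry X f)) as [h [Kh E]].
  { apply Kspace_iff. split; [now apply bdry_is_form|].
    apply bdry_bdry; auto using finite_locally_finite. }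
  assert (Eh : feq X (S e) (bdry X (delta_low X h)) (bdry X f)).
  { intros s Hs. specialize (E s Hs). unfold shift, low_laplacian in E. lra. }
  clear E. destruct (proj1 (Kspace_iff h) Kh) as [Fh _].
  pose proof (delta_low_is_form HX h Fh) as Fd. exists h. split.
  - apply (bdry_eq0_Zspace HX Hlow); auto using is_form_lincomb.
    intros s Hs. rewrite bdry_lincomb. unfold lincomb. rewrite Eh by auto. unfold zero_form. ring.
  - pose proof (rayleigh_ge_of_spectrum_ge low _ _ _ mu (finite_dcell_listing X (S e) Hfin)
      Kspace_closed_subspace low_laplacian_symmetric_operator Hmin h Kh) as Hray.
    rewrite l2norm_sqr, (bdry_delta_low_adjoint HX Hlow) by auto.
    unfold low_laplacian in Hray. set (x := inner low (bdry X (delta_low X h)) h) in *.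
    assert (Hx : x <= l2norm low (bdry X f) * l2norm low h).
    { unfold x. rewrite (inner_ext low _ (bdry X f) h h) by (auto; intros s _; reflexivity).
      now apply inner_le. }
    pose proof (l2norm_ge0 low h). pose proof (l2norm_ge0 low (bdry X f)).
    set (b := l2norm low (bdry X f)) in *. set (n := l2norm low h) in *.
    assert (Hcn : c * n <= b) by (destruct (Rle_lt_dec n 0); [|apply Rmult_le_reg_r with n]; nra).
    assert (c * x <= b ^ 2) by (apply Rle_trans with (b * (c * n)); nra).
    pose proof (pos_INR (S (S e))). nra.
Qed.

End LowerLaplacian.

(** * Distances and balls *)

Lemma within_dcell d X r a s : within d X r a s -> dcell X d a -> dcell X d s.
Proof.
  revert s; induction r as [|r IH]; intros s H Ha; simpl in H.
  - eapply dcell_permutation; eauto.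
  - destruct H as [H|[c [_ [_ [H _]]]]]; auto.
Qed.

Lemma within_permutation d X r a s t :
  dcell X d a -> within d X r a s -> Permutation s t -> within d X r a t.
Proof.
  revert s t; induction r as [|r IH]; intros s t Ha H Hp; simpl in *.
  - eapply Permutation_trans; eauto.
  - destruct H as [H|[c [Hwc [Hcc [Hs [u [Hu [Hcu Hsu]]]]]]]]; [left; eauto|]. right.
    exists c. repeat (split; auto); [eapply cell_perm; [eauto | apply Hs] | |].
    + rewrite <- (proj2 Hs). symmetry. now apply Permutation_length.
    + exists u. split; [|split]; auto. intros x Hx. apply Hsu.
      eapply Permutation_in; [apply Permutation_sym|]; eauto.
Qed.

Lemma within_mono d X r r' a s : (r <= r')%nat -> within d X r a s -> within d X r' a s.
Proof. induction 1; simpl; auto. Qed.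

Lemma within_self d X r a : within d X r a a.
Proof. apply (within_mono d X 0); [lia | simpl; auto]. Qed.

Lemma within_step d X r a c t s : dcell X d a -> within d X r a c -> dcell X (S d) t -> incl c t ->
  dcell X d s -> incl s t -> within d X (S r) a s.
Proof.
  intros Ha Hc Ht Hct Hs Hst. right. exists c. split; [|split; [|split]]; auto.
  - eapply within_dcell; eauto.
  - now exists t.
Qed.

Lemma ball_cell d X R a s : ball d X R a s -> cell X s.
Proof. intros [Hn [t [Hi [[[Ht _] _]|[[Ht _] _]]]]]; eapply cell_sub; eauto. Qed.

Lemma ball_subset d X R a s t : ball d X R a s -> NoDup t -> incl t s -> ball d X R a t.
Proof. intros [_ [u [Hi H]]] Hn Ht. split; auto. exists u. split; auto. intros x Hx; auto. Qed.

Lemma ball_vertex d X R a s u : ball d X R a s -> In u s -> ball d X R a [u].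
Proof.
  intros Hs Hu. apply (ball_subset d X R a s); auto.
  - repeat constructor. simpl; tauto.
  - now intros x [<-|[]].
Qed.

Lemma within_ball d X R a s : dcell X d a -> within d X R a s -> ball d X R a s.
Proof.
  intros Ha Hw. pose proof (within_dcell d X R a s Hw Ha) as Hs.
  split; [apply (cell_nodup X), Hs|]. exists s. split; [apply incl_refl | auto].
Qed.

Lemma cofaces_ball d X r R a s t : dcell X d a -> within d X r a s -> (S r <= R)%nat ->
  dcell X (S d) t -> incl s t -> ball d X R a t.
Proof.
  intros Ha Hs Hr Ht Hi. split; [apply (cell_nodup X), Ht|]. exists t. split; [apply incl_refl|].
  right. split; auto. intros u Hn Hu Hl. apply (within_mono d X (S r)); auto.
  apply (within_step d X r a s t u); auto. split; auto. now apply (cell_sub X t); [apply Ht | |].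
Qed.

Lemma connected_within d X a : connected_top d X -> dcell X d a ->
  forall s, dcell X d s -> exists r, within d X r a s.
Proof.
  intros HC Ha s Hs. specialize (HC a s Ha Hs). apply clos_rt_rtn1 in HC.
  induction HC as [|y z Hyz Hay IH]; [exists O; simpl; auto|].
  destruct Hyz as [[Hy [Hz [t [Ht [[i [Hi Pi]] [z' [Pz [j [Hj Pj]]]]]]]]]|[Hy Hp]];
    destruct (IH Hy) as [r Hr].
  - exists (S r). apply (within_step d X r a y t); auto.
    + intros x Hx. apply (rem_incl i t), (Permutation_in _ (perm_par_permutation _ _ _ Pi) Hx).
    + intros x Hx. apply (rem_incl j t), (Permutation_in _ (perm_par_permutation _ _ _ Pj)).
      exact (Permutation_in _ (perm_par_permutation _ _ _ Pz) Hx).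
  - exists r. eauto using within_permutation, perm_par_permutation.
Qed.

Lemma connected_within_list d X a L : connected_top d X -> dcell X d a ->
  (forall s, In s L -> dcell X d s) -> exists r, forall s, In s L -> within d X r a s.
Proof.
  intros HC Ha. induction L as [|s L IH]; intros HL; [exists O; simpl; tauto|].
  destruct IH as [r Hr]; [intros; apply HL; simpl; auto|].
  destruct (connected_within d X a HC Ha s) as [r' Hr']; [apply HL; simpl; auto|].
  exists (max r r'). intros t [<-|Ht].
  - apply (within_mono d X r'); auto; lia.
  - apply (within_mono d X r); auto; lia.
Qed.

(** * Isomorphisms of balls *)

Record ball_iso (d : nat) (X1 X2 : complex) (R : nat) (a1 a2 : list nat) (phi psi : nat -> nat) :
  Prop := {
  iso_dcell1 : dcell X1 d a1;
  iso_dcell2 : dcell X2 d a2;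
  iso_ball : forall s, ball d X1 R a1 s -> ball d X2 R a2 (map phi s);
  iso_ball_inv : forall s, ball d X2 R a2 s -> ball d X1 R a1 (map psi s);
  iso_cancel : forall u, ball d X1 R a1 [u] -> psi (phi u) = u;
  iso_cancel_inv : forall u, ball d X2 R a2 [u] -> phi (psi u) = u;
  iso_center : Permutation (map phi a1) a2;
  iso_center_inv : Permutation (map psi a2) a1 }.

Arguments iso_dcell1 {d X1 X2 R a1 a2 phi psi} _.
Arguments iso_ball {d X1 X2 R a1 a2 phi psi} _ s _.
Arguments iso_cancel {d X1 X2 R a1 a2 phi psi} _ u _.
Arguments iso_center {d X1 X2 R a1 a2 phi psi} _.

Lemma ball_iso_sym {d X1 X2 R a1 a2 phi psi} :
  ball_iso d X1 X2 R a1 a2 phi psi -> ball_iso d X2 X1 R a2 a1 psi phi.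
Proof. intros []. now split. Qed.

Lemma map_cancel_ball d X R a (phi psi : nat -> nat) s :
  (forall u, ball d X R a [u] -> psi (phi u) = u) -> ball d X R a s -> map psi (map phi s) = s.
Proof.
  intros H Hs. rewrite map_map. rewrite <- (map_id s) at 2. apply map_ext_in.
  intros u Hu. now apply H, (ball_vertex d X R a s).
Qed.

Lemma simp_iso_ball_iso d X1 X2 R a1 a2 phi : dcell X1 d a1 -> dcell X2 d a2 ->
  simp_iso (ball d X1 R a1) (ball d X2 R a2) phi -> Permutation (map phi a1) a2 ->
  exists psi, ball_iso d X1 X2 R a1 a2 phi psi.
Proof.
  intros Hd1 Hd2 [H12 [Hsurj Hinj]] Ha.
  set (psi := fun v => epsilon (inhabits O) (fun u => ball d X1 R a1 [u] /\ phi u = v)).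
  assert (Hpsi : forall v, ball d X2 R a2 [v] -> ball d X1 R a1 [psi v] /\ phi (psi v) = v).
  { intros v Hv. unfold psi. apply epsilon_spec. destruct (Hsurj [v] Hv) as [s [Hb Hp]].
    apply Permutation_sym, Permutation_length_1_inv in Hp.
    destruct s as [|u [|]]; try discriminate. injection Hp as E. now exists u. }
  assert (Hcancel : forall u, ball d X1 R a1 [u] -> psi (phi u) = u).
  { intros u Hu. destruct (Hpsi (phi u) (H12 [u] Hu)) as [Hb E]. now apply Hinj. }
  pose proof (fun s => map_cancel_ball d X1 R a1 phi psi s Hcancel) as Hmap.
  exists psi. split; auto.
  - intros t Ht. destruct (Hsurj t Ht) as [s [Hb Hp]].
    apply (Permutation_map psi) in Hp. rewrite (Hmap s Hb) in Hp.
    apply (ball_subset d X1 R a1 s); auto.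
    + apply (Permutation_NoDup Hp), Hb.
    + intros x. apply Permutation_in, Permutation_sym, Hp.
  - intros v Hv. now apply Hpsi.
  - rewrite <- (Hmap a1); [|now apply within_ball; [|apply within_self]].
    now apply Permutation_map, Permutation_sym.
Qed.

Section BallIso.
Context {d : nat} {X1 X2 : complex} {R : nat} {a1 a2 : list nat} {phi psi : nat -> nat}.
Hypothesis Hiso : ball_iso d X1 X2 R a1 a2 phi psi.

Let Ha1 : dcell X1 d a1 := iso_dcell1 Hiso.

Lemma iso_map_cancel s : ball d X1 R a1 s -> map psi (map phi s) = s.
Proof. apply map_cancel_ball, (iso_cancel Hiso). Qed.

Lemma iso_dcell k s : ball d X1 R a1 s -> length s = k -> dcell X2 k (map phi s).
Proof.
  intros Hs Hl. split; [now apply (ball_cell d X2 R a2), (iso_ball Hiso)|]. now rewrite length_map.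
Qed.

Lemma within_le_ball r s : (r <= R)%nat -> within d X1 r a1 s -> ball d X1 R a1 s.
Proof. intros Hr Hw. apply within_ball; auto. now apply (within_mono d X1 r). Qed.

Lemma iso_within_dcell r s : (r <= R)%nat -> within d X1 r a1 s -> dcell X2 d (map phi s).
Proof.
  intros Hr Hw. apply iso_dcell; [now apply (within_le_ball r)|].
  apply (within_dcell d X1 r a1 s Hw Ha1).
Qed.

Lemma iso_within r s : (r <= R)%nat -> within d X1 r a1 s -> within d X2 r a2 (map phi s).
Proof.
  intros Hr Hw. pose proof (iso_within_dcell r s Hr Hw) as Hc.
  revert s Hw Hc. induction r as [|r IH]; intros s Hw Hc; simpl in Hw.
  - apply (Permutation_trans (Permutation_sym (iso_center Hiso))). now apply Permutation_map.
  - destruct Hw as [Hw|[c [Hwc [Hcc [Hs [t [Ht [Hct Hst]]]]]]]]; [left; apply IH; auto; lia|].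
    apply (within_step d X2 r a2 (map phi c) (map phi t)); auto using incl_map.
    + apply (iso_dcell1 (ball_iso_sym Hiso)).
    + apply IH; auto; [lia|]. apply (iso_within_dcell r); auto; lia.
    + apply iso_dcell; [|apply Ht]. now apply (cofaces_ball d X1 r R a1 c).
Qed.

Lemma iso_within_cancel r s : (r <= R)%nat -> within d X1 r a1 s -> map psi (map phi s) = s.
Proof. intros Hr Hw. now apply iso_map_cancel, (within_le_ball r). Qed.

Lemma iso_nbv r s v : (S r <= R)%nat -> within d X1 r a1 s -> nbv X1 s v ->
  nbv X2 (map phi s) (phi v) /\ psi (phi v) = v.
Proof.
  intros Hr Hw Hv. apply (nbv_dcell X1 d) in Hv; [|now apply (within_dcell d X1 r a1)].
  assert (Hb : ball d X1 R a1 (v :: s)).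
  { apply (cofaces_ball d X1 r R a1 s); auto. intros x Hx. simpl; auto. }
  split.
  - apply (nbv_dcell X2 d); [apply (iso_within_dcell r); auto; lia|].
    apply (iso_dcell (S d) (v :: s)); auto. apply Hv.
  - apply (iso_cancel Hiso), (ball_vertex d X1 R a1 (v :: s)); simpl; auto.
Qed.

Lemma iso_face k r s v : (r <= R)%nat -> within d X1 r a1 (v :: s) -> dcell X1 k s ->
  dcell X2 k (map phi s) /\ map psi (map phi s) = s.
Proof.
  intros Hr Hw Hs. assert (Hb : ball d X1 R a1 s).
  { apply (ball_subset d X1 R a1 (v :: s)); [now apply (within_le_ball r) | |].
    - apply (cell_nodup X1), Hs.
    - intros x Hx. simpl; auto. }
  split; [now apply iso_dcell, Hs | now apply iso_map_cancel].
Qed.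

End BallIso.

Lemma has_sum_bdry X k f s : locally_finite X k -> dcell X k s ->
  has_sum (nbv X s) (fun v => f (v :: s)) (bdry X f s).
Proof.
  intros HX Hs. rewrite (bdry_neighbours HX) by auto.
  apply (has_sum_listing (nbv X s) (fun v => f (v :: s))), (neighbours_enumerates HX); auto.
Qed.

Lemma bdry_eq_of_bijection X1 X2 k (f1 f2 : form) s1 s2 (h h' : nat -> nat) :
  locally_finite X1 k -> locally_finite X2 k -> dcell X1 k s1 -> dcell X2 k s2 ->
  (forall v, nbv X1 s1 v -> f1 (v :: s1) <> 0 ->
    nbv X2 s2 (h v) /\ h' (h v) = v /\ f2 (h v :: s2) = f1 (v :: s1)) ->
  (forall v, nbv X2 s2 v -> f2 (v :: s2) <> 0 ->
    nbv X1 s1 (h' v) /\ h (h' v) = v /\ f1 (h' v :: s1) = f2 (v :: s2)) ->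
  bdry X1 f1 s1 = bdry X2 f2 s2.
Proof.
  intros HX1 HX2 Hs1 Hs2 Hh Hh'.
  apply (has_sum_unique (P := nbv X1 s1) (fun v => f1 (v :: s1))); [now apply (has_sum_bdry X1 k)|].
  apply (has_sum_reindex _ (nbv X2 s2) _ (fun v => f2 (v :: s2)) h h'); auto.
  now apply (has_sum_bdry X2 k).
Qed.

Lemma INR_deg_bdry X k s : locally_finite X k -> dcell X k s ->
  INR (deg X s) = bdry X (fun _ => 1) s.
Proof.
  intros HX Hs. rewrite (bdry_neighbours HX), (deg_neighbours HX), sum_over_const by auto. ring.
Qed.

(** * Corresponding forms on isomorphic balls *)

Definition supported (d : nat) (X : complex) (r : nat) (a : list nat) (g : form) : Prop :=
  forall s, dcell X d s -> ~ within d X r a s -> g s = 0.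

Definition corresponds (d : nat) (X1 X2 : complex) (a1 a2 : list nat) (phi : nat -> nat) (r : nat)
    (g1 g2 : form) : Prop :=
  supported d X1 r a1 g1 /\ supported d X2 r a2 g2 /\
  forall s, within d X1 r a1 s -> g1 s = g2 (map phi s).

Lemma supported_mono d X r r' a g : (r <= r')%nat -> supported d X r a g -> supported d X r' a g.
Proof. intros Hr Hg s Hs Hn. apply Hg; auto. intros Hw. now apply Hn, (within_mono d X r). Qed.

Lemma supported_bdry X k r a g s : dcell X k s -> supported (S k) X r a g -> bdry X g s <> 0 ->
  exists v, within (S k) X r a (v :: s).
Proof.
  intros Hs Hg Hn. apply NNPP. intros N. apply Hn, fsum_zero. intros v Hv. apply Hg.
  - now apply nbv_dcell.
  - intros Hw. apply N. now exists v.
Qed.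

Lemma supported_lapl_up d X r a g :
  dcell X d a -> supported d X r a g -> supported d X (S r) a (lapl_up X g).
Proof.
  intros Ha Hg s Hs Hn. apply fsum_zero. intros v Hv. apply (nbv_dcell X d) in Hv; auto.
  apply sum_over_zero. intros i Hi. apply in_seq in Hi.
  assert (Hc : dcell X d (rem i (v :: s))) by (apply (dcell_rem X d); auto; destruct Hv; lia).
  rewrite Hg; auto; [unfold Rdiv; ring|]. intros Hw. apply Hn.
  apply (within_step d X r a (rem i (v :: s)) (v :: s)); auto using rem_incl.
  intros x Hx. simpl; auto.
Qed.

Lemma extend_zero_within_is_form d X r a f : dcell X d a ->
  (forall s t, within d X r a s -> perm_par true s t -> f t = - f s) ->
  is_form X d (extend_zero (within d X r a) f).
Proof.
  intros Ha Hf s t Hs Hp. pose proof (perm_par_permutation _ _ _ Hp) as Hst.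
  destruct (classic (within d X r a s)) as [Hw|Hw].
  - rewrite !extend_zero_in; auto. now apply (within_permutation d X r a s).
  - rewrite !extend_zero_out; auto; [ring|]. intros Hw'.
    now apply Hw, (within_permutation d X r a t); [| |apply Permutation_sym].
Qed.

Lemma supported_extend_zero d X r a f : supported d X r a (extend_zero (within d X r a) f).
Proof. intros s _ Hn. now apply extend_zero_out. Qed.

Section Corresponds.
Context {d : nat} {X1 X2 : complex} {R : nat} {a1 a2 : list nat} {phi psi : nat -> nat}.
Hypothesis Hiso : ball_iso d X1 X2 R a1 a2 phi psi.

Notation corr := (corresponds d X1 X2 a1 a2 phi).

Lemma corresponds_sym r g1 g2 : (r <= R)%nat -> corr r g1 g2 ->
  corresponds d X2 X1 a2 a1 psi r g2 g1.
Proof.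
  intros Hr [S1 [S2 E]]. split; [|split]; auto. intros s Hw.
  rewrite E by now apply (iso_within (ball_iso_sym Hiso)).
  now rewrite (iso_within_cancel (ball_iso_sym Hiso) r).
Qed.

Lemma corresponds_apply r r' g1 g2 s : (r <= r')%nat -> (r' <= R)%nat -> corr r g1 g2 ->
  within d X1 r' a1 s -> g1 s = g2 (map phi s).
Proof.
  intros Hr Hr' [S1 [S2 E]] Hw.
  destruct (classic (within d X1 r a1 s)) as [Hw1|Hw1]; auto.
  rewrite S1, S2; auto.
  - now apply (iso_within_dcell Hiso r').
  - intros Hw2. apply Hw1.
    apply (iso_within (ball_iso_sym Hiso)) in Hw2; [|lia].
    now rewrite (iso_within_cancel Hiso r') in Hw2.
  - now apply (within_dcell d X1 r' a1); [|apply (iso_dcell1 Hiso)].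
Qed.

Lemma corresponds_mono r r' g1 g2 : (r <= r')%nat -> (r' <= R)%nat -> corr r g1 g2 -> corr r' g1 g2.
Proof.
  intros Hr Hr' Hc. split; [|split].
  - apply (supported_mono d X1 r); auto. apply Hc.
  - apply (supported_mono d X2 r); auto. apply Hc.
  - intros s. now apply (corresponds_apply r r').
Qed.

Lemma corresponds_lincomb r c f1 f2 e g1 g2 :
  corr r f1 f2 -> corr r g1 g2 -> corr r (lincomb c f1 e g1) (lincomb c f2 e g2).
Proof.
  intros [Sf1 [Sf2 Ef]] [Sg1 [Sg2 Eg]]. unfold lincomb. split; [|split].
  - intros s Hs Hn. rewrite Sf1, Sg1 by auto. ring.
  - intros s Hs Hn. rewrite Sf2, Sg2 by auto. ring.
  - intros s Hw. now rewrite Ef, Eg by auto.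
Qed.

Hypothesis lf1 : locally_finite X1 d.
Hypothesis lf2 : locally_finite X2 d.

Lemma iso_bdry r (f1 f2 : form) s : (S r <= R)%nat -> within d X1 r a1 s ->
  (forall v, nbv X1 s v -> f1 (v :: s) = f2 (map phi (v :: s))) ->
  bdry X1 f1 s = bdry X2 f2 (map phi s).
Proof.
  intros Hr Hw Hf.
  assert (Hw2 : within d X2 r a2 (map phi s)) by (apply (iso_within Hiso); auto; lia).
  apply (bdry_eq_of_bijection X1 X2 d f1 f2 s (map phi s) phi psi); auto.
  - now apply (within_dcell d X1 r a1); [|apply (iso_dcell1 Hiso)].
  - apply (iso_within_dcell Hiso r); auto; lia.
  - intros v Hv _. destruct (iso_nbv Hiso r s v) as [Hnbv Ecancel]; auto.
    repeat split; auto; try apply Hnbv. now rewrite Hf.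
  - intros v Hv _. destruct (iso_nbv (ball_iso_sym Hiso) r (map phi s) v) as [Hnbv Ecancel]; auto.
    rewrite (iso_within_cancel Hiso r) in Hnbv by (auto; lia).
    repeat split; auto; try apply Hnbv. rewrite Hf by auto. simpl. now rewrite Ecancel.
Qed.

Lemma iso_deg r s : (S r <= R)%nat -> within d X1 r a1 s -> deg X1 s = deg X2 (map phi s).
Proof.
  intros Hr Hw. apply INR_eq. rewrite (INR_deg_bdry X1 d), (INR_deg_bdry X2 d); auto.
  - now apply (iso_bdry r).
  - apply (iso_within_dcell Hiso r); auto; lia.
  - now apply (within_dcell d X1 r a1); [|apply (iso_dcell1 Hiso)].
Qed.

Lemma corresponds_lapl_up r g1 g2 : (3 + r <= R)%nat -> corr r g1 g2 ->
  corr (S r) (lapl_up X1 g1) (lapl_up X2 g2).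
Proof.
  intros Hr Hc. pose proof (iso_dcell1 Hiso) as Ha1.
  pose proof (iso_dcell1 (ball_iso_sym Hiso)) as Ha2.
  split; [|split]; [now apply supported_lapl_up; [|apply Hc] .. |].
  intros s Hw. pose proof (within_dcell d X1 (S r) a1 s Hw Ha1) as Hs.
  apply (iso_bdry (S r)); auto; [lia|]. intros v Hv. apply (nbv_dcell X1 d) in Hv; auto.
  unfold delta_top. rewrite length_map. apply sum_over_ext. intros i Hi. apply in_seq in Hi.
  assert (Hwi : within d X1 (S (S r)) a1 (rem i (v :: s))).
  { apply (within_step d X1 (S r) a1 s (v :: s)); auto using rem_incl.
    - intros x Hx. simpl; auto.
    - apply (dcell_rem X1 d); auto. destruct Hv. lia. }
  rewrite <- map_rem, <- (iso_deg (S (S r))), <- (corresponds_apply r (S (S r)) g1 g2); auto; lia.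
Qed.

Lemma corresponds_weighted_sqr r g1 g2 s : (S r <= R)%nat -> corr r g1 g2 -> dcell X1 d s ->
  g1 s ^ 2 * / INR (deg X1 s) <> 0 ->
  dcell X2 d (map phi s) /\ map psi (map phi s) = s /\
  g2 (map phi s) ^ 2 * / INR (deg X2 (map phi s)) = g1 s ^ 2 * / INR (deg X1 s).
Proof.
  intros Hr [S1 [_ E]] Hs Hn.
  assert (Hw : within d X1 r a1 s) by (apply NNPP; intros N; apply Hn; rewrite S1 by auto; ring).
  split; [apply (iso_within_dcell Hiso r); auto; lia|].
  split; [apply (iso_within_cancel Hiso r); auto; lia|].
  now rewrite <- E, <- (iso_deg r).
Qed.

End Corresponds.

Lemma corresponds_l2norm {d D1 D2 X1 X2 R a1 a2 phi psi} (HX1 : bounded_degree_complex d D1 X1)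
    (HX2 : bounded_degree_complex d D2 X2) r g1 g2 : ball_iso d X1 X2 R a1 a2 phi psi ->
  (S r <= R)%nat -> corresponds d X1 X2 a1 a2 phi r g1 g2 -> L2 (inv_deg_weight HX2) g2 ->
  L2 (inv_deg_weight HX1) g1 /\ l2norm (inv_deg_weight HX1) g1 = l2norm (inv_deg_weight HX2) g2.
Proof.
  intros Hiso Hr Hc Hg2. pose proof (top_locally_finite HX1) as lf1.
  pose proof (top_locally_finite HX2) as lf2.
  apply (l2norm_reindex _ _ _ _ (map phi) (map psi)); auto.
  - intros s. now apply (corresponds_weighted_sqr Hiso lf1 lf2 r).
  - intros s. apply (corresponds_weighted_sqr (ball_iso_sym Hiso) lf2 lf1 r); auto.
    apply (corresponds_sym Hiso); auto. lia.
Qed.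

Lemma corresponds_coface {k X1 X2 R a1 a2 phi psi} (Hiso : ball_iso (S k) X1 X2 R a1 a2 phi psi)
    r g1 g2 s v : (r <= R)%nat -> corresponds (S k) X1 X2 a1 a2 phi r g1 g2 ->
  dcell X1 k s -> dcell X2 k (map phi s) -> nbv X1 s v -> g1 (v :: s) <> 0 ->
  nbv X2 (map phi s) (phi v) /\ psi (phi v) = v /\ g2 (phi v :: map phi s) = g1 (v :: s).
Proof.
  intros Hr [S1 [_ E]] Hs Hs2 Hv Hn. apply (nbv_dcell X1 k) in Hv; auto.
  assert (Hw : within (S k) X1 r a1 (v :: s)) by (apply NNPP; intros N; now apply Hn, S1).
  split; [apply (nbv_dcell X2 k); auto; now apply (iso_within_dcell Hiso r (v :: s))|].
  split; [|symmetry; now apply (E (v :: s))].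
  pose proof (iso_within_cancel Hiso r (v :: s) Hr Hw) as Ec. simpl in Ec. congruence.
Qed.

Lemma corresponds_bdry {k X1 X2 R a1 a2 phi psi} (Hiso : ball_iso (S k) X1 X2 R a1 a2 phi psi)
    r g1 g2 s : locally_finite X1 k -> locally_finite X2 k -> (r <= R)%nat ->
  corresponds (S k) X1 X2 a1 a2 phi r g1 g2 -> dcell X1 k s -> bdry X1 g1 s <> 0 ->
  dcell X2 k (map phi s) /\ map psi (map phi s) = s /\ bdry X2 g2 (map phi s) = bdry X1 g1 s.
Proof.
  intros lf1 lf2 Hr Hc Hs Hn.
  destruct (supported_bdry X1 k r a1 g1 s Hs (proj1 Hc) Hn) as [v Hv].
  destruct (iso_face Hiso k r s v Hr Hv Hs) as [Hs2 Ec]. split; [|split]; auto.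
  symmetry. apply (bdry_eq_of_bijection X1 X2 k g1 g2 s (map phi s) phi psi); auto.
  - intros u. now apply (corresponds_coface Hiso r).
  - intros u. pose proof (corresponds_coface (ball_iso_sym Hiso) r g2 g1 (map phi s) u) as Hu.
    rewrite Ec in Hu. apply Hu; auto. now apply (corresponds_sym Hiso).
Qed.

Lemma corresponds_bdry_l2norm {k X1 X2 R a1 a2 phi psi}
    (Hiso : ball_iso (S k) X1 X2 R a1 a2 phi psi) r g1 g2 :
  locally_finite X1 k -> locally_finite X2 k -> (r <= R)%nat ->
  corresponds (S k) X1 X2 a1 a2 phi r g1 g2 -> L2 (unit_weight (dcell X2 k)) (bdry X2 g2) ->
  l2norm (unit_weight (dcell X1 k)) (bdry X1 g1) = l2norm (unit_weight (dcell X2 k)) (bdry X2 g2).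
Proof.
  intros lf1 lf2 Hr Hc Hg2.
  apply (l2norm_reindex _ _ _ _ (map phi) (map psi)); auto.
  - intros s Hs Hn. destruct (corresponds_bdry Hiso r g1 g2 s) as [Hdcell [Ecancel Ebdry]]; auto.
    { intros E. apply Hn. rewrite E. ring. }
    split; [|split]; auto. now rewrite Ebdry.
  - intros s Hs Hn.
    destruct (corresponds_bdry (ball_iso_sym Hiso) r g2 g1 s) as [Hdcell [Ecancel Ebdry]]; auto.
    { now apply (corresponds_sym Hiso). }
    { intros E. apply Hn. rewrite E. ring. }
    split; [|split]; auto. now rewrite Ebdry.
Qed.

Definition pullback (d : nat) (X : complex) (r : nat) (a : list nat) (phi : nat -> nat) (g : form) :
  form := extend_zero (within d X r a) (fun s => g (map phi s)).

Lemma pullback_is_form {d X1 X2 R a1 a2 phi psi} (Hiso : ball_iso d X1 X2 R a1 a2 phi psi) r g :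
  (r <= R)%nat -> is_form X2 d g -> is_form X1 d (pullback d X1 r a1 phi g).
Proof.
  intros Hr Hg. apply extend_zero_within_is_form; [apply (iso_dcell1 Hiso)|]. intros s t Hw Hp.
  apply Hg; [now apply (iso_within_dcell Hiso r) | now apply perm_par_map].
Qed.

Lemma corresponds_pullback d X1 X2 a1 a2 phi r g :
  supported d X2 r a2 g -> corresponds d X1 X2 a1 a2 phi r (pullback d X1 r a1 phi g) g.
Proof.
  intros Hg. split; [apply supported_extend_zero | split; auto].
  intros s Hw. unfold pullback. now rewrite extend_zero_in.
Qed.

(** * Truncation to balls *)

Definition truncate (d : nat) (X : complex) (r : nat) (a : list nat) (f : form) : form :=
  extend_zero (within d X r a) f.

Lemma truncate_is_form d X r a f : dcell X d a -> is_form X d f -> is_form X d (truncate d X r a f).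
Proof.
  intros Ha Hf. apply extend_zero_within_is_form; auto. intros s t Hw.
  apply Hf. now apply (within_dcell d X r a).
Qed.

Lemma truncate_L2 d X (w : weight (dcell X d)) r a f : L2 w f -> L2 w (truncate d X r a f).
Proof.
  apply summable_nonneg_le. intros s Hs. split; [now apply sqr_weight_ge0|].
  destruct (classic (within d X r a s)) as [Hw|Hw]; unfold truncate.
  - rewrite extend_zero_in by auto. apply Rle_refl.
  - rewrite extend_zero_out by auto. replace (0 ^ 2 * w s) with 0 by ring.
    now apply sqr_weight_ge0.
Qed.

Lemma truncate_l2dist_le d X (w : weight (dcell X d)) a f : connected_top d X -> dcell X d a ->
  L2 w f -> forall eps, 0 < eps -> exists r, l2dist w f (truncate d X r a f) <= eps.
Proof.
  intros HC Ha Hf eps Heps. pose proof (has_sum_inner_self w f Hf) as Hsum.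
  assert (Heps2 : 0 < eps ^ 2) by (apply pow_lt; auto).
  destruct (proj1 (filterlim_locally _ _) Hsum (mkposreal _ Heps2)) as [F [HF HFsum]].
  specialize (HFsum F HF (incl_refl F)). apply Rabs_lt_between' in HFsum. cbn [pos] in HFsum.
  destruct (connected_within_list d X a F HC Ha) as [r Hr]; [apply HF|]. exists r.
  apply l2norm_le_of_sqr; [lra|].
  set (h := lincomb 1 f (-1) (truncate d X r a f)).
  assert (Hin : forall s, within d X r a s -> h s = 0).
  { intros s Hw. unfold h, lincomb, truncate. rewrite extend_zero_in by auto. ring. }
  assert (Hout : forall s, ~ within d X r a s -> h s = f s).
  { intros s Hw. unfold h, lincomb, truncate. rewrite extend_zero_out by auto. ring. }
  destruct (summable_of_bounded (P := dcell X d) (fun s => h s ^ 2 * w s) (eps ^ 2))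
    as [Hsummable Hle].
  - intros s Hs. now apply sqr_weight_ge0.
  - intros L HL. rewrite <- (sum_over_select _ (fun s => ~ within d X r a s) L).
    2:{ intros s _ Hn. apply NNPP in Hn. rewrite Hin by auto. ring. }
    set (L' := select (fun s => ~ within d X r a s) L).
    rewrite (sum_over_ext _ (fun s => f s ^ 2 * w s)).
    2:{ intros s Hs. apply in_select in Hs as [_ Hs]. now rewrite Hout. }
    assert (HFL : finite_subset (dcell X d) (F ++ L')).
    { split.
      - apply NoDup_app; [apply HF | apply NoDup_select, HL|].
        intros s Hs Hs'. apply in_select in Hs' as [_ Hs']. now apply Hs', Hr.
      - intros s Hs. apply in_app_iff in Hs as [Hs|Hs]; [now apply HF|].
        apply in_select in Hs as [Hs _]. now apply HL. }
    pose proof (sum_over_le_has_sum _ _ _ (sqr_weight_ge0 w f) Hsum HFL) as Hub.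
    rewrite sum_over_app in Hub. lra.
  - now rewrite <- (tsum_eq _ _ (has_sum_inner_self w h Hsummable)).
Qed.

(** * Approximate eigenforms *)

Record approx_eigenform {d D X} (HX : bounded_degree_complex d D X) (x eps : R) (f : form) :
  Prop := {
  eigenform_is_form : is_form X d f;
  eigenform_L2 : L2 (inv_deg_weight HX) f;
  eigenform_pos : 0 < l2norm (inv_deg_weight HX) f;
  eigenform_residual : l2norm (inv_deg_weight HX) (shift (lapl_up X) x f) <
    eps * l2norm (inv_deg_weight HX) f }.

Arguments eigenform_is_form {d D X HX x eps f} _.
Arguments eigenform_L2 {d D X HX x eps f} _.
Arguments eigenform_pos {d D X HX x eps f} _.
Arguments eigenform_residual {d D X HX x eps f} _.

Section Perturbation.
Context {k D : nat} {X : complex} (HX : bounded_degree_complex (S k) D X).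

Notation top := (inv_deg_weight HX).

Lemma shift_lapl_up_L2 x f : L2 top f -> L2 top (shift (lapl_up X) x f).
Proof. intros Hf. rewrite shiftE. apply L2_lincomb; auto using lapl_up_L2. Qed.

Lemma shift_lapl_up_norm_le x f : L2 top f ->
  l2norm top (shift (lapl_up X) x f) <= (INR (S (S k)) + Rabs x) * l2norm top f.
Proof.
  intros Hf. rewrite shiftE.
  eapply Rle_trans; [apply l2norm_lincomb_le; auto using lapl_up_L2|].
  rewrite Rabs_R1, Rabs_Ropp. pose proof (lapl_up_norm_le HX f Hf). lra.
Qed.

Lemma shift_lapl_up_lincomb x c f e g :
  shift (lapl_up X) x (lincomb c f e g) =
  lincomb c (shift (lapl_up X) x f) e (shift (lapl_up X) x g).
Proof.
  rewrite !shiftE, (lapl_up_lincomb HX). apply functional_extensionality. lincomb_ring.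
Qed.

Lemma approx_eigenform_open x eps f : 0 < eps -> approx_eigenform HX x eps f ->
  exists eta, 0 < eta /\ forall g, is_form X (S k) g -> L2 top g -> l2dist top f g <= eta ->
    approx_eigenform HX x eps g.
Proof.
  intros Heps [Ff Lf Hpos Hres].
  set (K := INR (S (S k)) + Rabs x).
  assert (HK : 0 <= K) by (pose proof (pos_INR (S (S k))); pose proof (Rabs_pos x); unfold K; lra).
  set (n := l2norm top f) in *. set (rho := l2norm top (shift (lapl_up X) x f)) in *.
  assert (Hrho : 0 <= rho) by apply l2norm_ge0.
  exists ((eps * n - rho) / (2 * (K + eps))). split; [apply Rdiv_lt_0_compat; lra|].
  set (eta := (eps * n - rho) / (2 * (K + eps))). intros g Fg Lg Hdist.
  assert (Heta : eta * (2 * (K + eps)) = eps * n - rho) by (unfold eta; field; lra).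
  assert (Heta0 : 0 < eta) by (apply Rdiv_lt_0_compat; lra).
  pose proof (l2norm_le_l2dist top f g Lf Lg) as Hn. fold n in Hn.
  assert (Hg : l2norm top (shift (lapl_up X) x g) <= rho + K * eta).
  { eapply Rle_trans; [apply (l2norm_le_l2dist top _ (shift (lapl_up X) x f));
      auto using shift_lapl_up_L2|].
    fold rho. apply Rplus_le_compat_l. unfold l2dist. rewrite <- shift_lapl_up_lincomb.
    eapply Rle_trans; [apply shift_lapl_up_norm_le; auto using L2_lincomb|].
    fold (l2dist top g f). rewrite l2dist_sym by auto. fold K. now apply Rmult_le_compat_l. }
  assert (Hpos_g : rho + K * eta < eps * (n - eta)) by nra.
  split; auto; nra.
Qed.

Lemma bdry_small_open Dl eps f : (forall s, dcell X k s -> deg_le X s Dl) -> 0 < eps ->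
  L2 top f -> 0 < l2norm top f -> feq X k (bdry X f) zero_form ->
  exists eta, 0 < eta /\ forall g, L2 top g -> l2dist top f g <= eta ->
    l2norm (unit_weight (dcell X k)) (bdry X g) <= eps * l2norm top g.
Proof.
  intros Hlow Heps Lf Hpos Hf. set (K := sqrt (INR Dl * INR D)). set (n := l2norm top f) in *.
  assert (HK : 0 <= K) by apply sqrt_pos.
  exists (eps * n / (K + eps)). split; [apply Rdiv_lt_0_compat; nra|].
  set (eta := eps * n / (K + eps)). intros g Lg Hdist.
  assert (Heta : eta * (K + eps) = eps * n) by (unfold eta; field; lra).
  pose proof (l2norm_le_l2dist top f g Lf Lg) as Hn. fold n in Hn.
  assert (Hbdry : l2norm (unit_weight (dcell X k)) (bdry X g) <= K * eta).
  { rewrite (l2norm_ext _ _ (bdry X (lincomb 1 g (-1) f))).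
    - eapply Rle_trans; [apply (bdry_bound (low_weight_bounds HX Hlow)); auto using L2_lincomb|].
      fold K. apply Rmult_le_compat_l; auto. fold (l2dist top g f). now rewrite l2dist_sym.
    - intros s Hs. rewrite bdry_lincomb. unfold lincomb. rewrite Hf by auto. unfold zero_form. ring.
    - now apply (bdry_L2 HX Hlow). }
  nra.
Qed.

End Perturbation.

(** * The spectral gap of a finite complex *)

Section FiniteGap.
Context {k D : nat} {Y : complex} (HY : bounded_degree_complex (S k) D Y).
Hypothesis Hfin : finite_complex Y.
Context {lam : R}.
Hypothesis Hlam : is_lambda (S k) Y lam.

Notation top := (inv_deg_weight HY).

Let L2_all : forall f, L2 top f := L2_finite top (finite_dcell_listing Y (S k) Hfin).

Lemma spectral_gap_le x q z : Zspace (S k) Y z -> 0 < l2norm top z ->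
  l2norm top (shift (lapl_up Y) x z) <= q * l2norm top z -> lam <= x + q.
Proof.
  intros Hz Hpos Hres. destruct Hlam as [_ Hmin].
  pose proof (rayleigh_ge_of_spectrum_ge top _ _ _ lam (finite_dcell_listing Y (S k) Hfin)
    (Zspace_closed_subspace HY) (lapl_up_symmetric_operator HY) Hmin z Hz) as Hray.
  pose proof (inner_le top (shift (lapl_up Y) x z) z (L2_all _) (L2_all _)) as Hinner.
  rewrite shiftE, inner_lincomb_l, <- (l2norm_sqr top z), <- shiftE in Hinner by auto.
  set (n := l2norm top z) in *. apply (Rmult_le_reg_r (n ^ 2)); nra.
Qed.

(* The test form is [lapl_up f], which is not small as [x <> 0]. *)
Lemma spectral_gap_le_eigenform x q f : 0 < q < x -> approx_eigenform HY x q f ->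
  lam <= x + INR (S (S k)) * q / (x - q).
Proof.
  intros Hq [Ff Lf Hpos Hres]. set (M := INR (S (S k))). set (n := l2norm top f) in *.
  assert (Hz : (x - q) * n <= l2norm top (lapl_up Y f)).
  { pose proof (l2norm_le_l2dist top (lincomb x f 0 f) (lapl_up Y f) (L2_all _) (L2_all _)) as Hx.
    rewrite l2norm_scal, Rabs_pos_eq in Hx by (auto; lra).
    rewrite l2dist_sym in Hx by auto. unfold l2dist in Hx. fold n in Hx.
    replace (lincomb 1 (lapl_up Y f) (-1) (lincomb x f 0 f)) with (shift (lapl_up Y) x f) in Hx
      by (rewrite shiftE; apply functional_extensionality; lincomb_ring).
    lra. }
  apply (spectral_gap_le x _ (lapl_up Y f)); [now apply (lapl_up_Zspace HY) | nra |].
  replace (shift (lapl_up Y) x (lapl_up Y f)) with (lapl_up Y (shift (lapl_up Y) x f))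
    by (now rewrite !shiftE, (lapl_up_lincomb HY)).
  eapply Rle_trans; [apply (lapl_up_norm_le HY); auto|]. fold M.
  assert (HM : 0 <= M) by apply pos_INR.
  apply Rle_trans with (M * q / (x - q) * ((x - q) * n)).
  - replace (M * q / (x - q) * ((x - q) * n)) with (M * (q * n)) by (field; lra).
    apply Rmult_le_compat_l; lra.
  - apply Rmult_le_compat_l; auto. apply Rmult_le_pos; [nra|].
    left. apply Rinv_0_lt_compat. lra.
Qed.

End FiniteGap.

Lemma spectral_gap_le_almost_cycle {e D Dl Y} (HY : bounded_degree_complex (S (S e)) D Y)
    lam mu c q f : finite_complex Y -> (forall s, dcell Y (S e) s -> deg_le Y s Dl) ->
  is_lambda (S (S e)) Y lam -> is_lambda_low (S (S e)) Y mu -> 0 < c <= mu -> 0 < q ->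
  q * sqrt (INR (S (S e)) / c) < 1 -> approx_eigenform HY 0 q f ->
  l2norm (unit_weight (dcell Y (S e))) (bdry Y f) <= q * l2norm (inv_deg_weight HY) f ->
  lam <= q / (1 - q * sqrt (INR (S (S e)) / c)).
Proof.
  intros Hfin Hlow Hlam Hmu Hc Hq HqK [Ff Lf Hpos Hres] Hbdry.
  set (K := sqrt (INR (S (S e)) / c)) in *. set (top := inv_deg_weight HY) in *.
  assert (HL : forall g, L2 top g) by exact (L2_finite top (finite_dcell_listing Y (S (S e)) Hfin)).
  destruct (cycle_correction HY Hlow Hfin mu c f Hmu) as [h [Hz Hh]]; try tauto.
  fold top in Hh. set (z := lincomb 1 f (-1) (delta_low Y h)) in *. set (n := l2norm top f) in *.
  assert (Hcorr : l2norm top (delta_low Y h) <= K * (q * n)).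
  { apply Rle_trans with (K * l2norm (unit_weight (dcell Y (S e))) (bdry Y f)).
    - apply l2norm_le_of_sqr; [apply Rmult_le_pos; [apply sqrt_pos | apply l2norm_ge0]|].
      rewrite <- l2norm_sqr, Rpow_mult_distr by auto. unfold K.
      rewrite pow2_sqrt
        by (apply Rmult_le_pos; [apply pos_INR | left; apply Rinv_0_lt_compat; lra]).
      apply Rmult_le_reg_l with c; [lra|]. eapply Rle_trans; [apply Hh|]. right. field. lra.
    - apply Rmult_le_compat_l; [apply sqrt_pos | exact Hbdry]. }
  assert (Hn : (1 - q * K) * n <= l2norm top z).
  { pose proof (l2norm_le_l2dist top f z Lf (HL z)) as Hdist. unfold l2dist in Hdist.
    replace (lincomb 1 f (-1) z) with (delta_low Y h) in Hdist
      by (apply functional_extensionality; unfold z; lincomb_ring). fold n in Hdist. lra. }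
  rewrite <- (Rplus_0_l (q / _)).
  apply (spectral_gap_le HY Hfin Hlam 0 _ z Hz); [fold top; nra|]. fold top.
  rewrite (l2norm_ext top _ (shift (lapl_up Y) 0 f)); auto.
  - apply Rle_trans with (q / (1 - q * K) * ((1 - q * K) * n)).
    + left. replace (q / (1 - q * K) * ((1 - q * K) * n)) with (q * n) by (field; lra). exact Hres.
    + apply Rmult_le_compat_l; auto. left. apply Rdiv_lt_0_compat; lra.
  - intros s Hs. unfold shift, z. rewrite (lapl_up_lincomb HY). unfold lincomb at 1.
    rewrite (lapl_up_delta_low HY) by auto. unfold zero_form. ring.
Qed.

(** * The limit *)

Lemma deg_le_limit k X (Xs : nat -> complex) D : connected_top (S k) X ->
  converges (S k) Xs X -> (forall n s, dcell (Xs n) k s -> deg_le (Xs n) s D) ->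
  forall s, dcell X k s -> deg_le X s D.
Proof.
  intros HC [sn [a [Hsn [Ha Hcv]]]] HD s Hs L HN HL.
  destruct (connected_within_list (S k) X a (map (fun v => v :: s) L) HC Ha) as [r Hr].
  { intros t Ht. apply in_map_iff in Ht as [v [<- Hv]]. apply nbv_dcell; auto. }
  destruct (Hcv r) as [n Hn]. destruct (Hn n (le_n _)) as [phi [Hphi Hpa]].
  destruct (simp_iso_ball_iso (S k) (Xs n) X r (sn n) a phi (Hsn n) Ha Hphi Hpa) as [psi Hiso].
  apply ball_iso_sym in Hiso.
  assert (Hw : forall v, In v L -> within (S k) X r a (v :: s)).
  { intros v Hv. apply Hr, in_map_iff. now exists v. }
  destruct L as [|v0 L0]; [simpl; lia|].
  destruct (iso_face Hiso k r s v0) as [Hs' _]; auto; [apply Hw; simpl; auto|].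
  rewrite <- (length_map psi (v0 :: L0)). apply (HD n (map psi s) Hs').
  - apply Injective_map_NoDup_in; auto. intros u v Hu Hv E.
    pose proof (iso_within_cancel Hiso r _ (le_n _) (Hw u Hu)) as Eu.
    pose proof (iso_within_cancel Hiso r _ (le_n _) (Hw v Hv)) as Ev.
    simpl in Eu, Ev. congruence.
  - intros u Hu. apply in_map_iff in Hu as [v [<- Hv]]. apply (nbv_dcell (Xs n) k); auto.
    apply (iso_within_dcell Hiso r (v :: s)); auto.
Qed.

Section Limit.
Context {k D : nat} {Xs : nat -> complex} {X : complex}.
Hypothesis HXn : forall n, bounded_degree_complex (S k) D (Xs n).
Hypothesis HX : bounded_degree_complex (S k) D X.
Hypothesis Hconn : connected_top (S k) X.
Hypothesis Hconv : converges (S k) Xs X.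

Notation top := (inv_deg_weight HX).
Notation top_n n := (inv_deg_weight (HXn n)).

Lemma transplant_truncation f : is_form X (S k) f -> L2 top f -> forall eta, 0 < eta ->
  exists g, is_form X (S k) g /\ L2 top g /\ l2dist top f g <= eta /\
  forall x N, exists n, (N <= n)%nat /\ exists G, is_form (Xs n) (S k) G /\
    L2 (top_n n) G /\ l2norm (top_n n) G = l2norm top g /\
    l2norm (top_n n) (shift (lapl_up (Xs n)) x G) = l2norm top (shift (lapl_up X) x g) /\
    (locally_finite (Xs n) k -> locally_finite X k -> L2 (unit_weight (dcell X k)) (bdry X g) ->
      l2norm (unit_weight (dcell (Xs n) k)) (bdry (Xs n) G) =
      l2norm (unit_weight (dcell X k)) (bdry X g)).
Proof.
  intros Ff Lf eta Heta. destruct Hconv as [sn [a [Hsn [Ha Hballs]]]].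
  destruct (truncate_l2dist_le (S k) X top a f Hconn Ha Lf eta Heta) as [r Hdist].
  set (g := truncate (S k) X r a f) in *.
  assert (Fg : is_form X (S k) g) by now apply truncate_is_form.
  assert (Lg : L2 top g) by now apply truncate_L2.
  exists g. repeat split; auto. intros x N. destruct (Hballs (3 + r)%nat) as [N' HN'].
  set (n := max N N'). exists n. split; [lia|].
  destruct (HN' n ltac:(lia)) as [phi [Hphi Hpa]].
  destruct (simp_iso_ball_iso (S k) (Xs n) X (3 + r) (sn n) a phi (Hsn n) Ha Hphi Hpa)
    as [psi Hiso].
  set (G := pullback (S k) (Xs n) r (sn n) phi g).
  assert (Hcorr : corresponds (S k) (Xs n) X (sn n) a phi r G g)
    by apply corresponds_pullback, supported_extend_zero.
  destruct (corresponds_l2norm (HXn n) HX r G g Hiso) as [LG EG]; auto; [lia|].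
  exists G. split; [apply (pullback_is_form Hiso); auto; lia|]. split; [|split; [|split]]; auto.
  - rewrite !shiftE. apply (corresponds_l2norm _ _ (S r) _ _ Hiso); [lia | |].
    + apply corresponds_lincomb.
      * now apply (corresponds_lapl_up Hiso (top_locally_finite (HXn n)) (top_locally_finite HX)).
      * apply (corresponds_mono Hiso r); auto; lia.
    + apply L2_lincomb; auto using lapl_up_L2.
  - intros lf_n lf Lb. apply (corresponds_bdry_l2norm Hiso r); auto. lia.
Qed.

Lemma transplant_approx_eigenform x eps f : 0 < eps -> approx_eigenform HX x eps f ->
  forall N, exists n, (N <= n)%nat /\ exists G, approx_eigenform (HXn n) x eps G.
Proof.
  intros Heps Hf N.
  destruct (approx_eigenform_open HX x eps f Heps Hf) as [eta [Heta Hopen]].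
  destruct (transplant_truncation f (eigenform_is_form Hf) (eigenform_L2 Hf) eta Heta)
    as [g [Fg [Lg [Hdist HG]]]].
  destruct (Hopen g Fg Lg Hdist) as [_ _ Hpos Hres].
  destruct (HG x N) as [n [Hn [G [FG [LG [EG [ER _]]]]]]]. exists n. split; auto. exists G.
  split; rewrite ?ER, ?EG; auto.
Qed.

Lemma transplant_almost_cycle Dl x eps f :
  (forall n s, dcell (Xs n) k s -> deg_le (Xs n) s Dl) -> 0 < eps ->
  approx_eigenform HX x eps f -> feq X k (bdry X f) zero_form ->
  forall N, exists n, (N <= n)%nat /\ exists G, approx_eigenform (HXn n) x eps G /\
    l2norm (unit_weight (dcell (Xs n) k)) (bdry (Xs n) G) <= eps * l2norm (top_n n) G.
Proof.
  intros HDln Heps Hf Hcycle N.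
  pose proof (deg_le_limit k X Xs Dl Hconn Hconv HDln) as Hlow.
  destruct (approx_eigenform_open HX x eps f Heps Hf) as [eta1 [Heta1 Hopen1]].
  destruct (bdry_small_open HX Dl eps f Hlow Heps (eigenform_L2 Hf) (eigenform_pos Hf) Hcycle)
    as [eta2 [Heta2 Hopen2]].
  destruct (transplant_truncation f (eigenform_is_form Hf) (eigenform_L2 Hf) (Rmin eta1 eta2))
    as [g [Fg [Lg [Hdist HG]]]]; [now apply Rmin_pos|].
  pose proof (Rle_trans _ _ _ Hdist (Rmin_l eta1 eta2)) as Hdist1.
  pose proof (Rle_trans _ _ _ Hdist (Rmin_r eta1 eta2)) as Hdist2.
  destruct (Hopen1 g Fg Lg Hdist1) as [_ _ Hpos Hres].
  destruct (HG x N) as [n [Hn [G [FG [LG [EG [ER Ebdry]]]]]]]. exists n. split; auto. exists G.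
  split; [split; rewrite ?ER, ?EG; auto|].
  rewrite Ebdry, EG; auto.
  - exact (deg_le_locally_finite (Xs n) k Dl (HDln n)).
  - exact (deg_le_locally_finite X k Dl Hlow).
  - now apply (bdry_L2 HX Hlow).
Qed.

Lemma specZ_approx_eigenform x eps : specZ (S k) X x -> 0 < eps ->
  exists f, approx_eigenform HX x eps f /\ Zspace (S k) X f.
Proof.
  intros Hx Heps.
  destruct (approximate_eigenfunction (Zspace_closed_subspace HX) (lapl_up_symmetric_operator HX)
    x Hx eps Heps) as [f [Zf [Hpos Hres]]].
  exists f. split; auto. split; auto; now apply (Zspace_is_form_L2 HX).
Qed.

Hypothesis HFn : forall n, finite_complex (Xs n).
Context {lamn : nat -> R}.
Hypothesis Hlamn : forall n, is_lambda (S k) (Xs n) (lamn n).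

Lemma liminf_gap_le_pos x : specZ (S k) X x -> 0 < x ->
  forall eps, 0 < eps -> forall N, exists n, (N <= n)%nat /\ lamn n <= x + eps.
Proof.
  intros Hx Hpos eps Heps N. set (M := INR (S (S k))).
  assert (HM : 0 < M) by apply INR_S_pos.
  set (q := eps * x / (M + eps)).
  assert (Hq : 0 < q) by (apply Rdiv_lt_0_compat; nra).
  assert (HqM : q * (M + eps) = eps * x) by (unfold q; field; lra).
  destruct (specZ_approx_eigenform x q Hx Hq) as [f [Hf _]].
  destruct (transplant_approx_eigenform x q f Hq Hf N) as [n [Hn [G HG]]].
  exists n. split; auto.
  assert (Hqx : q < x) by nra.
  replace eps with (M * q / (x - q)).
  - now apply (spectral_gap_le_eigenform (HXn n) (HFn n) (Hlamn n) x q G).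
  - apply (Rmult_eq_reg_r (x - q)); [|lra]. unfold Rdiv. rewrite Rmult_assoc, Rinv_l by lra. nra.
Qed.

End Limit.

Lemma liminf_gap_le_zero {e D Dl Xs X} (HXn : forall n, bounded_degree_complex (S (S e)) D (Xs n))
    (HX : bounded_degree_complex (S (S e)) D X) (lamn mu : nat -> R) c :
  connected_top (S (S e)) X -> converges (S (S e)) Xs X ->
  (forall n, finite_complex (Xs n)) -> (forall n, is_lambda (S (S e)) (Xs n) (lamn n)) ->
  (forall n s, dcell (Xs n) (S e) s -> deg_le (Xs n) s Dl) ->
  (forall n, is_lambda_low (S (S e)) (Xs n) (mu n)) -> 0 < c -> (forall n, c <= mu n) ->
  specZ (S (S e)) X 0 ->
  forall eps, 0 < eps -> forall N, exists n, (N <= n)%nat /\ lamn n <= eps.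
Proof.
  intros Hconn Hconv HFn Hlamn Hlow Hmu Hc Hcmu Hspec0 eps Heps N.
  set (K := sqrt (INR (S (S e)) / c)). assert (HK : 0 <= K) by apply sqrt_pos.
  set (q := eps / (1 + eps * K)).
  assert (Hden : 0 < 1 + eps * K) by nra.
  assert (Hq : 0 < q) by now apply Rdiv_lt_0_compat.
  assert (HqK : q * (1 + eps * K) = eps) by (unfold q; field; lra).
  destruct (specZ_approx_eigenform HX 0 q Hspec0 Hq) as [f [Hf Zf]].
  pose proof (Zspace_bdry_eq0 HX (deg_le_limit (S e) X Xs Dl Hconn Hconv Hlow) f Zf) as Hcycle.
  destruct (transplant_almost_cycle HXn HX Hconn Hconv Dl 0 q f Hlow Hq Hf Hcycle N)
    as [n [Hn [G [HG Hbdry]]]].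
  exists n. split; auto.
  assert (HqK1 : q * K < 1) by (apply (Rmult_lt_reg_l eps); nra).
  replace eps with (q / (1 - q * K)).
  - now apply (spectral_gap_le_almost_cycle (HXn n) (lamn n) (mu n) c q G (HFn n) (Hlow n)).
  - apply (Rmult_eq_reg_r (1 - q * K)); [|lra]. unfold Rdiv.
    rewrite Rmult_assoc, Rinv_l by lra. nra.
Qed.

Theorem mainTheorem10 (d : nat) (Xs : nat -> complex) (X : complex)
    (lamn : nat -> R) (lam : R) :
  (2 <= d)%nat ->
  (forall n, finite_complex (Xs n)) ->
  (forall n, uniform_dcomplex d (Xs n)) -> uniform_dcomplex d X ->
  (forall n, connected_top d (Xs n)) -> connected_top d X ->
  (exists D : nat,
     (forall n s, dcell (Xs n) d s -> deg_le (Xs n) s D) /\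
     (forall s, dcell X d s -> deg_le X s D)) ->
  converges d Xs X ->
  (forall n, is_lambda d (Xs n) (lamn n)) ->
  is_lambda d X lam ->
  ( ~ specZ d X 0
    \/ (specZ d X 0 /\ forall eps, 0 < eps -> exists x, specZ d X x /\ x <> 0 /\ Rabs x < eps)
    \/ ((exists D : nat, forall n s, dcell (Xs n) (d - 1) s -> deg_le (Xs n) s D) /\
        exists mu : nat -> R, (forall n, is_lambda_low d (Xs n) (mu n)) /\
          exists c, 0 < c /\ forall n, c <= mu n) ) ->
  (* liminf_{n -> oo} lamn n <= lam *)
  forall eps, 0 < eps -> forall N : nat, exists n, (N <= n)%nat /\ lamn n <= lam + eps.
Proof.
  intros Hd HFn HUn HU _ Hconn [D [HDn HD]] Hconv Hlamn [Hlam _] Hcase eps Heps N.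
  destruct d as [|[|e]]; [lia | lia |].
  assert (HXn : forall n, bounded_degree_complex (S (S e)) D (Xs n)) by (split; auto).
  assert (HX : bounded_degree_complex (S (S e)) D X) by (split; auto).
  assert (Hpos : forall x, specZ (S (S e)) X x -> x <> 0 -> forall eta, 0 < eta ->
    exists n, (N <= n)%nat /\ lamn n <= x + eta).
  { intros x Hx Nx eta Heta. pose proof (specZ_ge0 HX x Hx).
    apply (liminf_gap_le_pos HXn HX Hconn Hconv HFn Hlamn); auto. lra. }
  destruct (Req_dec lam 0) as [->|Nlam]; [|now apply Hpos].
  destruct Hcase as [Hspec0|[[_ Hacc]|[[Dl Hlow] [mu [Hmu [c [Hc Hcmu]]]]]]].
  - contradiction.
  - destruct (Hacc (eps / 2)) as [x [Hx [Nx Hxeps]]]; [lra|].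
    destruct (Hpos x Hx Nx (eps / 2)) as [n [Hn Hle]]; [lra|].
    exists n. split; auto. pose proof (Rle_abs x). lra.
  - rewrite Rplus_0_l.
    exact (liminf_gap_le_zero HXn HX lamn mu c Hconn Hconv HFn Hlamn Hlow Hmu Hc Hcmu Hlam
      eps Heps N).
Qed.
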